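(* For each $A\in\mathcal{S}(n)$ there is a unique $\lambda=\lambda(A)\in\mathbb{R}$ such that the equation $$\max_{1\le i\le n}\left\{\lambda+G(D^2u,Du,x;A),\ |u_{x_i}|-1\right\}=0,\qquad x\in\mathbb{R}^n,$$ has a viscosity solution $u\in C(\mathbb{R}^n)$ satisfying $$\lim_{|x|\to\infty}\frac{u(x)}{\sum_{i=1}^n|x_i|}=1.$$ Moreover, associated to $\lambda(A)$ there is a convex viscosity solution $u$ of the equation (with $\lambda=\lambda(A)$) satisfying this growth condition; when $\det A\neq 0$, $u\in C^{1,\alpha}_{\mathrm{loc}}(\mathbb{R}^n)$ for each $0<\alpha<1$.
   Context: Fix $n\ge 1$ and a nonsingular real $n\times n$ matrix $\sigma$; $\sigma^t$ is its transpose. $\mathcal{S}(n)$ is the set of real symmetric $n\times n$ matrices. For $a,b\in\mathbb{R}^n$, $a\otimes b$ is the $n\times n$ matrix with entries $a_ib_j$. For $A\in\mathcal{S}(n)$ and $(X,p,x)\in\mathcal{S}(n)\times\mathbb{R}^n\times\mathbb{R}^n$, $$G(X,p,x;A):=-\tfrac12\,\mathrm{tr}\left[\sigma\sigma^t\left(A+AXA+(x+Ap)\otimes(x+Ap)\right)\right].$$ Viscosity solutions: an upper semicontinuous $u$ is a viscosity subsolution of the equation if for each $x_0\in\mathbb{R}^n$ and $\varphi\in C^2(\mathbb{R}^n)$ such that $u-\varphi$ has a local maximum at $x_0$, $\max_{1\le i\le n}\{\lambda+G(D^2\varphi(x_0),D\varphi(x_0),x_0;A),|\varphi_{x_i}(x_0)|-1\}\le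 0$. A lower semicontinuous $v$ is a viscosity supersolution if for each $y_0\in\mathbb{R}^n$ and $\psi\in C^2(\mathbb{R}^n)$ such that $v-\psi$ has a local minimum at $y_0$, $\max_{1\le i\le n}\{\lambda+G(D^2\psi(y_0),D\psi(y_0),y_0;A),|\psi_{x_i}(y_0)|-1\}\ge 0$. A viscosity solution is a continuous function that is both. *)

(* Defs.v *)
From HB Require Import structures.
From mathcomp Require Export all_boot all_order all_algebra.
From mathcomp Require Export all_classical all_reals all_analysis.

Set Implicit Arguments.
Unset Strict Implicit.
Unset Printing Implicit Defensive.

Import Order.TTheory GRing.Theory Num.Theory.
Export numFieldNormedType.Exports.

Local Open Scope classical_set_scope.
Local Open Scope ring_scope.

Section EuclideanSpace.
Context {R : realType} {n : nat}.
Implicit Types (x : 'cV[R]_n) (u : 'cV[R]_n -> R).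

(* The library norm `|x| on 'cV[R]_n is the sup norm. *)
Definition enorm x : R := Num.sqrt (\sum_(i < n) x i 0 ^+ 2).

(* The filter of neighbourhoods of infinity, i.e. |x| --> +oo. *)
Definition at_infinity : set_system 'cV[R]_n :=
  filter_from [set: R] (fun M => [set x | M < enorm x]).

Global Instance at_infinity_filter : Filter at_infinity.
Proof.
apply: filter_from_filter; first by exists 0.
move=> M N _ _; exists (Num.max M N) => // x /=.
by rewrite gt_max => /andP[].
Qed.

Definition partial (i : 'I_n) u : 'cV[R]_n -> R := 'D_(delta_mx i 0) u.

Definition grad u x : 'cV[R]_n := \col_i partial i u x.

Definition hess u x : 'M[R]_n := \matrix_(i, j) partial j (partial i u) x.

(* Continuity of u itself follows from that of its partial derivatives. *)
Definition C1 u : Prop := forall i : 'I_n,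
  (forall x, derivable u x (delta_mx i 0)) /\ continuous (partial i u).

Definition C2 u : Prop := C1 u /\ forall i, C1 (partial i u).

Definition C1alpha_loc (alpha : R) u : Prop :=
  C1 u /\
  forall K : set 'cV[R]_n, compact K -> exists C : R, forall i x y,
    K x -> K y ->
    `|partial i u x - partial i u y| <= C * enorm (x - y) `^ alpha.

Definition usc u : Prop := lower_semicontinuous (fun x => (- u x)%:E).
Definition lsc u : Prop := lower_semicontinuous (fun x => (u x)%:E).

Definition local_max_at u x0 : Prop := \forall x \near x0, u x <= u x0.
Definition local_min_at u x0 : Prop := \forall x \near x0, u x0 <= u x.

(* Viscosity notions for F (D^2 u, D u, x) = 0 on the whole space. *)
Variable F : 'M[R]_n -> 'cV[R]_n -> 'cV[R]_n -> R.

Definition viscosity_subsolution u : Prop :=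
  usc u /\
  forall x0 (phi : 'cV[R]_n -> R), C2 phi ->
    local_max_at (fun x => u x - phi x) x0 ->
    F (hess phi x0) (grad phi x0) x0 <= 0.

Definition viscosity_supersolution u : Prop :=
  lsc u /\
  forall y0 (psi : 'cV[R]_n -> R), C2 psi ->
    local_min_at (fun y => u y - psi y) y0 ->
    0 <= F (hess psi y0) (grad psi y0) y0.

Definition viscosity_solution u : Prop :=
  [/\ continuous u, viscosity_subsolution u & viscosity_supersolution u].

End EuclideanSpace.

Section Equation.
Context {R : realType} {n : nat}.
Implicit Types (a b p x : 'cV[R]_n) (sigma A X : 'M[R]_n).

Definition tensor a b : 'M[R]_n := \matrix_(i, j) (a i 0 * b j 0).

Definition G sigma X p x A : R :=
  - (2^-1 * \tr (sigma *m sigma^T *m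
      (A + A *m X *m A + tensor (x + A *m p) (x + A *m p)))).

(* The maximum over i <= n of lambda + G and the |p_i| - 1: the term
   lambda + G, which does not depend on i, is the initial value of the fold. *)
Definition pde sigma A (lambda : R) X p x : R :=
  \big[Num.max/(lambda + G sigma X p x A)]_(i < n) (`|p i 0| - 1).

Definition unit_growth (u : 'cV[R]_n -> R) : Prop :=
  u x / (\sum_(i < n) `|x i 0|) @[x --> at_infinity] --> (1 : R).

End Equation.

(* Main.v *)
(* Expanding exp shows that the logarithm of an average of exp u over the
   2m points x +- t b_j, each tilted by exp(+-t s_j . x), differs from u by
   t^2 Q(D^2 u, D u, x) + O(t^4), where m Q = -G for a suitable choice of s_j
   and b_j.  Combined with the inf-convolution with the l1 norm, which imposes
   the gradient constraint, this gives a monotone scheme that preserves convex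
   1-Lipschitz functions; the quadratic growth of Q confines the relevant
   points to a fixed ball, so discrete eigenpairs (u_t, k_t) exist with bounds
   uniform in t.  Their limits along an ultrafilter are convex viscosity
   solutions, and the second difference of u_t along b_j is O(t^2), which gives
   C^{1,1} as soon as the b_j span.

   For uniqueness, the scheme is linear in w = exp u.  Averaging w twice in each
   coordinate direction over [0, r] therefore produces W = ln w_r of class C^2
   that is an approximate smooth subsolution everywhere, and an approximate
   smooth supersolution where the gradient constraint is not active.  Testing
   an arbitrary viscosity solution v with tau W from below and with W / tau from
   above, tau < 1, and letting r -> 0 and tau -> 1 identifies its eigenvalue.
   The second test needs u in C^{1,1}; when A is singular this is arranged by
   adding small directions d e_i, whose effect disappears as d -> 0. *)

From HB Require Import structures.
Require Import Defs.
From mathcomp Require Import ring lra.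

Set Implicit Arguments.
Unset Strict Implicit.
Unset Printing Implicit Defensive.

Import Order.TTheory GRing.Theory Num.Theory.

Local Open Scope classical_set_scope.
Local Open Scope ring_scope.

(** * Dot product, l1 norm and l1 topology of column vectors *)

Section Vectors.
Context {R : realType} {n : nat}.
Implicit Types (a b x y z : 'cV[R]_n).

(** The additive eigenvalue problem of the scheme is turned into a fixed-point problem by a discount
    of size t^4, which is negligible against the t^2 of the expansion.

    In the uniqueness part, v is only continuous and has to be tested with C^2 functions, while u is
    at best C^{1,1}. Once exp u is mollified, the only defect left is the dependence of the tilt on
    x; the pairing of +t and -t makes it O(t^2 r), so it is small after division by t^2.

    The factor tau plays two roles. It opens a gap in the linear growth at infinity, so that extrema
    exist in a ball that does not depend on r. It also keeps the relevant gradient strictly inside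
    the constraint: that of tau W in the test from below, that of W in the test from above.

    For the test from above d > 0 is held fixed: extra directions only raise averages of convex
    functions, so the equation without them can still be compared. Then d is sent to 0 along a
    diagonal sequence. The eigenvalue is [#|J|] times the limit of the k_t, because the scheme
    averages over J where the trace sums. *)

Definition dot a b : R := \sum_(i < n) a i 0 * b i 0.
Definition l1norm x : R := \sum_(i < n) `|x i 0|.

Lemma dotC a b : dot a b = dot b a.
Proof. by apply: eq_bigr => i _; rewrite mulrC. Qed.

Lemma dotDr a x y : dot a (x + y) = dot a x + dot a y.
Proof. by rewrite -big_split; apply: eq_bigr => i _; rewrite mxE mulrDr. Qed.

Lemma dotZr a c x : dot a (c *: x) = c * dot a x.
Proof. by rewrite mulr_sumr; apply: eq_bigr => i _; rewrite mxE mulrCA. Qed.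

Lemma dotNr a x : dot a (- x) = - dot a x.
Proof. by rewrite -scaleN1r dotZr mulN1r. Qed.

Lemma dotBr a x y : dot a (x - y) = dot a x - dot a y.
Proof. by rewrite dotDr dotNr. Qed.

Lemma dotDl x y a : dot (x + y) a = dot x a + dot y a.
Proof. by rewrite dotC dotDr !(dotC a). Qed.

Lemma dotZl a c x : dot (c *: x) a = c * dot x a.
Proof. by rewrite dotC dotZr dotC. Qed.

Lemma dotNl a x : dot (- x) a = - dot x a.
Proof. by rewrite dotC dotNr dotC. Qed.

Lemma dot0l a : dot 0 a = 0.
Proof. by rewrite -[0](scale0r 0) dotZl mul0r. Qed.

Lemma dot0r a : dot a 0 = 0.
Proof. by rewrite dotC dot0l. Qed.

Definition dotE := (dotDr, dotDl, dotNr, dotNl, dotZr, dotZl, dot0l, dot0r).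

Lemma dot_ge0 x : 0 <= dot x x.
Proof. by apply: sumr_ge0 => i _; rewrite -expr2 sqr_ge0. Qed.

Lemma l1norm_ge0 x : 0 <= l1norm x.
Proof. exact: sumr_ge0. Qed.

Lemma l1norm0 : l1norm 0 = 0.
Proof. by rewrite /l1norm big1 // => i _; rewrite mxE normr0. Qed.

Lemma l1norm_triangle x y : l1norm (x + y) <= l1norm x + l1norm y.
Proof.
by rewrite -big_split; apply: ler_sum => i _; rewrite mxE; exact: ler_normD.
Qed.

Lemma l1normZ c x : l1norm (c *: x) = `|c| * l1norm x.
Proof. by rewrite mulr_sumr; apply: eq_bigr => i _; rewrite mxE normrM. Qed.

Lemma l1normN x : l1norm (- x) = l1norm x.
Proof. by rewrite -scaleN1r l1normZ normrN1 mul1r. Qed.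

Lemma l1normB x y : l1norm (x - y) = l1norm (y - x).
Proof. by rewrite -l1normN opprB. Qed.

Lemma l1norm_coord x i : `|x i 0| <= l1norm x.
Proof. by rewrite /l1norm (bigD1 i) //= lerDl sumr_ge0. Qed.

Lemma l1norm_delta i : l1norm (delta_mx i 0) = 1.
Proof.
rewrite /l1norm (bigD1 i) //= mxE !eqxx normr1 big1 ?addr0 // => j ji.
by rewrite mxE (negbTE ji) normr0.
Qed.

Lemma dot_bound a b : `|dot a b| <= l1norm a * l1norm b.
Proof.
apply: (le_trans (ler_norm_sum _ _ _)); rewrite mulr_suml.
apply: ler_sum => i _; rewrite normrM ler_wpM2l //; exact: l1norm_coord.
Qed.


Lemma dot_coord x i : x i 0 ^+ 2 <= dot x x.
Proof.
rewrite /dot (bigD1 i) //= -expr2 lerDl sumr_ge0 // => j _.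
by rewrite -expr2 sqr_ge0.
Qed.

Lemma enormE x : enorm x = Num.sqrt (dot x x).
Proof. by congr Num.sqrt; apply: eq_bigr => i _; rewrite expr2. Qed.

Lemma l1norm_le_enorm x : l1norm x <= n%:R * enorm x.
Proof.
rewrite mulr_natl -[n in _ *+ n]card_ord -sumr_const; apply: ler_sum => i _.
by rewrite enormE -sqrtr_sqr ler_wsqrtr // dot_coord.
Qed.

Lemma enorm_le_l1norm x : enorm x <= l1norm x.
Proof.
rewrite enormE -(ger0_norm (l1norm_ge0 x)) -sqrtr_sqr ler_wsqrtr // expr2.
exact: le_trans (ler_norm _) (dot_bound _ _).
Qed.

Lemma l1norm_sqr_le x : l1norm x ^+ 2 <= n%:R ^+ 2 * dot x x.
Proof.
rewrite -[dot x x]sqr_sqrtr ?dot_ge0 // -enormE -exprMn.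
by rewrite lerXn2r ?nnegrE ?l1norm_ge0 // ?mulr_ge0 ?sqrtr_ge0 // l1norm_le_enorm.
Qed.

Lemma mx_norm_bigmax p q (z : 'M[R]_(p, q)) : `|z| = \big[Num.max/0]_ij `|z ij.1 ij.2|.
Proof. exact: mx_normrE. Qed.

Lemma norm_coord x i : `|x i 0| <= `|x|.
Proof.
rewrite mx_norm_bigmax.
exact: (le_bigmax _ (fun ij : _ * _ => `|x ij.1 ij.2|) (i, 0)).
Qed.

Lemma l1norm_le_norm x : l1norm x <= n%:R * `|x|.
Proof.
rewrite mulr_natl -[n in _ *+ n]card_ord -sumr_const; apply: ler_sum => i _.
exact: norm_coord.
Qed.

Lemma norm_le_l1norm x : `|x| <= l1norm x.
Proof.
rewrite mx_norm_bigmax; apply/bigmax_leP; split.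
  exact: l1norm_ge0.
by move=> [i j] _ /=; rewrite (ord1 j) l1norm_coord.
Qed.

(** The gradient constraint is dual to the l1 norm, so later neighbourhoods are closed l1 balls
    instead of sup-norm balls. Dividing the radius by [n.+1] rather than [n] keeps it meaningful
    when n = 0. *)
Lemma nbhs_l1P x (P : set 'cV[R]_n) :
  nbhs x P <-> exists2 e, 0 < e & forall y, l1norm (y - x) <= e -> P y.
Proof.
split.
  move=> /nbhs_ballP[e /= e0 eP]; exists (e / 2); first by rewrite divr_gt0.
  move=> y yx; apply: eP; rewrite -ball_normE /= distrC.
  by rewrite (le_lt_trans (norm_le_l1norm _)) // (le_lt_trans yx) // ltr_pdivrMr // ltr_pMr // ltr1n.
move=> [e e0 eP]; apply/nbhs_ballP; exists (e / n.+1%:R) => /=.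
  by rewrite divr_gt0.
move=> y; rewrite -ball_normE /= distrC => yx; apply: eP.
rewrite (le_trans (l1norm_le_norm _)) // (@le_trans _ _ (n.+1%:R * `|y - x|)) //.
  by rewrite ler_wpM2r // ler_nat.
by rewrite -ler_pdivlMl // mulrC ltW.
Qed.

Lemma l1norm_lip x y : `|l1norm x - l1norm y| <= l1norm (x - y).
Proof.
rewrite ler_norml; have := l1norm_triangle (x - y) y.
have := l1norm_triangle (y - x) x; rewrite !subrK (l1normB x y) => *.
by apply/andP; split; lra.
Qed.

Lemma lipschitz_l1_continuous (L : R) (f : 'cV[R]_n -> R) :
  (forall x y, `|f x - f y| <= L * l1norm (x - y)) -> continuous f.
Proof.
move=> fL x; apply/(@cvgrPdist_le _ _ _ (nbhs x)) => /= e e0; apply/nbhs_l1P.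
have L0 : 0 < `|L| + 1 by rewrite ltr_wpDl.
exists (e / (`|L| + 1)) => [|y yx]; first by rewrite divr_gt0.
rewrite (le_trans (fL _ _)) // l1normB.
have := l1norm_ge0 (y - x); have := ler_norm L.
by move: yx; rewrite ler_pdivlMr //; nra.
Qed.

Lemma l1norm_continuous : continuous l1norm.
Proof.
by apply: (@lipschitz_l1_continuous 1) => x y; rewrite mul1r l1norm_lip.
Qed.

(** A closed subset of a cube; compactness of the cube is taken from row vectors and carried over by
    transposition, which is continuous. *)
Lemma l1ball_compact M : compact [set x : 'cV[R]_n | l1norm x <= M].
Proof.
pose A (i : 'I_n) := `[- M, M]%classic : set R.
have cA : compact [set v : 'rV[R]_n | forall i, A i (v ord0 i)].
  by apply: rV_compact => i; exact: segment_compact.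
have cT : continuous (fun v : 'rV[R]_n => v^T : 'cV[R]_n).
  move=> v B /= /nbhs_l1P[e e0 eB]; apply/nbhs_ballP.
  exists (e / n.+1%:R) => /=; first by rewrite divr_gt0.
  move=> w; rewrite -ball_normE /= distrC => wv; apply: eB.
  rewrite (le_trans (l1norm_le_norm _)) //.
  have -> : `|w^T - v^T| = `|w - v|.
    rewrite -linearB /= !mx_norm_bigmax.
    apply/eqP; rewrite eq_le; apply/andP; split.
      apply/bigmax_leP; split; first exact: bigmax_ge_id.
      move=> [i j] _ /=; rewrite (ord1 j) mxE.
      exact: (le_bigmax _ (fun ij : _ * _ => `|(w - v) ij.1 ij.2|) (0, i)).
    apply/bigmax_leP; split; first exact: bigmax_ge_id.
    move=> [i j] _ /=; rewrite (ord1 i); have -> : (w - v) 0 j = (w - v)^T j 0 by rewrite [RHS]mxE.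
    exact: (le_bigmax _ (fun ij : _ * _ => `|(w - v)^T ij.1 ij.2|) (j, 0)).
  rewrite (@le_trans _ _ (n.+1%:R * `|w - v|)) //.
    by rewrite ler_wpM2r // ler_nat.
  by rewrite -ler_pdivlMl // mulrC ltW.
have cAT : compact [set x : 'cV[R]_n | forall i, A i (x i 0)].
  have -> : [set x : 'cV[R]_n | forall i, A i (x i 0)] =
      (fun v : 'rV[R]_n => v^T) @` [set v : 'rV[R]_n | forall i, A i (v ord0 i)].
    apply/seteqP; split => [x Ax|_ [v Av <-] i]; last by rewrite mxE.
    by exists x^T; [move=> i; rewrite mxE|rewrite trmxK].
  by apply: continuous_compact => //; exact: continuous_subspaceT.
apply: subclosed_compact cAT _.
  apply: (@closed_comp _ _ l1norm [set y : R | y <= M]); last exact: closed_le.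
  by move=> x _; exact: l1norm_continuous.
move=> x /= xM i; rewrite /A /= in_itv /= -ler_norml.
exact: le_trans (l1norm_coord _ _) xM.
Qed.

End Vectors.

(** * The tilted random walk *)

Section ExpBounds.
Context {R : realType}.
Implicit Types x y p : R.

(** Combines [(1 - x) * expR x <= 1] with the fact that the product of [1 - x] and the right-hand
    side is [1 + x ^+ 2 - 2 * x ^+ 3], which is at least 1 for [x <= 1/2], however negative x may
    be. *)
Lemma expR_le_quad x : x <= 2^-1 -> expR x <= 1 + x + 2 * x ^+ 2.
Proof.
move=> x2; have := expR_ge1Dx (- x); rewrite expRN => h.
have e0 := expR_gt0 x.
have : (1 - x) * expR x <= 1.
  by have := ler_wpM2r (ltW e0) h; rewrite mulVf ?gt_eqF.
nra.
Qed.

(** The excess over 2 is the square of [expR (x / 2) - expR (- (x / 2))], and for nonnegative x this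
    difference is at least [x / 2]. This quadratic growth is what later confines near-minimisers. *)
Lemma expR_cosh_ge x : 2 + x ^+ 2 / 4 <= expR x + expR (- x).
Proof.
wlog x0 : x / 0 <= x => [hw|].
  have [/hw //|/ltW x0] := leP 0 x.
  by have := hw (- x); rewrite oppr_ge0 sqrrN opprK [expR _ + _]addrC => /(_ x0).
have e0 := expR_gt0 (x / 2).
have -> : expR x = expR (x / 2) ^+ 2.
  by rewrite expr2 -expRD; congr expR; lra.
have -> : expR (- x) = expR (- (x / 2)) ^+ 2.
  by rewrite expr2 -expRD; congr expR; lra.
have h1 : expR (x / 2) * expR (- (x / 2)) = 1 by rewrite -expRD subrr expR0.
have h2 := expR_ge1Dx (x / 2).
have h3 : expR (- (x / 2)) <= 1 by rewrite expR_le1; lra.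
have h4 : x / 2 <= expR (x / 2) - expR (- (x / 2)) by lra.
have h5 : 0 <= x / 2 by lra.
nra.
Qed.

Lemma expR_pair_ge x y :
  expR ((x + y) / 2) * (2 + ((x - y) / 2) ^+ 2 / 4) <= expR x + expR y.
Proof.
have -> : expR x = expR ((x + y) / 2) * expR ((x - y) / 2).
  by rewrite -expRD; congr expR; lra.
have -> : expR y = expR ((x + y) / 2) * expR (- ((x - y) / 2)).
  by rewrite -expRD; congr expR; lra.
by rewrite -mulrDr ler_wpM2l ?expR_ge0 // expR_cosh_ge.
Qed.

Lemma expR_convex p x y : 0 <= p <= 1 ->
  expR (p * x + (1 - p) * y) <= p * expR x + (1 - p) * expR y.
Proof.
move=> /andP[p0 p1]; set z := p * x + (1 - p) * y.
have hx : expR x = expR z * expR (x - z) by rewrite -expRD; congr expR; lra.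
have hy : expR y = expR z * expR (y - z) by rewrite -expRD; congr expR; lra.
have := expR_ge1Dx (x - z); have := expR_ge1Dx (y - z).
rewrite hx hy; set a := expR (x - z); set c := expR (y - z) => h1 h2.
have : 1 <= p * a + (1 - p) * c.
  have : p * (1 + (x - z)) + (1 - p) * (1 + (y - z)) = 1 by rewrite /z; ring.
  nra.
have := expR_gt0 z; nra.
Qed.

End ExpBounds.

Section Scheme.
Context {R : realType} {n : nat} {J : finType}.
Implicit Types (f g u : 'cV[R]_n -> R) (x y z : 'cV[R]_n).

Definition cvx f := forall p x y, 0 <= p <= 1 ->
  f (p *: x + (1 - p) *: y) <= p * f x + (1 - p) * f y.

(** The integrated form of the constraint that all partial derivatives lie in [-1, 1]. *)
Definition lip1 f := forall x y, f x <= f y + l1norm (x - y).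

Lemma lip1_norm f x y : lip1 f -> `|f x - f y| <= l1norm (x - y).
Proof.
move=> fL; rewrite ler_norml; have := fL x y; have := fL y x.
by rewrite (l1normB y x) => *; apply/andP; split; lra.
Qed.

Lemma cvx_mid f x y : cvx f -> 0 <= f (x + y) + f (x - y) - 2 * f x.
Proof.
move=> fC; have := fC 2^-1 (x + y) (x - y).
have -> : 2^-1 *: (x + y) + (1 - 2^-1) *: (x - y) = x.
  by apply/matrixP => i j; rewrite !mxE; lra.
move=> /(_ _); have -> : 0 <= (2^-1 : R) <= 1 by apply/andP; split; lra.
by move=> /(_ isT); lra.
Qed.

Variables (s b : J -> 'cV[R]_n).

(* One step of length t of the random walk along +-b_j, tilted so that it is
   consistent with the quadratic Hamiltonian (s_j . x + b_j . p)^2. *)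
Definition stepe (t : R) f x j : R :=
  expR (f (x + t *: b j) + t * dot (s j) x + t ^+ 2 / 2 * dot (s j) (b j)).

Definition avge t f x : R :=
  (\sum_j (stepe t f x j + stepe (- t) f x j)) / (2 * #|J|%:R).

Definition logavg t f x : R := ln (avge t f x).

Hypothesis J0 : (0 < #|J|)%N.

Let m0 : (0 : R) < #|J|%:R. Proof. by rewrite ltr0n. Qed.
Let m20 : (0 : R) < 2 * #|J|%:R. Proof. by rewrite mulr_gt0. Qed.

Lemma stepe_gt0 t f x j : 0 < stepe t f x j.
Proof. exact: expR_gt0. Qed.

Lemma avge_gt0 t f x : 0 < avge t f x.
Proof.
rewrite divr_gt0 //; case/card_gt0P : (J0) => j _.
rewrite (bigD1 j) //= ltr_pwDl ?addr_gt0 ?stepe_gt0 //.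
by apply: sumr_ge0 => i _; rewrite addr_ge0 // ltW // stepe_gt0.
Qed.

Lemma expR_logavg t f x : expR (logavg t f x) = avge t f x.
Proof. by rewrite lnK // posrE avge_gt0. Qed.

Lemma le_logavg t f x (c : R) : (logavg t f x <= c) = (avge t f x <= expR c).
Proof. by rewrite -ler_expR expR_logavg. Qed.

Lemma ge_logavg t f x (c : R) : (c <= logavg t f x) = (expR c <= avge t f x).
Proof. by rewrite -ler_expR expR_logavg. Qed.

Lemma avge_addc t f x (c : R) :
  avge t (fun z => f z + c) x = avge t f x * expR c.
Proof.
rewrite /avge mulrAC; congr (_ / _); rewrite mulr_suml; apply: eq_bigr => j _.
by rewrite mulrDl -!expRD; congr (expR _ + expR _); ring.
Qed.

Lemma logavg_addc t f x (c : R) :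
  logavg t (fun z => f z + c) x = logavg t f x + c.
Proof. by rewrite /logavg avge_addc lnM ?posrE ?avge_gt0 ?expR_gt0 // expRK. Qed.

Lemma avge_mono t f g x :
  (forall j, f (x + t *: b j) <= g (x + t *: b j) /\
             f (x - t *: b j) <= g (x - t *: b j)) ->
  avge t f x <= avge t g x.
Proof.
move=> fg; rewrite /avge ler_wpM2r ?invr_ge0 ?(ltW m20) //; apply: ler_sum => j _.
have [h1 h2] := fg j.
by apply: lerD; rewrite ler_expR !lerD2r // scaleNr.
Qed.

Lemma logavg_mono t f g x : (forall y, f y <= g y) ->
  logavg t f x <= logavg t g x.
Proof.
move=> fg; by rewrite ler_ln ?posrE ?avge_gt0 // avge_mono.
Qed.

Lemma logavg_le_addc t f g x (c : R) : (forall y, f y <= g y + c) ->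
  logavg t f x <= logavg t g x + c.
Proof. by move=> fg; rewrite -logavg_addc; exact: logavg_mono. Qed.

(* Convexity of log-sum-exp, proved by normalising the two sums to 1. *)
Lemma logavg_cvx t f : cvx f -> cvx (logavg t f).
Proof.
move=> fC p x y p01; rewrite le_logavg.
set X := logavg t f x; set Y := logavg t f y; set z := _ + _.
have step (r : R) j : stepe r f z j <= expR (p * X + (1 - p) * Y) *
    (p * (stepe r f x j * expR (- X)) + (1 - p) * (stepe r f y j * expR (- Y))).
  rewrite -!expRD; set A := f (x + _) + _ + _; set B := f (y + _) + _ + _.
  have h : f (z + r *: b j) + r * dot (s j) z + r ^+ 2 / 2 * dot (s j) (b j) <=
      (p * X + (1 - p) * Y) + (p * (A - X) + (1 - p) * (B - Y)).
    have -> : z + r *: b j = p *: (x + r *: b j) + (1 - p) *: (y + r *: b j).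
      by apply/matrixP => i k; rewrite /z !mxE; ring.
    have := fC _ (x + r *: b j) (y + r *: b j) p01.
    by rewrite /z !dotE /A /B; lra.
  apply: (@le_trans _ _ (expR (p * X + (1 - p) * Y + (p * (A - X) + (1 - p) * (B - Y))))).
    by rewrite ler_expR.
  by rewrite [leLHS]expRD ler_wpM2l ?expR_ge0 // expR_convex.
have E1 w : avge t f w * expR (- logavg t f w) = 1.
  by rewrite expRN expR_logavg divff // gt_eqF // avge_gt0.
have -> : expR (p * X + (1 - p) * Y) = expR (p * X + (1 - p) * Y) *
    (p * (avge t f x * expR (- X)) + (1 - p) * (avge t f y * expR (- Y))).
  by rewrite !E1; ring.
have d0 : 2 * #|J|%:R != 0 :> R by rewrite gt_eqF.
rewrite /avge ler_pdivrMr //.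
set S := \sum_j (stepe t f x j + _); set S' := \sum_j (stepe t f y j + _).
set K := expR (p * X + _) in step *.
have cancel_den (S1 S2 k a c e : R) : e != 0 ->
    k * (p * (S1 / e * a) + (1 - p) * (S2 / e * c)) * e = k * (p * (S1 * a) + (1 - p) * (S2 * c)).
  by move=> e0; field.
have distr (a1 a2 c1 c2 e1 e2 : R) : p * (a1 * e1) + (1 - p) * (c1 * e2) +
    (p * (a2 * e1) + (1 - p) * (c2 * e2)) = p * ((a1 + a2) * e1) + (1 - p) * ((c1 + c2) * e2).
  by ring.
rewrite cancel_den // /S /S' !mulr_suml !mulr_sumr -big_split mulr_sumr.
apply: ler_sum => j _ /=; apply: (le_trans (lerD (step t j) (step (- t) j))).
rewrite -mulrDr ler_wpM2l //; first exact: expR_ge0.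
by rewrite le_eqVlt; apply/orP; left; apply/eqP; exact: distr.
Qed.

Section PairBounds.
Variables (t C0 : R).
Hypothesis sb : forall j, `|dot (s j) (b j)| <= 2 * C0.

(** The mean of the two exponents contains half the second difference of f, their half difference
    contains slope plus drift. By convexity both contributions are nonnegative, so an upper bound on
    the average controls each. [C0] absorbs the tilt term [t ^+ 2 / 2 * dot (s j) (b j)]. *)
Lemma pair_ge f x j : cvx f ->
  expR (f x - t ^+ 2 * C0) *
    (2 + (f (x + t *: b j) + f (x - t *: b j) - 2 * f x) +
     ((f (x + t *: b j) - f (x - t *: b j)) / 2 + t * dot (s j) x) ^+ 2 / 4)
  <= stepe t f x j + stepe (- t) f x j.
Proof.
move=> fC; apply: le_trans (expR_pair_ge _ _).
rewrite scaleNr; set D := _ - 2 * f x.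
set X := (_ - _) / 2 + _; set c := dot (s j) (b j).
have D0 : 0 <= D by exact: cvx_mid.
rewrite [X in _ <= expR X * _](_ : _ =
    (f x - t ^+ 2 * C0) + (D / 2 + t ^+ 2 * (C0 + c / 2))); last by rewrite /D; field.
rewrite [X in _ <= _ * (2 + X ^+ 2 / 4)](_ : _ = X); last by rewrite /X; field.
rewrite [in leRHS]expRD -[leRHS]mulrA ler_wpM2l ?expR_ge0 //.
have c0 : 0 <= C0 + c / 2 by have := sb j; rewrite -/c ler_norml => /andP[? ?]; lra.
have t0 : 0 <= t ^+ 2 * (C0 + c / 2) by rewrite mulr_ge0 // sqr_ge0.
have := expR_ge1Dx (D / 2 + t ^+ 2 * (C0 + c / 2)).
have := sqr_ge0 X; nra.
Qed.

Lemma logavg_ge f x : cvx f -> f x - t ^+ 2 * C0 <= logavg t f x.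
Proof.
move=> fC; rewrite ge_logavg ler_pdivlMr //.
have -> : expR (f x - t ^+ 2 * C0) * (2 * #|J|%:R) =
    \sum_(j : J) expR (f x - t ^+ 2 * C0) * 2.
  by rewrite sumr_const -mulr_natr; ring.
apply: ler_sum => j _; apply: le_trans (pair_ge x j fC).
rewrite ler_wpM2l ?expR_ge0 //; have := cvx_mid x (t *: b j) fC.
by set X := _ + t * _; have := sqr_ge0 X; lra.
Qed.

(** Each contribution [D j] is at most the sum of all of them, which is at most [2 * #|J|] times
    [expR a - 1] with [a = t ^+ 2 * (C + C0)]. Since [a <= 1/2], [expR a - 1] is at most [2 * a],
    whence the factor 4. *)
Lemma logavg_le_pairs f x (C : R) j : cvx f ->
  t ^+ 2 * (C + C0) <= 2^-1 -> 0 <= C + C0 ->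
  logavg t f x <= f x + t ^+ 2 * C ->
  (f (x + t *: b j) + f (x - t *: b j) - 2 * f x) +
  ((f (x + t *: b j) - f (x - t *: b j)) / 2 + t * dot (s j) x) ^+ 2 / 4
  <= 4 * #|J|%:R * (C + C0) * t ^+ 2.
Proof.
move=> fC tC C0_ge0 h.
pose D k := (f (x + t *: b k) + f (x - t *: b k) - 2 * f x) +
  ((f (x + t *: b k) - f (x - t *: b k)) / 2 + t * dot (s k) x) ^+ 2 / 4.
have D0 k : 0 <= D k.
  by have := cvx_mid x (t *: b k) fC; rewrite /D;
    set X := _ + t * _; have := sqr_ge0 X; lra.
have sD : expR (f x - t ^+ 2 * C0) * \sum_k (2 + D k) <=
    expR (f x + t ^+ 2 * C) * (2 * #|J|%:R).
  move: h; rewrite le_logavg ler_pdivrMr //; apply: le_trans.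
  rewrite mulr_sumr; apply: ler_sum => k _; apply: le_trans (pair_ge x k fC).
  by rewrite /D addrA.
have : \sum_k (2 + D k) <= expR (t ^+ 2 * (C + C0)) * (2 * #|J|%:R).
  rewrite -(ler_pM2l (expR_gt0 (f x - t ^+ 2 * C0))) [leRHS]mulrA -expRD.
  by apply: le_trans sD _; rewrite ler_wpM2r ?(ltW m20) // ler_expR; lra.
rewrite big_split /= sumr_const -[2 *+ _]mulr_natr.
have : D j <= \sum_k D k by rewrite (bigD1 j) //= lerDl sumr_ge0.
rewrite -/(D j).
have a0 : 0 <= t ^+ 2 * (C + C0) by rewrite mulr_ge0 // sqr_ge0.
have := expR_le_quad tC; set a := t ^+ 2 * _ in a0 tC * => hE.
have -> : 4 * #|J|%:R * (C + C0) * t ^+ 2 = 4 * #|J|%:R * a by rewrite /a; ring.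
have {}hE : expR a <= 1 + 2 * a by nra.
have := m0; set m := #|J|%:R; set d := D j; set S := \sum_k D k; set e := expR a.
move=> mp dS Se; apply: (le_trans dS).
have : (e - 1) * (2 * m) <= 2 * a * (2 * m).
  by rewrite ler_wpM2r; [|lra|rewrite /e; lra].
by move: Se; rewrite -/m; lra.
Qed.

End PairBounds.
End Scheme.

(** * Eigenpairs of the discrete scheme *)

Section Huber.
Context {R : realType}.
Implicit Types r : R.

Definition clip r : R := if r <= -1 then -1 else if 1 <= r then 1 else r.
(** The Huber function: the inf-convolution of [y ^+ 2 / 2] with the absolute value. [clip r] is
    both the minimiser and the derivative at r. *)
Definition hub r : R := clip r ^+ 2 / 2 + `|r - clip r|.

Variant hub_spec r : R -> R -> Prop :=
| HubLow of r <= -1 : hub_spec r (-1) (- r - 2^-1)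
| HubHigh of 1 <= r : hub_spec r 1 (r - 2^-1)
| HubMid of -1 <= r <= 1 : hub_spec r r (r ^+ 2 / 2).

Lemma hubP r : hub_spec r (clip r) (hub r).
Proof.
rewrite /hub /clip; have [h|h] := leP r (-1).
  have -> : (-1) ^+ 2 / 2 + `|r - -1| = - r - 2^-1 by rewrite ler0_norm; lra.
  exact: HubLow.
have [h'|h'] := leP 1 r.
  have -> : 1 ^+ 2 / 2 + `|r - 1| = r - 2^-1 by rewrite ger0_norm; lra.
  exact: HubHigh.
rewrite subrr normr0 addr0; apply: HubMid; apply/andP; split; lra.
Qed.

Lemma clip_norm r : `|clip r| <= 1.
Proof. by case: hubP => h; rewrite ?normrN ?normr1 // ler_norml. Qed.

Lemma hub_le_norm r : hub r <= `|r|.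
Proof.
case: hubP => h; first by rewrite ler0_norm; lra.
  by rewrite ger0_norm; lra.
move/andP: h => [h1 h2]; have [r0|r0] := leP 0 r.
  by rewrite ger0_norm //; nra.
by rewrite ltr0_norm //; nra.
Qed.

Lemma norm_le_hub r : `|r| <= hub r + 2^-1.
Proof.
case: hubP => h; first by rewrite ler0_norm; lra.
  by rewrite ger0_norm; lra.
have := sqr_ge0 (r - 1); have := sqr_ge0 (r + 1).
by have [r0|r0] := leP 0 r; [rewrite ger0_norm|rewrite ltr0_norm] => //; lra.
Qed.

Lemma hub_le_sqr r : hub r <= r ^+ 2 / 2.
Proof. by case: hubP => h //; have := sqr_ge0 (r - 1); have := sqr_ge0 (r + 1); lra. Qed.

Lemma hub_ge0 r : 0 <= hub r.
Proof. by case: hubP => h; rewrite ?divr_ge0 ?sqr_ge0 //; lra. Qed.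

Lemma hub_clip r : hub (clip r) = clip r ^+ 2 / 2.
Proof.
have := clip_norm r; rewrite ler_norml => /andP[h1 h2].
have [h|h|//] := hubP (clip r).
  by rewrite (_ : clip r = -1); lra.
by rewrite (_ : clip r = 1); lra.
Qed.

Lemma hub_subgrad r q : hub q + clip q * (r - q) <= hub r.
Proof.
by case: (hubP q) => h; case: (hubP r) => h'; try (move/andP: h => [h h1]);
  try (move/andP: h' => [h' h1']); have := sqr_ge0 (r - q);
  have := sqr_ge0 (r - 1); have := sqr_ge0 (r + 1); have := sqr_ge0 (q - 1);
  have := sqr_ge0 (q + 1); nra.
Qed.

Lemma hub_cvx p r q : 0 <= p <= 1 ->
  hub (p * r + (1 - p) * q) <= p * hub r + (1 - p) * hub q.
Proof.
move=> /andP[p0 p1]; set z := _ + _.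
have h1 := hub_subgrad r z; have h2 := hub_subgrad q z.
have : p * (r - z) + (1 - p) * (q - z) = 0 by rewrite /z; ring.
move: h1 h2; set c := clip z; set a := hub z; set a1 := hub r; set a2 := hub q.
move=> h1 h2 e.
have : p * (a + c * (r - z)) + (1 - p) * (a + c * (q - z)) <= p * a1 + (1 - p) * a2.
  by apply: lerD; rewrite ler_wpM2l // subr_ge0.
suff -> : p * (a + c * (r - z)) + (1 - p) * (a + c * (q - z)) = a by [].
by rewrite -[RHS]addr0 -(mulr0 c) -e; ring.
Qed.

End Huber.

Section DiscretePair.
Context {R : realType} {n : nat} {J : finType}.
Implicit Types (f g u : 'cV[R]_n -> R) (x y z : 'cV[R]_n).

Definition huber x : R := \sum_(i < n) hub (x i 0).

Lemma huber_le_l1norm x : huber x <= l1norm x.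
Proof. by apply: ler_sum => i _; exact: hub_le_norm. Qed.

Lemma l1norm_le_huber x : l1norm x <= huber x + n%:R.
Proof.
rewrite -[n in n%:R]card_ord -[_%:R]sumr_const -big_split; apply: ler_sum => i _ /=.
by have := norm_le_hub (x i 0); lra.
Qed.

Lemma huber_ge0 x : 0 <= huber x.
Proof. by apply: sumr_ge0 => i _; exact: hub_ge0. Qed.

Lemma huber0 : huber 0 = 0.
Proof.
have := huber_le_l1norm 0; rewrite l1norm0; have := huber_ge0 0; lra.
Qed.

Lemma huber_le_dot x : huber x <= dot x x / 2.
Proof.
rewrite /dot mulr_suml; apply: ler_sum => i _.
by rewrite -expr2 hub_le_sqr.
Qed.

Lemma huber_cvx : cvx huber.
Proof.
move=> p x y p01; rewrite !mulr_sumr -big_split; apply: ler_sum => i _ /=.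
by rewrite !mxE hub_cvx.
Qed.

(* Far from the origin the Huber function has slopes +-1, so there the
   inf-convolution with the l1 norm reduces it to the unit cube. *)
Lemma huber_cube x : exists y, [/\ l1norm y <= n%:R, huber y = dot y y / 2
  & huber x = huber y + l1norm (x - y)].
Proof.
exists (\col_i clip (x i 0)); split.
- rewrite -[n in n%:R]card_ord -[_%:R]sumr_const; apply: ler_sum => i _.
  by rewrite mxE clip_norm.
- rewrite /dot mulr_suml; apply: eq_bigr => i _.
  by rewrite mxE hub_clip expr2.
rewrite -big_split; apply: eq_bigr => i _ /=.
by rewrite !mxE hub_clip.
Qed.

(** The largest [lip1] minorant of f. [inf] takes a default value on sets that are not bounded
    below, so the lemmas that follow carry a lower bound c of f. *)
Definition infconv f x : R := inf [set f y + l1norm (x - y) | y in setT].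

Section Infconv.
Variables (f : 'cV[R]_n -> R) (c : R).
Hypothesis fc : forall x, c <= f x.

Let inf_has x : has_inf [set f y + l1norm (x - y) | y in setT].
Proof.
split; first by exists (f x + l1norm (x - x)); exists x.
exists c => _ [y _ <-]; rewrite -[leLHS]addr0 lerD //; exact: l1norm_ge0.
Qed.

Lemma infconv_le x y : infconv f x <= f y + l1norm (x - y).
Proof. by apply: ge_inf; [case: (inf_has x)|exists y]. Qed.

Lemma infconv_adherent x e : 0 < e ->
  exists y, f y + l1norm (x - y) < infconv f x + e.
Proof. by move=> e0; have [_ [y _ <-]] := inf_adherent e0 (inf_has x); exists y. Qed.

Lemma infconv_ge x : c <= infconv f x.
Proof.
apply: lb_le_inf => [|_ [y _ <-]].
  by exists (f x + l1norm (x - x)); exists x.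
rewrite -[leLHS]addr0 lerD //; exact: l1norm_ge0.
Qed.

Lemma infconv_cvx : cvx f -> cvx (infconv f).
Proof.
move=> fC p x y /[dup] p01 /andP[p0 p1]; apply/ler_addgt0Pr => e e0.
have [x' hx] := infconv_adherent x e0; have [y' hy] := infconv_adherent y e0.
apply: (le_trans (infconv_le _ (p *: x' + (1 - p) *: y'))).
have := fC _ x' y' p01.
have -> : p *: x + (1 - p) *: y - (p *: x' + (1 - p) *: y') =
    p *: (x - x') + (1 - p) *: (y - y').
  by apply/matrixP => i j; rewrite !mxE; ring.
have := l1norm_triangle (p *: (x - x')) ((1 - p) *: (y - y')).
rewrite !l1normZ (ger0_norm p0) ger0_norm ?subr_ge0 //.
set a := l1norm (x - x') in hx *; set a' := l1norm (y - y') in hy *.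
set v := f x' in hx *; set v' := f y' in hy *.
set w := infconv f x in hx *; set w' := infconv f y in hy *.
have : p * (v + a) + (1 - p) * (v' + a') <= p * (w + e) + (1 - p) * (w' + e).
  by apply: lerD; rewrite ler_wpM2l ?subr_ge0 // ltW.
lra.
Qed.

End Infconv.

(** Approximate eigenpair of the composition of [logavg] and [infconv]. [dp_sub] and [dp_sup] are
    the two inequalities; in [dp_sup] the infimum is represented by a point y, and the t^4 terms
    absorb the discount and the possible failure of attainment. A single C makes all bounds uniform
    in t. *)
Record dpair (s : J -> 'cV[R]_n) (C t : R) (b : J -> 'cV[R]_n)
    (u : 'cV[R]_n -> R) (k : R) : Prop := Dpair {
  dp_cvx : cvx u;
  dp_lip : lip1 u;
  dp_0 : u 0 = 0;
  dp_k : `|k| <= C;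
  dp_growth : forall x, l1norm x - C <= u x;
  dp_sub : forall x, u x + t ^+ 2 * k <= logavg s b t u x + C * t ^+ 4;
  dp_sup : forall x, exists y,
    logavg s b t u y + l1norm (x - y) <= u x + t ^+ 2 * k + C * t ^+ 4;
  dp_lower : forall x, u x - C * t ^+ 2 <= logavg s b t u x;
  dp_sc : forall x j,
    u (x + t *: b j) + u (x - t *: b j) - 2 * u x <= C * t ^+ 2 }.

(** * Discounted fixed point and its bounds uniform in t *)

Section Existence.
Variables (s b : J -> 'cV[R]_n) (S B g : R) (t : R).
Hypothesis J0 : (0 < #|J|)%N.
Hypothesis sS : forall j, l1norm (s j) <= S.
Hypothesis bB : forall j, l1norm (b j) <= B.
Hypothesis S0 : 0 <= S.
Hypothesis B0 : 0 <= B.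
Hypothesis coer : forall y M, (forall j, `|dot (s j) y| <= M) -> l1norm y <= g * M.
Hypothesis g0 : 0 <= g.
Hypothesis t0 : 0 < t.
Hypothesis t1 : t <= 1.

(** [B1] bounds the first-order coefficient [dot y (b j) + dot (s j) y] on the l1 ball of radius n,
    which contains the point produced by [huber_cube]. [K] bounds the growth of [huber] in one step
    there and, later, k from above. *)
Let B1 := (B + S) * n%:R.
Let C0 := S * B.
Let K := 2 * B1 ^+ 2 + B ^+ 2 + C0.
Hypothesis tB1 : t * B1 <= 2^-1.

Let m := #|J|%:R : R.
(** [C1] bounds the excess at a near-minimiser: K comes from the eigenvalue, 1 and n from the t^4
    errors of non-attainment and of the discount. [C2] is the bound that [logavg_le_pairs] then
    gives. *)
Let C1 := K + 1 + n%:R.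
Let C2 := 4 * m * (C1 + C0).
Hypothesis tC1 : t ^+ 2 * (C1 + C0) <= 2^-1.

Let H := logavg s b t.

Let sb j : `|dot (s j) (b j)| <= 2 * C0.
Proof.
apply: (le_trans (dot_bound _ _)); apply: (@le_trans _ _ (S * B)).
  by rewrite ler_pM ?l1norm_ge0.
by have := mulr_ge0 S0 B0; rewrite /C0; lra.
Qed.

Let C00 : 0 <= C0. Proof. by rewrite mulr_ge0. Qed.
Let B10 : 0 <= B1. Proof. by rewrite mulr_ge0 // addr_ge0. Qed.
Let K0 : 0 <= K.
Proof. by rewrite /K; have := sqr_ge0 B1; have := sqr_ge0 B; have := C00; lra. Qed.
Let m0 : 0 <= m. Proof. by []. Qed.

(** At the neighbours of y, [huber] is replaced by half the squared Euclidean norm, which dominates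
    it and agrees with it at y. The exponents are then explicit and the first-order terms of the
    steps t and -t cancel, leaving [2 * B1 ^+ 2] from the quadratic error of exp and [B ^+ 2 + C0]
    from the second-order terms. *)
Lemma logavg_huber y : l1norm y <= n%:R -> huber y = dot y y / 2 ->
  H huber y <= huber y + t ^+ 2 * K.
Proof.
move=> yn hy; rewrite le_logavg // ler_pdivrMr ?mulr_gt0 ?ltr0n //.
set e := expR _; have -> : e * (2 * #|J|%:R) = \sum_(j : J) 2 * e.
  by rewrite sumr_const -mulr_natr; ring.
apply: ler_sum => j _; rewrite /stepe.
pose c1 := dot y (b j) + dot (s j) y.
pose c2 := (dot (b j) (b j) + dot (s j) (b j)) / 2.
have step r : r ^+ 2 = t ^+ 2 -> expR (huber (y + r *: b j) + r * dot (s j) y +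
    r ^+ 2 / 2 * dot (s j) (b j)) <=
    expR (huber y + t ^+ 2 * c2) * expR (r * c1).
  move=> rt; rewrite -expRD ler_expR.
  have := huber_le_dot (y + r *: b j); rewrite !dotE (dotC (b j) y) hy.
  rewrite /c1 /c2 -rt; set d := dot (s j) _; set d' := dot (b j) _.
  by set d'' := dot y (b j); set d3 := dot y y; set d4 := huber _; lra.
have c1B : `|c1| <= B1.
  apply: (le_trans (ler_normD _ _)); rewrite /B1 mulrDl; apply: lerD.
    apply: (le_trans (dot_bound _ _)); rewrite mulrC.
    by rewrite ler_pM ?l1norm_ge0.
  by apply: (le_trans (dot_bound _ _)); rewrite ler_pM ?l1norm_ge0.
have c2B : c2 <= B ^+ 2 + C0.
  have := le_trans (ler_norm _) (sb j); have := le_trans (ler_norm _) (dot_bound (b j) (b j)).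
  have : l1norm (b j) * l1norm (b j) <= B ^+ 2 by rewrite expr2 ler_pM ?l1norm_ge0.
  have := sqr_ge0 B; rewrite /c2; set d := dot (s j) _; set d' := dot (b j) _.
  lra.
have tc r : `|r| = t -> r * c1 <= 2^-1.
  move=> rt; apply: (le_trans (ler_norm _)); rewrite normrM rt.
  by apply: le_trans tB1; rewrite ler_wpM2l // ltW.
apply: (le_trans (lerD (step t _) (step (- t) _))); rewrite ?sqrrN //.
rewrite -mulrDr; set e' := expR (huber y + _).
have h1 := expR_le_quad (tc t (gtr0_norm t0)).
have h2 : expR (- t * c1) <= 1 + (- t * c1) + 2 * (- t * c1) ^+ 2.
  by apply/expR_le_quad/tc; rewrite normrN gtr0_norm.
have h3 := expR_ge1Dx (2 * t ^+ 2 * c1 ^+ 2).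
have -> : 2 * e = e' * (2 * expR (t ^+ 2 * (K - c2))).
  rewrite mulrCA -expRD; congr (_ * expR _); ring.
rewrite ler_wpM2l ?expR_ge0 //.
have : expR (2 * t ^+ 2 * c1 ^+ 2) <= expR (t ^+ 2 * (K - c2)).
  rewrite ler_expR mulrAC [2 * _ * _]mulrC.
  rewrite ler_wpM2l ?sqr_ge0 //.
  have : c1 ^+ 2 <= B1 ^+ 2 by rewrite -real_normK ?num_real // lerXn2r ?nnegrE.
  by rewrite /K; lra.
by rewrite exprMn sqrrN in h2; rewrite exprMn in h1; lra.
Qed.

(** The discount. The constant [K / t ^+ 2] loses [t ^+ 2 * K] under [T], exactly the growth of
    [huber] allowed by [logavg_huber]. *)
Let T f x := (1 - t ^+ 4) * f x + t ^+ 4 * huber x.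

Let tn0 : t != 0. Proof. by rewrite gt_eqF. Qed.
Let t40 : 0 <= t ^+ 4. Proof. by rewrite exprn_ge0 // ltW. Qed.
Let t41 : 0 <= 1 - t ^+ 4. Proof. by rewrite subr_ge0 exprn_ile1 // ltW. Qed.
Let t20 : 0 < t ^+ 2. Proof. by rewrite exprn_gt0. Qed.

Let T_mono f f' : (forall x, f x <= f' x) -> forall x, T f x <= T f' x.
Proof. by move=> ff x; rewrite lerD2r ler_wpM2l. Qed.

Let T_cvx f : cvx f -> cvx (T f).
Proof.
move=> fC p x y p01; rewrite /T; have := fC p x y p01; have := huber_cvx x y p01.
set z := _ + _; move=> h1 h2.
have := ler_wpM2l t40 h1; have := ler_wpM2l t41 h2; lra.
Qed.

(** Monotone iteration from a supersolution, hence decreasing. The constant [L] below is chosen so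
    that the discount compensates the loss [t ^+ 2 * C0] of one step, which makes it a lower
    barrier. *)
Let F := fix F (k : nat) : 'cV[R]_n -> R :=
  if k is k'.+1 then infconv (H (T (F k'))) else fun x => huber x + K / t ^+ 2.

Let L := - C0 / t ^+ 2.

Let H_lower f : (forall x, L <= f x) -> forall x, L <= H (T f) x.
Proof.
move=> fL x.
have cC : cvx (fun _ : 'cV[R]_n => (1 - t ^+ 4) * L) by move=> p ? ? _; lra.
have := logavg_ge J0 t sb x cC.
have -> : (1 - t ^+ 4) * L - t ^+ 2 * C0 = L by rewrite /L; field.
move=> h; apply: (le_trans h); apply: logavg_mono => // y.
rewrite /T -[leLHS]addr0 lerD // ?ler_wpM2l // mulr_ge0 //; exact: huber_ge0.
Qed.

Let F_lower k x : L <= F k x.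
Proof.
elim: k x => [|k IH] x /=.
  have : 0 <= K / t ^+ 2 by rewrite divr_ge0 // ltW.
  have : L <= 0 by rewrite /L mulNr oppr_le0 divr_ge0 // ltW.
  by have := huber_ge0 x; lra.
exact: infconv_ge (H_lower IH) x.
Qed.

Let F_le k x y : F k.+1 x <= H (T (F k)) y + l1norm (x - y).
Proof. exact: infconv_le (H_lower (@F_lower k)) x y. Qed.

Let F_cvx k : cvx (F k).
Proof.
elim: k => [|k IH] /=.
  by move=> p x y /huber_cvx h; have := h x y; lra.
by apply: infconv_cvx (H_lower (@F_lower k)) _; apply/logavg_cvx/T_cvx.
Qed.

Let F_decS k x : F k.+1 x <= F k x.
Proof.
elim: k x => [|k IH] x.
  (* Moving to the cube loses nothing, since [huber x] is [huber y] plus the distance, and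
     [logavg_huber] applies at y. *)
  have [y [yn hy hx]] := huber_cube x.
  apply: (le_trans (F_le 0 _ y)).
  have -> : T (F 0) = (fun z => huber z + (K / t ^+ 2 - t ^+ 2 * K)).
    by apply/funext => z; rewrite /T /=; field.
  by rewrite /H logavg_addc //; have := logavg_huber yn hy; rewrite /H /= hx; lra.
apply/ler_addgt0Pr => e e0.
have [y hy] := infconv_adherent (H_lower (@F_lower k)) x e0.
apply: (le_trans (F_le k.+1 _ y)); apply: le_trans (ltW hy).
by rewrite lerD2r; apply/logavg_mono => //; exact: T_mono.
Qed.

Let F_dec k k' x : (k <= k')%N -> F k' x <= F k x.
Proof.
move=> /subnK <-; elim: (k' - k)%N => // d IH.
by rewrite addSn; apply: le_trans IH; exact: F_decS.
Qed.

Let u0 x := inf [set F k x | k in setT].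

Let u0_has x : has_inf [set F k x | k in setT].
Proof. by split; [exists (F 0 x); exists 0%N|exists L => _ [k _ <-]]. Qed.

Let u0_le k x : u0 x <= F k x.
Proof. by apply: ge_inf; [case: (u0_has x)|exists k]. Qed.

Let u0_lower x : L <= u0 x.
Proof. by apply: lb_le_inf; [case: (u0_has x)|move=> _ [k _ <-]]. Qed.

Let u0_adh x e : 0 < e -> exists k, F k x < u0 x + e.
Proof. by move=> e0; have [_ [k _ <-]] := inf_adherent e0 (u0_has x); exists k. Qed.

Let u0_cvx : cvx u0.
Proof.
move=> p x y /[dup] p01 /andP[p0 p1]; apply/ler_addgt0Pr => e e0.
have [k hk] := u0_adh x e0; have [l hl] := u0_adh y e0.
pose q := maxn k l.
have hx : F q x <= u0 x + e by apply: le_trans (ltW hk); apply: F_dec; rewrite leq_maxl.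
have hy : F q y <= u0 y + e by apply: le_trans (ltW hl); apply: F_dec; rewrite leq_maxr.
apply: (le_trans (u0_le q _)); apply: (le_trans (F_cvx _ _ _ p01)).
have p1' : 0 <= 1 - p by rewrite subr_ge0.
have := ler_wpM2l p0 hx; have := ler_wpM2l p1' hy; lra.
Qed.

(** [H] reads its argument only at the finitely many points [y +- t b_j], so one index q serves them
    all up to e. This is how the infimum over the iterates passes through the operator. *)
Let u0_fix_le x y : u0 x <= H (T u0) y + l1norm (x - y).
Proof.
apply/ler_addgt0Pr => e e0.
have /fin_all_exists[k1 hk1] : forall j, exists k, F k (y + t *: b j) < u0 (y + t *: b j) + e.
  by move=> j; exact: u0_adh.
have /fin_all_exists[k2 hk2] : forall j, exists k, F k (y - t *: b j) < u0 (y - t *: b j) + e.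
  by move=> j; exact: u0_adh.
pose q := maxn (\max_j k1 j) (\max_j k2 j).
apply: (le_trans (u0_le q.+1 _)); apply: (le_trans (F_le q _ y)).
rewrite addrAC lerD2r /H -logavg_addc // ler_ln ?posrE ?avge_gt0 //.
apply: avge_mono => // j; split.
  have h : F q (y + t *: b j) <= u0 (y + t *: b j) + e.
    apply: le_trans (ltW (hk1 j)); apply: F_dec.
    by apply: leq_trans (leq_maxl _ _); exact: leq_bigmax.
  by have := ler_wpM2l t41 h; rewrite /T; have := mulr_ge0 t40 (ltW e0); lra.
have h : F q (y - t *: b j) <= u0 (y - t *: b j) + e.
  apply: le_trans (ltW (hk2 j)); apply: F_dec.
  by apply: leq_trans (leq_maxr _ _); exact: leq_bigmax.
by have := ler_wpM2l t41 h; rewrite /T; have := mulr_ge0 t40 (ltW e0); lra.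
Qed.

Let u0_fix_ge x e : 0 < e -> exists y, H (T u0) y + l1norm (x - y) <= u0 x + e.
Proof.
move=> e0; have e2 : 0 < e / 2 by rewrite divr_gt0.
have [k hk] := u0_adh x e2.
have [y hy] := infconv_adherent (H_lower (@F_lower k)) x e2.
exists y; have : H (T u0) y <= H (T (F k)) y.
  by apply: logavg_mono => //; exact: T_mono (u0_le k).
by have := F_decS k x; rewrite /= in hy *; lra.
Qed.

Let u x := u0 x - u0 0.
(** [T] multiplies constants by [1 - t ^+ 4], so normalising the fixed point leaves [t ^+ 4 * u0 0],
    that is [t ^+ 2 * k]. It is of the right order because [u0 0] lies between [L] and [F 0 0], both
    of order 1/t^2. *)
Let k := t ^+ 2 * u0 0.

Let T_sub x : T u0 x = T u x + (1 - t ^+ 4) * u0 0.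
Proof. by rewrite /T /u; ring. Qed.

Let HT_sub x : H (T u0) x = H (T u) x + (1 - t ^+ 4) * u0 0.
Proof.
have -> : T u0 = (fun y => T u y + (1 - t ^+ 4) * u0 0).
  by apply/funext => y; exact: T_sub.
exact: logavg_addc.
Qed.

Let u_fix_le x y : u x + t ^+ 2 * k <= H (T u) y + l1norm (x - y).
Proof. by have := u0_fix_le x y; rewrite HT_sub /u /k; lra. Qed.

Let u_fix_ge x e : 0 < e ->
  exists y, H (T u) y + l1norm (x - y) <= u x + t ^+ 2 * k + e.
Proof.
by move=> /(u0_fix_ge x)[y]; rewrite HT_sub => h; exists y; rewrite /u /k; lra.
Qed.

Let u_cvx : cvx u.
Proof. by move=> p x y /u0_cvx h; rewrite /u; have := h x y; lra. Qed.

Let u_lip : lip1 u.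
Proof.
move=> x y; apply/ler_addgt0Pr => e /(u_fix_ge y)[z hz].
have := u_fix_le x z; have := l1norm_triangle (x - y) (y - z).
by rewrite addrA subrK; lra.
Qed.

Let k_bound : - C0 <= k <= K.
Proof.
rewrite /k; have := u0_lower 0; have := u0_le 0 0; rewrite /= huber0 add0r /L => h1 h2.
have := ler_wpM2l (ltW t20) h1; have := ler_wpM2l (ltW t20) h2.
have -> : t ^+ 2 * (- C0 / t ^+ 2) = - C0 by field.
have -> : t ^+ 2 * (K / t ^+ 2) = K by field.
by move=> -> ->.
Qed.

Let u_0 : u 0 = 0. Proof. by rewrite /u subrr. Qed.

Let u_le_l1 x : u x <= l1norm x.
Proof. by have := u_lip x 0; rewrite u_0 subr0 add0r. Qed.

Let Hu_le_HTu x : H u x <= H (T u) x + t ^+ 4 * n%:R.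
Proof.
apply: logavg_le_addc => // y; rewrite /T.
have := u_le_l1 y; have := l1norm_le_huber y => h1 h2.
have h3 : u y - huber y <= n%:R by lra.
by have := ler_wpM2l t40 h3; lra.
Qed.

Let t42 : t ^+ 4 <= t ^+ 2.
Proof. by rewrite ler_wiXn2l // ltW. Qed.

Let u_sup x : exists y,
  H u y + l1norm (x - y) <= u x + t ^+ 2 * k + t ^+ 4 * (1 + n%:R).
Proof.
have t4 : 0 < t ^+ 4 by rewrite exprn_gt0.
by have [y hy] := u_fix_ge x t4; exists y; have := Hu_le_HTu y; lra.
Qed.

(** By the Lipschitz bound, [u x - l1norm (x - y)] is at most [u y]: the cost of moving cancels and
    an inequality at y alone remains, to which [logavg_le_pairs] applies. *)
Let near_min x y :
  H u y + l1norm (x - y) <= u x + t ^+ 2 * k + t ^+ 4 * (1 + n%:R) ->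
  H u y <= u y + t ^+ 2 * C1.
Proof.
move=> h; have := u_lip x y; have /andP[_ kK] := k_bound.
have h1 := ler_wpM2l (ltW t20) kK.
have n1 : 0 <= (1 : R) + n%:R by rewrite addr_ge0.
have := ler_wpM2r n1 t42; rewrite /C1; lra.
Qed.

Let n0 : 0 <= (n%:R : R). Proof. by []. Qed.
Let C10 : 0 <= C1 + C0.
Proof. by rewrite /C1; have := K0; have := C00; have := n0; lra. Qed.
Let C20 : 0 <= C2. Proof. by rewrite /C2 mulr_ge0 // mulr_ge0. Qed.

Let Hu_lower x : u x - t ^+ 2 * C0 <= H u x.
Proof. exact: logavg_ge. Qed.

(* The tilt makes the scheme expand strongly far from the origin: there the
   minimiser of the inf-convolution cannot be found. *)
Let localize y : H u y <= u y + t ^+ 2 * C1 -> l1norm y <= g * (B + 2 * C2 + 1).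
Proof.
move=> h; apply: coer => j.
have := logavg_le_pairs J0 sb j u_cvx tC1 C10 h; rewrite -/m -/C2.
have := cvx_mid y (t *: b j) u_cvx; set D := _ - 2 * u y => D0.
set X := _ / 2 + _ => hX.
have X2 : (X / t) ^+ 2 <= 4 * C2.
  rewrite expr_div_n ler_pdivrMr //; lra.
have Xt : `|X / t| <= 2 * C2 + 1.
  have h2 : 0 <= 2 * C2 + 1 by have := C20; lra.
  rewrite -ler_sqr ?nnegrE // real_normK ?num_real // (le_trans X2) //.
  by have := sqr_ge0 C2; lra.
have : `|(u (y + t *: b j) - u (y - t *: b j)) / 2| <= t * B.
  have := lip1_norm (y + t *: b j) (y - t *: b j) u_lip.
  have -> : y + t *: b j - (y - t *: b j) = (2 * t) *: b j.
    by apply/matrixP => i l; rewrite !mxE; ring.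
  rewrite l1normZ normrM [`|2|]ger0_norm // (gtr0_norm t0) normrM normfV.
  rewrite [`|2|]ger0_norm // => hl.
  have := ler_wpM2l (ltW t0) (bB j); lra.
have -> : dot (s j) y = X / t - (u (y + t *: b j) - u (y - t *: b j)) / 2 / t.
  by rewrite /X; field.
move=> h1; apply: (le_trans (ler_normB _ _)).
have : `|(u (y + t *: b j) - u (y - t *: b j)) / 2 / t| <= B.
  by rewrite normrM normfV (gtr0_norm t0) ler_pdivrMr // [B * t]mulrC.
lra.
Qed.

Let Cg := g * (B + 2 * C2 + 1).
Let Cg0 : 0 <= Cg. Proof. by rewrite mulr_ge0 // !addr_ge0 // mulr_ge0. Qed.

Let Cf := 2 * Cg + C2 + C1 + C0.

Let tC1' : t ^+ 2 * (C1 + C0) <= C1 + C0.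
Proof. by rewrite ler_piMl // exprn_ile1 // ltW. Qed.

(* At a near-minimiser y for x, u x is u y + |x - y| up to O(t^2). *)
Let u_ge_min x y :
  H u y + l1norm (x - y) <= u x + t ^+ 2 * k + t ^+ 4 * (1 + n%:R) ->
  u y + l1norm (x - y) <= u x + t ^+ 2 * (C1 + C0).
Proof.
move=> h; have := Hu_lower y; have /andP[_ kK] := k_bound.
have h1 := ler_wpM2l (ltW t20) kK.
have n1 : 0 <= (1 : R) + n%:R by rewrite addr_ge0.
have := ler_wpM2r n1 t42; rewrite /C1; lra.
Qed.

(** A near-minimiser y for x lies in a fixed ball by [localize], and u x exceeds u y by the distance
    up to a constant; so u grows like the distance to that ball. *)
Let u_growth x : l1norm x - Cf <= u x.
Proof.
have [y hy] := u_sup x.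
have yg := localize (near_min hy); have := u_ge_min hy.
have := u_lip 0 y; rewrite u_0 sub0r l1normN.
have := l1norm_triangle (x - y) y; rewrite subrK -/Cg in yg *.
by have := tC1'; rewrite /Cf; have := C20; lra.
Qed.

(** Replacing x by its near-minimiser y lowers each outer value by at most the distance, and
    [u_ge_min] recovers that distance at the centre; the bound at y thus transfers to x with a loss
    O(t^2). *)
Let u_sc x j : u (x + t *: b j) + u (x - t *: b j) - 2 * u x <=
  (C2 + 2 * (C1 + C0)) * t ^+ 2.
Proof.
have [y hy] := u_sup x.
have := u_ge_min hy.
have := logavg_le_pairs J0 sb j u_cvx tC1 C10 (near_min hy); rewrite -/m -/C2.
set X := _ / 2 + _; have := sqr_ge0 X => X0 h1 h2.
have := u_lip (x + t *: b j) (y + t *: b j).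
have := u_lip (x - t *: b j) (y - t *: b j).
have -> : x + t *: b j - (y + t *: b j) = x - y.
  by apply/matrixP => i l; rewrite !mxE; ring.
have -> : x - t *: b j - (y - t *: b j) = x - y.
  by apply/matrixP => i l; rewrite !mxE; ring.
lra.
Qed.

Lemma dpair_exists : exists v l, dpair s (Cf + C2 + 2 * (C1 + C0) + C0 + n%:R + 1) t b v l.
Proof.
exists u, k; set C := _ + 1.
have := Cg0; have := C20; have := C00; have := K0; have := n0 => ? ? ? ? ?.
have CfE : Cf = 2 * Cg + C2 + C1 + C0 by [].
have CE : C = Cf + C2 + 2 * (C1 + C0) + C0 + n%:R + 1 by [].
have C12 : 0 <= C1 by rewrite /C1; have := K0; have := n0; lra.
split => //.
- have /andP[h1 h2] := k_bound; have : K <= C1 by rewrite /C1; lra.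
  rewrite ler_norml => h3.
  by apply/andP; split; rewrite CE CfE; lra.
- by move=> x; have := u_growth x; rewrite CE CfE; lra.
- move=> x; have := u_fix_le x x; rewrite subrr l1norm0 addr0.
  have : H (T u) x <= H u x + t ^+ 4 * Cf.
    apply: logavg_le_addc => // y; rewrite /T.
    have := u_growth y; have := huber_le_l1norm y => h1 h2.
    have h3 : huber y - u y <= Cf by lra.
    by have := ler_wpM2l t40 h3; lra.
  have : Cf <= C by rewrite CE CfE; lra.
  by move=> /(ler_wpM2l t40); rewrite /H; lra.
- move=> x; have [y hy] := u_sup x; exists y.
  have : 1 + n%:R <= C by rewrite CE CfE; lra.
  by move=> /(ler_wpM2l t40); move: hy; rewrite /H; lra.
- move=> x; have := Hu_lower x.
  have : C0 <= C by rewrite CE CfE; lra.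
  by move=> /(ler_wpM2l (ltW t20)); rewrite /H; lra.
- move=> x j; have := u_sc x j.
  have : C2 + 2 * (C1 + C0) <= C by rewrite CE CfE; lra.
  by move=> /(ler_wpM2l (ltW t20)); lra.
Qed.

End Existence.

(** C and t0 are fixed before b, so they serve all families bounded by B at once, in particular
    those with extra directions [d e_i] for every [|d| <= 1]. *)
Lemma discrete_eigenpairs (s : J -> 'cV[R]_n) (B g : R) : (0 < #|J|)%N -> 0 <= B ->
  0 <= g -> (forall y M, (forall j, `|dot (s j) y| <= M) -> l1norm y <= g * M) ->
  exists2 C, 0 < C & exists2 t0, 0 < t0 & forall t b, 0 < t <= t0 ->
    (forall j, l1norm (b j) <= B) -> exists u k, dpair s C t b u k.
Proof.
move=> J0 B0 g0 coer.
pose S := \sum_j l1norm (s j).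
have sS j : l1norm (s j) <= S.
  by rewrite /S (bigD1 j) //= lerDl sumr_ge0 // => i _; exact: l1norm_ge0.
have S0 : 0 <= S by apply: sumr_ge0 => i _; exact: l1norm_ge0.
pose B1 := (B + S) * n%:R.
pose C0 := S * B.
pose K := 2 * B1 ^+ 2 + B ^+ 2 + C0.
pose m := #|J|%:R : R.
pose C1 := K + 1 + n%:R.
have C00 : 0 <= C0 by rewrite mulr_ge0.
have B10 : 0 <= B1 by rewrite mulr_ge0 // addr_ge0.
have n0 : 0 <= (n%:R : R) by [].
have C10 : 0 <= C1.
  by rewrite /C1 /K; have := sqr_ge0 B1; have := sqr_ge0 B; lra.
have C20 : 0 <= 4 * m * (C1 + C0) by apply: mulr_ge0; [exact: mulr_ge0|lra].
have Cg0 : 0 <= g * (B + 2 * (4 * m * (C1 + C0)) + 1).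
  by rewrite mulr_ge0 //; lra.
exists (2 * (g * (B + 2 * (4 * m * (C1 + C0)) + 1)) + 4 * m * (C1 + C0) + C1 + C0 +
   4 * m * (C1 + C0) + 2 * (C1 + C0) + C0 + n%:R + 1); first by lra.
pose q := 2 * (B1 + C1 + C0 + 1).
have q0 : 0 < q by rewrite /q; lra.
exists q^-1; first by rewrite invr_gt0.
move=> t b /andP[t0 tq] bB.
have tq1 : t * q <= 1 by rewrite -(mulVf (lt0r_neq0 q0)) ler_wpM2r // ltW.
have t1 : t <= 1 by rewrite /q in tq1; nra.
apply: dpair_exists => //; first by rewrite -/B1; rewrite /q in tq1; nra.
rewrite -/B1 -/C0 -/K -/C1; rewrite /q in tq1.
have : t ^+ 2 <= t by rewrite expr2 ler_piMl // ltW.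
by nra.
Qed.

End DiscretePair.

(** * Taylor expansions and consistency *)

Section Derivatives.
Context {R : realType}.

Lemma is_derive_epsP (V : normedModType R) (f : V -> R) (x v : V) (d : R) :
  (forall e, 0 < e -> exists2 r, 0 < r & forall h, `|h| <= r ->
     `|f (x + h *: v) - f x - h * d| <= e * `|h|) <->
  is_derive x v f d.
Proof.
split => [fd|[fx fd] e e0].
  suff h : (fun h => h^-1 *: ((f \o shift x) (h *: v) - f x)) @ 0^' --> d.
    split; first by apply/cvg_ex; exists d.
    by apply: cvg_lim.
  apply/cvgrPdist_le => e e0; have [r r0 hr] := fd e e0.
  near=> h; have h0 : h != 0 by near: h; exact: nbhs_dnbhs_neq.
  have hr' : `|h| <= r.
    near: h; apply: dnbhs0_le => //.
  rewrite distrC /= /shift /= [h *: v + x]addrC.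
  have -> : h^-1 *: (f (x + h *: v) - f x) - d = h^-1 * (f (x + h *: v) - f x - h * d).
    by rewrite /GRing.scale /=; field.
  by rewrite normrM normfV ler_pdivrMl ?normr_gt0 // [_ * e]mulrC; exact: hr.
have := fx; rewrite /derivable -[lim _]/('D_v f x) => /cvgrPdist_le; rewrite fd => /(_ _ e0).
rewrite near_withinE => /nbhs_ballP[r /= r0 hr]; exists (r / 2); first by rewrite divr_gt0.
move=> h hr2; have [->|h0] := eqVneq h 0.
  by rewrite scale0r addr0 subrr sub0r mul0r normrN !normr0 mulr0.
have := hr h; rewrite -ball_normE /= sub0r normrN => /(_ _ h0).
have hlt : `|h| < r by rewrite (le_lt_trans hr2) // ltr_pdivrMr // ltr_pMr // ltr1n.
move=> /(_ hlt); rewrite distrC /shift /= [h *: v + x]addrC.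
have -> : h^-1 *: (f (x + h *: v) - f x) - d = h^-1 * (f (x + h *: v) - f x - h * d).
  by rewrite /GRing.scale /=; field.
by rewrite normrM normfV ler_pdivrMl ?normr_gt0 // [_ * e]mulrC.
Unshelve. all: by end_near. Qed.

Lemma is_derive_line (V : normedModType R) (f : V -> R) (x v : V) (s d : R) :
  is_derive (x + s *: v) v f d -> is_derive s 1 (fun r : R => f (x + r *: v)) d.
Proof.
move=> /is_derive_epsP fd; apply/is_derive_epsP => e e0.
have [r r0 hr] := fd e e0; exists r => // h hh.
by rewrite [h *: 1](mulr1 h) scalerDl addrA; exact: hr.
Qed.

Lemma MVT_line (g dg : R -> R) (s : R) :
  (forall r : R, is_derive r 1 g (dg r)) ->
  exists2 th, `|th| <= `|s| & g s - g 0 = dg th * s.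
Proof.
move=> gd; have gc : continuous g.
  by move=> r; apply/differentiable_continuous/derivable1_diffP; case: (gd r).
have [s0|s0] := leP 0 s.
  have [c] := @MVT_segment _ g dg 0 s s0 (fun r _ => gd r) (continuous_subspaceT gc).
  rewrite in_itv /= => /andP[c0 cs] h; exists c; last by rewrite h subr0.
  by rewrite !ger0_norm // (le_trans c0).
have [c] := @MVT_segment _ g dg s 0 (ltW s0) (fun r _ => gd r) (continuous_subspaceT gc).
rewrite in_itv /= => /andP[cs c0] h; exists c; last by lra.
by rewrite (ler0_norm c0) (ler0_norm (ltW s0)) lerN2.
Qed.


Lemma is_derive_subf (V : normedModType R) (f g : V -> R) x v d d' :
  is_derive x v f d -> is_derive x v g d' ->
  is_derive x v (fun y => f y - g y) (d - d').
Proof. exact: is_deriveB. Qed.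

Lemma is_derive_quad (a b c r : R) :
  is_derive r 1 (fun r => a + r * b + r ^+ 2 * c) (b + 2 * r * c).
Proof.
apply/is_derive_epsP => e e0; exists (e / (`|c| + 1)).
  by rewrite divr_gt0 // ltr_wpDl.
move=> h; rewrite ler_pdivlMr ?ltr_wpDl // => hh.
rewrite /GRing.scale /= mulr1 (_ : _ - _ = h * (h * c)); last by ring.
rewrite normrM mulrC ler_wpM2r // normrM.
by have := normr_ge0 h; have := normr_ge0 c; nra.
Qed.

(** After subtraction of a quadratic polynomial with second derivative q, the mean value theorem is
    applied to the remainder and then to [g1]. The bound is e rather than e/2, which makes no
    difference later. *)
Lemma taylor2_bound (g g1 g2 : R -> R) (q e : R) :
  (forall r : R, is_derive r 1 g (g1 r)) -> (forall r : R, is_derive r 1 g1 (g2 r)) ->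
  (forall r, `|r| <= 1 -> `|g2 r - q| <= e) ->
  `|g 1 - g 0 - g1 0 - q / 2| <= e.
Proof.
move=> gd1 gd2 g2q.
have kd (r : R) : is_derive r 1 (fun r => g r - (g 0 + r * g1 0 + r ^+ 2 * (q / 2)))
    (g1 r - (g1 0 + 2 * r * (q / 2))).
  by apply: is_derive_subf => //; exact: is_derive_quad.
have [c c1] := MVT_line 1 kd.
have [d dc gE] := MVT_line c gd2.
rewrite expr0n expr1n /= => h.
have -> : g 1 - g 0 - g1 0 - q / 2 = c * (g2 d - q) by lra.
rewrite normr1 in c1; rewrite normrM; have := g2q d (le_trans dc c1).
by have := normr_ge0 c; have := normr_ge0 (g2 d - q); nra.
Qed.

End Derivatives.

Section SecondOrder.
Context {R : realType} {n : nat}.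
Implicit Types (f : 'cV[R]_n -> R) (g : 'cV[R]_n -> 'cV[R]_n).
Implicit Types (x y z v w p : 'cV[R]_n) (X : 'M[R]_n).

Local Notation ee i := (delta_mx i 0 : 'cV[R]_n).

Lemma continuous_l1_fin (I : finType) (f : I -> 'cV[R]_n -> R) x :
  (forall i, {for x, continuous (f i)}) -> forall e, 0 < e ->
  exists2 r, 0 < r & forall i y, l1norm (y - x) <= r -> `|f i y - f i x| <= e.
Proof.
move=> fx e e0.
have /nbhs_l1P[r r0 hr] : \forall y \near x, forall i, `|f i x - f i y| <= e.
  apply: (@filter_forall _ I (fun i y => `|f i x - f i y| <= e) (nbhs x)) => i.
  by have /(@cvgrPdist_le _ _ _ (nbhs x)) h := fx i; exact: h.
by exists r => // i y /hr /(_ i); rewrite distrC.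
Qed.

Lemma C1_partial f i x : C1 f -> is_derive x (ee i) f (partial i f x).
Proof. by move=> fC; apply/derivableP; case: (fC i). Qed.

Definition trunc k v : 'cV[R]_n := \col_i (if (i < k)%N then v i 0 else 0).

Lemma trunc0 v : trunc 0 v = 0.
Proof. by apply/matrixP => i j; rewrite !mxE ltn0. Qed.

Lemma truncn v : trunc n v = v.
Proof. by apply/matrixP => i j; rewrite !mxE ltn_ord (ord1 j). Qed.

Lemma truncS (k : 'I_n) v : trunc k.+1 v = trunc k v + v k 0 *: (ee k).
Proof.
apply/matrixP => i j; rewrite !mxE (ord1 j) eqxx andbT ltnS leq_eqVlt.
have [->|ik] := eqVneq i k; first by rewrite eqxx ltnn mulr1 add0r.
by rewrite (negbTE (_ : (i != k :> nat))) //= mulr0 addr0.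
Qed.

Lemma l1norm_trunc k v : l1norm (trunc k v) <= l1norm v.
Proof. by apply: ler_sum => i _; rewrite mxE; case: ifP; rewrite ?normr0. Qed.

(** The coordinates of w are switched on one at a time by [trunc]; each increment is a mean value
    theorem along an axis, and the increments telescope. *)
Lemma C1_expand f x : C1 f -> forall e, 0 < e -> exists2 r, 0 < r & forall w,
  l1norm w <= r -> `|f (x + w) - f x - dot (grad f x) w| <= e * l1norm w.
Proof.
move=> fC e e0.
have [r r0 hr] := continuous_l1_fin (fun i => (fC i).2 x) e0.
exists (r / 2) => [|w wr]; first by rewrite divr_gt0.
pose g k := f (x + trunc k w).
have step (k : 'I_n) : `|g k.+1 - g k - grad f x k 0 * w k 0| <= e * `|w k 0|.
  have fl (s : R) : is_derive s 1 (fun r => f (x + trunc k w + r *: (ee k)))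
      (partial k f (x + trunc k w + s *: (ee k))).
    by apply: is_derive_line; exact: C1_partial.
  have [th ht] := MVT_line (w k 0) fl.
  rewrite scale0r addr0 -addrA -truncS -/(g _) -/(g k) => ->.
  rewrite mxE -mulrBl normrM ler_wpM2r //; apply: hr.
  rewrite [_ - x](_ : _ = trunc k w + th *: (ee k)); last first.
    by apply/matrixP => i j; rewrite !mxE; ring.
  apply: (le_trans (l1norm_triangle _ _)); rewrite l1normZ l1norm_delta mulr1.
  have := l1norm_trunc k w; have := l1norm_coord w k; lra.
have -> : f (x + w) - f x = \sum_(k < n) (g k.+1 - g k).
  rewrite -(big_mkord xpredT (fun k => g k.+1 - g k)) telescope_sumr //.
  by rewrite /g truncn trunc0 addr0.
rewrite -sumrB mulr_sumr; apply: (le_trans (ler_norm_sum _ _ _)).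
by apply: ler_sum => k _; exact: step.
Qed.

Lemma C1_dir f x v : C1 f -> is_derive x v f (dot (grad f x) v).
Proof.
move=> fC; apply/is_derive_epsP => e e0.
have v0 : 0 < l1norm v + 1 by rewrite ltr_wpDl // l1norm_ge0.
have [r r0 hr] := C1_expand x fC (divr_gt0 e0 v0).
exists (r / (l1norm v + 1)) => [|h hh]; first by rewrite divr_gt0.
have vv : l1norm v <= l1norm v + 1 by rewrite lerDl.
have hv : `|h| * l1norm v <= r.
  apply: (le_trans (ler_wpM2l (normr_ge0 h) vv)).
  by move: hh; rewrite ler_pdivlMr.
have := hr (h *: v); rewrite l1normZ dotZr => /(_ hv) h1; apply: (le_trans h1).
rewrite -mulrA ler_wpM2l ?(ltW e0) // ler_pdivrMl //.
by have := normr_ge0 h; lra.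
Qed.

Definition qform X v : R := dot v (X *m v).

Lemma qformZ X c v : qform X (c *: v) = c ^+ 2 * qform X v.
Proof. by rewrite /qform -scalemxAr !dotE mulrA. Qed.

Lemma qform_sum X v : qform X v = \sum_i v i 0 * dot (row i X)^T v.
Proof.
apply: eq_bigr => i _; rewrite mxE; congr (_ * _).
by apply: eq_bigr => j _; rewrite !mxE.
Qed.

Lemma C2_line1 f x v (s : R) : C2 f ->
  is_derive s 1 (fun r => f (x + r *: v)) (dot (grad f (x + s *: v)) v).
Proof. by move=> [fC _]; apply: is_derive_line; exact: C1_dir. Qed.

Lemma C2_line2 f x v (s : R) : C2 f ->
  is_derive s 1 (fun r => dot (grad f (x + r *: v)) v) (qform (hess f (x + s *: v)) v).
Proof.
move=> [_ fC]; rewrite qform_sum.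
have -> : (fun r => dot (grad f (x + r *: v)) v) =
    (fun r : R => \sum_(i < n) v i 0 * partial i f (x + r *: v)).
  by apply/funext => r; apply: eq_bigr => i _; rewrite mxE mulrC.
apply/is_derive_epsP => e e0.
have v0 : 0 < l1norm v + 1 by rewrite ltr_wpDl // l1norm_ge0.
have pd i : is_derive s 1 (fun r => partial i f (x + r *: v))
    (dot (row i (hess f (x + s *: v)))^T v).
  have -> : (row i (hess f (x + s *: v)))^T = grad (partial i f) (x + s *: v).
    by apply/matrixP => k l; rewrite !mxE.
  by apply: is_derive_line; exact: C1_dir.
have : forall i, \forall h \near (0 : R), `|partial i f (x + (s + h) *: v) -
    partial i f (x + s *: v) - h * dot (row i (hess f (x + s *: v)))^T v| <=
    e / (l1norm v + 1) * `|h|.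
  move=> i; have /is_derive_epsP/(_ _ (divr_gt0 e0 v0))[r r0 hr] := pd i.
  apply/nbhs_ballP; exists r => //= h; rewrite -ball_normE /= sub0r normrN => /ltW hh.
  by have := hr h hh; rewrite [h *: 1](mulr1 h).
move=> /filter_forall /nbhs_ballP[r /= r0 hr]; exists (r / 2); first by rewrite divr_gt0.
move=> h hh; have {}hr := hr h _.
rewrite [h *: 1](mulr1 h) mulr_sumr -!sumrB; apply: (le_trans (ler_norm_sum _ _ _)).
apply: (@le_trans _ _ (\sum_(i < n) `|v i 0| * (e / (l1norm v + 1) * `|h|))).
  apply: ler_sum => i _; rewrite mulrCA -!mulrBr normrM ler_wpM2l // hr //.
  by rewrite -ball_normE /= sub0r normrN (le_lt_trans hh) // ltr_pdivrMr // ltr_pMr // ltr1n.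
rewrite -mulr_suml -/(l1norm v) mulrA ler_wpM2r // mulrCA ler_piMr ?(ltW e0) //.
by rewrite ler_pdivrMr // mul1r lerDl.
Qed.

Lemma qform_bound X v e : (forall i j, `|X i j| <= e) -> `|qform X v| <= e * l1norm v ^+ 2.
Proof.
move=> Xe; rewrite qform_sum; apply: (le_trans (ler_norm_sum _ _ _)).
rewrite expr2 mulrCA mulr_suml; apply: ler_sum => i _; rewrite normrM ler_wpM2l //.
rewrite mulr_sumr; apply: (le_trans (ler_norm_sum _ _ _)); apply: ler_sum => j _.
by rewrite normrM !mxE ler_wpM2r.
Qed.

Lemma qformB X Y v : qform (X - Y) v = qform X v - qform Y v.
Proof. by rewrite /qform mulmxBl dotBr. Qed.

(* Second-order expansion at x0 that is uniform in the base point x near x0. *)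
Definition jet2 f (g : 'cV[R]_n -> 'cV[R]_n) X x0 : Prop :=
  (forall e, 0 < e -> exists2 r, 0 < r & forall x w,
     l1norm (x - x0) <= r -> l1norm w <= r ->
     `|f (x + w) - f x - dot (g x) w - qform X w / 2| <= e * l1norm w ^+ 2) /\
  (forall i, {for x0, continuous (fun x => g x i 0)}).

Lemma C2_jet2 f x0 : C2 f -> jet2 f (grad f) (hess f x0) x0.
Proof.
move=> fC; split=> [e e0|i]; last first.
  have -> : (fun x => grad f x i 0) = partial i f by apply/funext => x; rewrite mxE.
  by case: fC => fC _; case: (fC i) => _; exact.
have hc (ij : 'I_n * 'I_n) : {for x0, continuous (fun x => hess f x ij.1 ij.2)}.
  have -> : (fun x => hess f x ij.1 ij.2) = partial ij.2 (partial ij.1 f).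
    by apply/funext => x; rewrite mxE.
  by case: fC => _ fC; case: (fC ij.1 ij.2) => _; exact.
have [r r0 hr] := continuous_l1_fin hc e0.
exists (r / 2) => [|x w xr wr]; first by rewrite divr_gt0.
have := taylor2_bound (fun s => C2_line1 x w s fC) (fun s => C2_line2 x w s fC).
move=> /(_ (qform (hess f x0) w) (e * l1norm w ^+ 2)).
rewrite scale1r scale0r addr0; apply=> s s1; rewrite -qformB; apply: qform_bound => i j.
have -> : (hess f (x + s *: w) - hess f x0) i j =
    hess f (x + s *: w) i j - hess f x0 i j by rewrite !mxE.
apply: (hr (i, j)).
have -> : x + s *: w - x0 = (x - x0) + s *: w by rewrite addrAC.
apply: (le_trans (l1norm_triangle _ _)); rewrite l1normZ.
have := ler_wpM2r (l1norm_ge0 w) s1; lra.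
Qed.

(** The paraboloid makes an extremum at x0 strict without changing value or gradient there; its
    effect on the operator is linear in e and disappears as e tends to 0. *)
Lemma jet2_perturb f g X x0 e : jet2 f g X x0 ->
  jet2 (fun x => f x + e * dot (x - x0) (x - x0)) (fun x => g x + (2 * e) *: (x - x0))
    (X + (2 * e)%:M) x0.
Proof.
move=> [fj gc]; split=> [d /fj[r r0 hr]|i].
  exists r => // x w xr wr; have := hr x w xr wr.
  rewrite /qform mulmxDl mul_scalar_mx !dotE (dotC w x) (dotC w x0) (dotC x0 x).
  move=> h; rewrite [X in `|X| <= _](_ : _ =
    f (x + w) - f x - dot (g x) w - dot w (X *m w) / 2) //; by field.
have -> : (fun x => (g x + (2 * e) *: (x - x0)) i 0) =
    (fun x => g x i 0 + 2 * e * (x i 0 - x0 i 0)) by apply/funext => z; rewrite !mxE.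
have h : {for x0, continuous (fun x : 'cV[R]_n => 2 * e * (x i 0 - x0 i 0))}.
  apply: (@continuousM _ _ (fun=> 2 * e)); first exact: cst_continuous.
  apply: (@continuousB _ _ _ (fun x : 'cV[R]_n => x i 0) (fun=> x0 i 0)).
    exact: coord_continuous.
  exact: cst_continuous.
exact: continuousD (gc i) h.
Qed.

Lemma jet2_grad_perturb (g : 'cV[R]_n -> 'cV[R]_n) x0 e :
  g x0 + (2 * e) *: (x0 - x0) = g x0.
Proof. by rewrite subrr scaler0 addr0. Qed.

End SecondOrder.

Section ExpTaylor.
Context {R : realType}.

Lemma expR_taylor (z : R) : `|z| <= 2^-1 ->
  `|expR z - 1 - z - z ^+ 2 / 2| <= 2 * `|z| ^+ 3.
Proof.
move=> z2.
have kd (r : R) : is_derive r 1 (fun r => expR r - (1 + r * 1 + r ^+ 2 * 2^-1))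
    (expR r - (1 + 2 * r * 2^-1)).
  by apply: is_derive_subf; exact: is_derive_quad.
have [c cz] := MVT_line z kd; rewrite expR0 => h.
have -> : expR z - 1 - z - z ^+ 2 / 2 = (expR c - 1 - c) * z by lra.
have c2 : c <= 2^-1 by have := ler_norm c; lra.
have := expR_le_quad c2; have := expR_ge1Dx c => h1 h2.
have h3 : `|expR c - 1 - c| <= 2 * `|c| ^+ 2.
  by rewrite real_normK ?num_real // ger0_norm; lra.
rewrite normrM exprSr mulrA ler_wpM2r // (le_trans h3) // ler_wpM2l //.
by rewrite lerXn2r ?nnegrE.
Qed.

Context {F : set_system nat} {FF : ProperFilter F}.

Lemma cvg_le_lim (a c : nat -> R) la lc : a @ F --> la -> c @ F --> lc ->
  (\forall N \near F, a N <= c N) -> la <= lc.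
Proof.
move=> ha hc ac; rewrite -(cvg_lim _ ha) // -(cvg_lim _ hc) //.
have ca : cvg (a @ F) by apply/cvg_ex; exists la.
have cc : cvg (c @ F) by apply/cvg_ex; exists lc.
exact: ler_lim.
Qed.

Lemma cvg_0_le (a c : nat -> R) : c @ F --> 0 ->
  (\forall N \near F, `|a N| <= c N) -> a @ F --> 0.
Proof.
move=> hc ac; apply/cvgr0Pnorm_le => e e0; near=> N.
apply: (@le_trans _ _ (c N)); first by near: N.
apply: le_trans (ler_norm _) _; near: N; exact: cvgr0_norm_le.
Unshelve. all: by end_near. Qed.

Lemma cvg_sumr (I : Type) (r : seq I) (a : I -> nat -> R) (l : I -> R) :
  (forall i, a i @ F --> l i) -> (fun N => \sum_(i <- r) a i N) @ F --> \sum_(i <- r) l i.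
Proof.
move=> al; elim: r => [|i r IH].
  rewrite big_nil (_ : (fun _ => _) = fun=> 0); first exact: cvg_cst.
  by apply/funext => N; rewrite big_nil.
rewrite big_cons (_ : (fun _ => _) = fun N => a i N + \sum_(i <- r) a i N).
  exact: cvgD (al i) IH.
by apply/funext => N; rewrite big_cons.
Qed.

Lemma expR_second_order (t a : nat -> R) (a0 : R) :
  t @ F --> 0 -> (forall N, 0 < t N) -> a @ F --> a0 ->
  (fun N => (expR (t N * a N) - 1 - t N * a N) / t N ^+ 2) @ F --> a0 ^+ 2 / 2.
Proof.
move=> t0 tp aa.
pose E N := (expR (t N * a N) - 1 - t N * a N - (t N * a N) ^+ 2 / 2) / t N ^+ 2.
have -> : (fun N => (expR (t N * a N) - 1 - t N * a N) / t N ^+ 2) =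
    (fun N => E N + a N * a N * 2^-1).
  by apply/funext => N; rewrite /E; field; rewrite gt_eqF.
rewrite -[_ / 2]add0r expr2; apply: cvgD; last first.
  by apply: cvgM; [exact: cvgM|exact: cvg_cst].
have ta : (fun N => t N * a N) @ F --> 0 by rewrite -(mul0r a0); exact: cvgM.
apply: (@cvg_0_le _ (fun N => `|2 * (a N * (a N * (t N * a N)))|)).
  apply/norm_cvg0P; rewrite (_ : 0 = 2 * (a0 * (a0 * 0))); last by rewrite !mulr0.
  by apply: cvgM; [exact: cvg_cst|apply: cvgM => //; exact: cvgM].
near=> N.
have h : `|t N * a N| <= 2^-1 by near: N; apply: (cvgr0_norm_le _ ta).
have h2 := expR_taylor h.
rewrite /E [leLHS]normrM normfV normrX (gtr0_norm (tp N)).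
rewrite ler_pdivrMr ?exprn_gt0 //; apply: (le_trans h2).
by rewrite !normrM (gtr0_norm (tp N)) [`|2|]ger0_norm // le_eqVlt; apply/orP; left; apply/eqP; ring.
Unshelve. all: by end_near. Qed.

End ExpTaylor.

Section Consistency.
Context {R : realType} {n : nat} {J : finType}.
Context {F : set_system nat} {FF : ProperFilter F}.
Implicit Types (f : 'cV[R]_n -> R) (a c x y z v w p : 'cV[R]_n) (X : 'M[R]_n).

Lemma cvg_dot (a c : nat -> 'cV[R]_n) a0 c0 :
  (forall i, (fun N => a N i 0) @ F --> a0 i 0) ->
  (forall i, (fun N => c N i 0) @ F --> c0 i 0) ->
  (fun N => dot (a N) (c N)) @ F --> dot a0 c0.
Proof. by move=> ha hc; apply: cvg_sumr => i; apply: cvgM. Qed.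

Lemma cvg_coord (a : nat -> 'cV[R]_n) a0 : a @ F --> a0 ->
  forall i, (fun N => a N i 0) @ F --> a0 i 0.
Proof.
by move=> ha i; exact: (cvg_comp _ _ ha (@coord_continuous R n 1 i 0 a0)).
Qed.

Lemma cvg_qform X (c : nat -> 'cV[R]_n) c0 : c @ F --> c0 ->
  (fun N => qform X (c N)) @ F --> qform X c0.
Proof.
move=> hc; rewrite qform_sum (_ : (fun _ => _) =
    fun N => \sum_i c N i 0 * dot (row i X)^T (c N)).
  apply: cvg_sumr => i; apply: cvgM; first exact: cvg_coord.
  by apply: cvg_dot; [move=> k; exact: cvg_cst|exact: cvg_coord].
by apply/funext => N; rewrite qform_sum.
Qed.

Lemma cvg_l1norm (c : nat -> 'cV[R]_n) c0 : c @ F --> c0 ->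
  (fun N => l1norm (c N)) @ F --> l1norm c0.
Proof. by move=> hc; exact: (cvg_comp _ _ hc (@l1norm_continuous R n c0)). Qed.

Lemma cvg_l1P (c : nat -> 'cV[R]_n) c0 : c @ F --> c0 <->
  forall e, 0 < e -> \forall N \near F, l1norm (c N - c0) <= e.
Proof.
split=> [hc e e0|h P /nbhs_l1P[r r0 hr]].
  have h : nbhs c0 [set y | l1norm (y - c0) <= e] by apply/nbhs_l1P; exists e.
  exact: (hc _ h).
by apply: filterS (h _ r0) => N; exact: hr.
Qed.

(* The generator of the random walk, divided by t^2. *)
Definition Qop (s b : J -> 'cV[R]_n) X p x : R :=
  (2 * #|J|%:R)^-1 * \sum_j (dot (s j) (b j) + qform X (b j) +
                            (dot (s j) x + dot p (b j)) ^+ 2).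

(** Base points and directions both move with N, hence the uniformity in [jet2]. Relative to f at
    [x N], each exponent is [z = t (r P + t q)] with r = 1 or -1, up to the choice of index. The
    terms in P cancel between the two signs; the square of P and twice the limit of q remain. *)
Lemma consistency (s : J -> 'cV[R]_n) (t : nat -> R) (b : nat -> J -> 'cV[R]_n) b0
    (x : nat -> 'cV[R]_n) x0 f g X :
  (0 < #|J|)%N -> jet2 f g X x0 -> t @ F --> 0 -> (forall N, 0 < t N) ->
  (forall j, (fun N => b N j) @ F --> b0 j) -> x @ F --> x0 ->
  (fun N => (avge s (b N) (t N) f (x N) * expR (- f (x N)) - 1) / t N ^+ 2) @ F -->
  Qop s b0 X (g x0) x0.
Proof.
move=> J0 [fj gc] t0 tp bb xx.
pose P N j := dot (s j) (x N) + dot (g (x N)) (b N j).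
pose q N j (r : R) := (f (x N + (r * t N) *: b N j) - f (x N) -
  r * t N * dot (g (x N)) (b N j)) / t N ^+ 2 + dot (s j) (b N j) / 2.
pose z N j r := t N * (r * P N j + t N * q N j r).
pose D N j r := (expR (z N j r) - 1 - z N j r) / t N ^+ 2.
have gx i : (fun N => g (x N) i 0) @ F --> g x0 i 0.
  exact: (cvg_comp _ _ xx (gc i)).
have Pc j : P ^~ j @ F --> dot (s j) x0 + dot (g x0) (b0 j).
  apply: cvgD; apply: cvg_dot => //; try exact: cvg_coord.
  by move=> i; exact: cvg_cst.
have qc j r : `|r| = 1 -> (fun N => q N j r) @ F -->
    qform X (b0 j) / 2 + dot (s j) (b0 j) / 2.
  move=> r1; have r2 : r ^+ 2 = 1 by rewrite -real_normK ?num_real // r1 expr1n.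
  apply: cvgD; last first.
    apply: cvgM; last exact: cvg_cst.
    by apply: cvg_dot; [move=> i; exact: cvg_cst|exact: cvg_coord].
  pose E N := (f (x N + (r * t N) *: b N j) - f (x N) - r * t N * dot (g (x N)) (b N j)
    - qform X ((r * t N) *: b N j) / 2) / t N ^+ 2.
  have -> : (fun N => (f (x N + (r * t N) *: b N j) - f (x N) -
      r * t N * dot (g (x N)) (b N j)) / t N ^+ 2) =
      (fun N => E N + qform X (b N j) / 2).
    apply/funext => N; rewrite /E qformZ exprMn r2 mul1r.
    by field; rewrite gt_eqF.
  rewrite -[X in _ --> X]add0r; apply: cvgD; last first.
    by apply: cvgM; [exact: cvg_qform|exact: cvg_cst].
  have bc : (fun N => l1norm (b N j)) @ F --> l1norm (b0 j) by exact: cvg_l1norm.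
  have tb : (fun N => t N * l1norm (b N j)) @ F --> 0.
    by rewrite -(mul0r (l1norm (b0 j))); exact: cvgM.
  apply/cvgr0Pnorm_le => e e0.
  have L0 : 0 < (l1norm (b0 j) + 1) ^+ 2 by rewrite exprn_gt0 // ltr_wpDl // l1norm_ge0.
  have [d d0 hd] := fj _ (divr_gt0 e0 L0).
  near=> N.
  have hx : l1norm (x N - x0) <= d by near: N; move: d d0 {hd}; exact/cvg_l1P.
  have hw : l1norm ((r * t N) *: b N j) <= d.
    rewrite l1normZ normrM r1 mul1r (gtr0_norm (tp N)).
    have -> : t N * l1norm (b N j) = `|t N * l1norm (b N j)|.
      by rewrite ger0_norm // mulr_ge0 ?l1norm_ge0 // ltW.
    by near: N; exact: (cvgr0_norm_le _ tb).
  have := hd (x N) _ hx hw; rewrite dotZr => h.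
  rewrite /E normrM normfV normrX (gtr0_norm (tp N)) ler_pdivrMr ?exprn_gt0 //.
  apply: (le_trans h); rewrite l1normZ [`|r * _|]normrM r1 mul1r (gtr0_norm (tp N)) exprMn.
  rewrite mulrCA [leRHS]mulrC ler_wpM2l ?sqr_ge0 // -mulrA ler_piMr ?(ltW e0) //.
  rewrite ler_pdivrMl // mulr1 lerXn2r ?nnegrE ?l1norm_ge0 ?addr_ge0 ?l1norm_ge0 //.
  near: N; apply: (@cvgr_le _ _ _ _ _ _ bc); by rewrite ltrDl.
have ac j r : `|r| = 1 -> (fun N => r * P N j + t N * q N j r) @ F -->
    r * (dot (s j) x0 + dot (g x0) (b0 j)).
  move=> r1; rewrite -[X in _ --> X]addr0; apply: cvgD.
    by apply: cvgM; [exact: cvg_cst|exact: Pc].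
  by rewrite -(mul0r (qform X (b0 j) / 2 + dot (s j) (b0 j) / 2)); apply: cvgM; [|exact: qc].
have Dc j r : `|r| = 1 -> (fun N => D N j r) @ F -->
    (r * (dot (s j) x0 + dot (g x0) (b0 j))) ^+ 2 / 2.
  by move=> r1; apply: expR_second_order => //; exact: ac.
have n1 : `|(-1 : R)| = 1 by rewrite normrN1.
have -> : (fun N => (avge s (b N) (t N) f (x N) * expR (- f (x N)) - 1) / t N ^+ 2) =
    (fun N => (2 * #|J|%:R)^-1 * \sum_j ((D N j 1 + D N j (-1)) + (q N j 1 + q N j (-1)))).
  apply/funext => N; have tn : t N != 0 by rewrite gt_eqF.
  have m0 : #|J|%:R != 0 :> R by rewrite pnatr_eq0 -lt0n.
  have DE j : (D N j 1 + D N j (-1)) + (q N j 1 + q N j (-1)) =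
      ((stepe s (b N) (t N) f (x N) j + stepe s (b N) (- t N) f (x N) j) *
       expR (- f (x N)) - 2) / t N ^+ 2.
    rewrite /D; have hz r : r ^+ 2 = 1 ->
        expR (z N j r) = stepe s (b N) (r * t N) f (x N) j * expR (- f (x N)).
      move=> r2; rewrite -expRD; congr expR; rewrite /z /q /P exprMn r2 mul1r.
      by field.
    rewrite !hz ?sqrrN ?expr1n // mul1r mulN1r /z.
    by field.
  under [in RHS]eq_bigr do rewrite DE.
  rewrite -mulr_suml sumrB -mulr_suml sumr_const -mulr_natr /avge.
  set S := \sum_j _; rewrite -/(#|J|); by field; rewrite tn m0.
rewrite /Qop; apply: cvgM; first exact: cvg_cst.
apply: cvg_sumr => j.
set P0 := dot (s j) x0 + _.
have -> : dot (s j) (b0 j) + qform X (b0 j) + P0 ^+ 2 =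
  ((1 * P0) ^+ 2 / 2 + ((-1) * P0) ^+ 2 / 2) +
  ((qform X (b0 j) / 2 + dot (s j) (b0 j) / 2) +
   (qform X (b0 j) / 2 + dot (s j) (b0 j) / 2)) by lra.
have p1 : `|(1 : R)| = 1 by rewrite normr1.
have h1 := cvgD (Dc j 1 p1) (Dc j (-1) n1).
have h2 := cvgD (qc j 1 p1) (qc j (-1) n1).
exact: (cvgD (h1 _) (h2 _)).
Unshelve. all: by end_near. Qed.

End Consistency.

(** * Stability *)

Section Stability.
Context {R : realType} {n : nat} {J : finType}.
Context {F : set_system nat} {FF : ProperFilter F}.
Implicit Types (f : 'cV[R]_n -> R) (x y z v w p : 'cV[R]_n) (X : 'M[R]_n).

Definition unif_on (P : set 'cV[R]_n) (u : nat -> 'cV[R]_n -> R) f : Prop :=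
  forall e, 0 < e -> \forall N \near F, forall x, P x -> `|u N x - f x| <= e.

Lemma unif_onN P u f : unif_on P u f -> unif_on P (fun N x => - u N x) (fun x => - f x).
Proof.
move=> uf e e0; apply: filterS (uf e e0) => N h x Px.
by rewrite -opprD normrN h.
Qed.

(** The [u N] are arbitrary functions here, so maximisers are replaced by points maximal up to
    [t N ^+ 4], an error that vanishes after division by t^2. They converge to x0 because the
    paraboloid makes the maximum strict. *)
Lemma near_max_seq (u : nat -> 'cV[R]_n -> R) f phi x0 rho e (t : nat -> R) :
  0 < rho -> 0 < e -> t @ F --> 0 -> (forall N, 0 < t N) ->
  unif_on [set x | l1norm (x - x0) <= rho] u f ->
  (forall x, l1norm (x - x0) <= rho -> f x - phi x <= f x0 - phi x0) ->
  let psi x := phi x + e * dot (x - x0) (x - x0) in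
  exists x : nat -> 'cV[R]_n, x @ F --> x0 /\
    \forall N \near F, forall z, l1norm (z - x0) <= rho ->
      u N z - psi z <= u N (x N) - psi (x N) + t N ^+ 4.
Proof.
move=> rho0 e0 t0 tp uf fmax psi.
pose B z := l1norm (z - x0) <= rho.
have Bx0 : B x0 by rewrite /B subrr l1norm0 ltW.
pose good N x := B x /\ forall z, B z -> u N z - psi z <= u N x - psi x + t N ^+ 4.
(* Good points exist only for F-almost all N, so the selection is made conditional, with x0 as
   default. *)
have /choice[x hx] : forall N, exists x, (exists y, good N y) -> good N x.
  move=> N; have [[y hy]|h] := pselect (exists y, good N y); first by exists y.
  by exists x0 => /h.
have psix0 : psi x0 = phi x0 by rewrite /psi subrr dot0l mulr0 addr0.
have upper d N z : B z -> `|u N z - f z| <= d ->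
    u N z - psi z + e * dot (z - x0) (z - x0) <= f x0 - phi x0 + d.
  by move=> Bz; rewrite ler_norml => /andP[_ h]; have := fmax _ Bz; rewrite /psi; lra.
have gd : \forall N \near F, good N (x N).
  apply: filterS (uf 1 ltr01) => N h1; apply: hx.
  pose A := [set u N z - psi z | z in [set z | B z]].
  have supA : has_sup A.
    split; first by exists (u N x0 - psi x0); exists x0.
    exists (f x0 - phi x0 + 1) => _ [z Bz <-].
    have := upper 1 N z Bz (h1 z Bz); have := mulr_ge0 (ltW e0) (dot_ge0 (z - x0)); lra.
  have t4 : 0 < t N ^+ 4 by rewrite exprn_gt0.
  have [_ [y By <-] hy] := sup_adherent t4 supA.
  exists y; split=> // z Bz.
  have : u N z - psi z <= sup A by apply: sup_upper_bound => //; exists z.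
  lra.
exists x; split; last by apply: filterS gd => N [].
apply/cvg_l1P => d d0.
have n0 : (0 : R) < n%:R ^+ 2 + 1 by rewrite ltr_wpDl // sqr_ge0.
(* Three errors of size c add up: the uniform distance at [x N], that at x0, and the defect
   [t N ^+ 4]. The factor [n ^+ 2 + 1] pays for passing from the Euclidean to the l1 norm. *)
pose c := e * d ^+ 2 / (n%:R ^+ 2 + 1) / 3.
have c0 : 0 < c by rewrite !divr_gt0 // mulr_gt0 // exprn_gt0.
have t1 : \forall N \near F, t N ^+ 4 <= c.
  have h : (fun N => t N * t N * (t N * t N)) @ F --> (0 * 0 * (0 * 0) : R).
    by apply: cvgM; apply: cvgM.
  rewrite !mul0r in h.
  near=> N; have hh : `|t N * t N * (t N * t N)| <= c.
    by near: N; exact: (cvgr0_norm_le _ h).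
  apply: le_trans hh; rewrite (_ : t N ^+ 4 = t N * t N * (t N * t N)); last by ring.
  exact: ler_norm.
near=> N.
have [Bx hz] : good N (x N) by near: N.
have tc : t N ^+ 4 <= c by near: N.
have huf : forall z, B z -> `|u N z - f z| <= c by near: N; exact: uf.
have h1 := upper c N _ Bx (huf _ Bx).
have h2 := hz _ Bx0; have := huf _ Bx0; rewrite ler_norml => /andP[h3 _].
have h4 : e * dot (x N - x0) (x N - x0) <= 3 * c.
  by rewrite psix0 in h2; lra.
have := l1norm_sqr_le (x N - x0); set q := dot _ _ in h4 * => h5.
have q0 : 0 <= q by exact: dot_ge0.
have h6 : l1norm (x N - x0) ^+ 2 <= d ^+ 2.
  apply: (le_trans h5); rewrite -(ler_pM2l e0).
  have n1 : (0 : R) <= n%:R ^+ 2 by rewrite sqr_ge0.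
  have := ler_wpM2l n1 h4.
  have -> : 3 * c = e * d ^+ 2 / (n%:R ^+ 2 + 1) by rewrite /c; field; rewrite gt_eqF.
  move=> h; rewrite mulrCA; apply: (le_trans h).
  rewrite mulrA ler_pdivrMr // mulrC ler_wpM2l ?lerDl //.
  by rewrite mulr_ge0 ?sqr_ge0 // ltW.
by move: h6; rewrite ler_sqr ?nnegrE ?l1norm_ge0 // ltW.
Unshelve. all: by end_near. Qed.

Lemma near_min_seq (u : nat -> 'cV[R]_n -> R) f phi x0 rho e (t : nat -> R) :
  0 < rho -> 0 < e -> t @ F --> 0 -> (forall N, 0 < t N) ->
  unif_on [set x | l1norm (x - x0) <= rho] u f ->
  (forall x, l1norm (x - x0) <= rho -> f x0 - phi x0 <= f x - phi x) ->
  let psi x := phi x + (- e) * dot (x - x0) (x - x0) in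
  exists x : nat -> 'cV[R]_n, x @ F --> x0 /\
    \forall N \near F, forall z, l1norm (z - x0) <= rho ->
      u N (x N) - psi (x N) - t N ^+ 4 <= u N z - psi z.
Proof.
move=> rho0 e0 t0 tp uf fmin psi.
have [|x [xx hx]] := @near_max_seq (fun N x => - u N x) (fun x => - f x)
  (fun x => - phi x) x0 rho e t rho0 e0 t0 tp (unif_onN uf).
  by move=> x /fmin; lra.
exists x; split=> //; apply: filterS hx => N h z zr; have := h z zr; rewrite /psi.
lra.
Qed.

Variables (s : J -> 'cV[R]_n) (t : nat -> R) (b : nat -> J -> 'cV[R]_n).
Variable b0 : J -> 'cV[R]_n.
Hypothesis J0 : (0 < #|J|)%N.
Hypothesis t0 : t @ F --> 0.
Hypothesis tp : forall N, 0 < t N.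
Hypothesis bb : forall j, (fun N => b N j) @ F --> b0 j.

Lemma Qop_perturb X e p x : Qop s b0 (X + (2 * e)%:M) p x =
  Qop s b0 X p x + e * (#|J|%:R^-1 * \sum_j dot (b0 j) (b0 j)).
Proof.
have m0 : #|J|%:R != 0 :> R by rewrite pnatr_eq0 -lt0n.
rewrite /Qop.
have -> : \sum_j (dot (s j) (b0 j) + qform (X + (2 * e)%:M) (b0 j) +
      (dot (s j) x + dot p (b0 j)) ^+ 2) =
    \sum_j (dot (s j) (b0 j) + qform X (b0 j) + (dot (s j) x + dot p (b0 j)) ^+ 2) +
    2 * e * \sum_j dot (b0 j) (b0 j).
  rewrite mulr_sumr -big_split; apply: eq_bigr => j _ /=.
  by rewrite /qform mulmxDl mul_scalar_mx !dotE; ring.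
by field; rewrite m0.
Qed.

Lemma stay_near (x : nat -> 'cV[R]_n) x0 rho : 0 < rho -> x @ F --> x0 ->
  \forall N \near F, forall j, l1norm (x N + t N *: b N j - x0) <= rho /\
     l1norm (x N - t N *: b N j - x0) <= rho.
Proof.
move=> rho0 xx.
have h j : \forall N \near F, l1norm (x N + t N *: b N j - x0) <= rho /\
     l1norm (x N - t N *: b N j - x0) <= rho.
  have r2 : 0 < rho / 2 by rewrite divr_gt0.
  have tb : (fun N => t N * l1norm (b N j)) @ F --> 0.
    by rewrite -(mul0r (l1norm (b0 j))); apply: cvgM => //; exact: cvg_l1norm.
  near=> N.
  have h1 : l1norm (x N - x0) <= rho / 2 by near: N; move: (rho / 2) r2; exact/cvg_l1P.
  have h2 : `|t N * l1norm (b N j)| <= rho / 2 by near: N; exact: (cvgr0_norm_le _ tb).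
  have h3 := ler_norm (t N * l1norm (b N j)).
  split; rewrite addrAC; apply: (le_trans (l1norm_triangle _ _));
    rewrite ?l1normN l1normZ (gtr0_norm (tp N)); lra.
exact: filter_forall h.
Unshelve. all: by end_near. Qed.

Lemma le_of_all_eps (a c q : R) : (forall e, 0 < e -> a <= c + e * q) -> a <= c.
Proof.
move=> h; apply/ler_addgt0Pr => e e0.
have q0 : 0 < `|q| + 1 by rewrite ltr_wpDl.
apply: (le_trans (h (e / (`|q| + 1)) _)); first by rewrite divr_gt0.
rewrite lerD2l -mulrA ler_piMr ?(ltW e0) // ler_pdivrMl // mulr1.
by have := ler_norm q; lra.
Qed.

(** Up to a constant, the perturbed test function lies above [u N] at all neighbours of an
    almost-maximum, so monotonicity transfers the scheme inequality to it, and consistency applies.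
    The perturbation is removed by [le_of_all_eps]. *)
Lemma stability_sub (u : nat -> 'cV[R]_n -> R) f phi g X x0 rho (mu : nat -> R) (m : R) :
  0 < rho -> mu @ F --> m -> jet2 phi g X x0 ->
  unif_on [set x | l1norm (x - x0) <= rho] u f ->
  (forall x, l1norm (x - x0) <= rho -> f x - phi x <= f x0 - phi x0) ->
  (\forall N \near F, forall x, l1norm (x - x0) <= rho ->
     u N x + t N ^+ 2 * mu N <= logavg s (b N) (t N) (u N) x) ->
  m <= Qop s b0 X (g x0) x0.
Proof.
move=> rho0 mum phiJ uf fmax usub.
apply: (@le_of_all_eps _ _ (#|J|%:R^-1 * \sum_j dot (b0 j) (b0 j))) => e e0.
have [x [xx hx]] := near_max_seq rho0 e0 t0 tp uf fmax.
have := consistency (s:=s) J0 (jet2_perturb e phiJ) t0 tp bb xx.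
rewrite jet2_grad_perturb Qop_perturb => hc.
pose psi x := phi x + e * dot (x - x0) (x - x0).
have hmu : (fun N => mu N - t N * t N) @ F --> m.
  by rewrite -[m]subr0 -(mul0r 0); apply: cvgB => //; exact: cvgM.
apply: (cvg_le_lim hmu (hc _)).
near=> N.
have hx' : forall z, l1norm (z - x0) <= rho ->
      u N z - psi z <= u N (x N) - psi (x N) + t N ^+ 4 by near: N.
have hb : forall j, l1norm (x N + t N *: b N j - x0) <= rho /\
     l1norm (x N - t N *: b N j - x0) <= rho by near: N; exact: stay_near.
have hs : u N (x N) + t N ^+ 2 * mu N <= logavg s (b N) (t N) (u N) (x N).
  have hall : forall x, l1norm (x - x0) <= rho ->
     u N x + t N ^+ 2 * mu N <= logavg s (b N) (t N) (u N) x by near: N.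
  by apply: hall; near: N; move: rho rho0 {uf fmax usub hx}; exact/cvg_l1P.
pose k := u N (x N) - psi (x N) + t N ^+ 4.
have : avge s (b N) (t N) (u N) (x N) <= avge s (b N) (t N) (fun z => psi z + k) (x N).
  by apply: avge_mono => // j; have [h1 h2] := hb j; split;
    [have := hx' _ h1|have := hx' _ h2]; rewrite /k; lra.
rewrite avge_addc => h.
have h2 : expR (u N (x N) + t N ^+ 2 * mu N) <=
    avge s (b N) (t N) psi (x N) * expR k.
  by apply: le_trans h; rewrite -expR_logavg // ler_expR.
rewrite ler_pdivlMr ?exprn_gt0 //.
have h3 : expR (t N ^+ 2 * mu N - t N ^+ 4) <=
    avge s (b N) (t N) psi (x N) * expR (- psi (x N)).
  rewrite -(ler_pM2r (expR_gt0 (k + psi (x N)))) -[leRHS]mulrA -!expRD.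
  have -> : t N ^+ 2 * mu N - t N ^+ 4 + (k + psi (x N)) = u N (x N) + t N ^+ 2 * mu N.
    by rewrite /k; ring.
  by have -> : - psi (x N) + (k + psi (x N)) = k by ring.
have := expR_ge1Dx (t N ^+ 2 * mu N - t N ^+ 4).
have -> : (mu N - t N * t N) * t N ^+ 2 = t N ^+ 2 * mu N - t N ^+ 4 by ring.
lra.
Unshelve. all: by end_near. Qed.

(* The scheme inequality is available at some y N near the touching points x N,
   with the l1 cost of moving from x N to y N paid by the test function. *)
Lemma stability_sup_core (u : nat -> 'cV[R]_n -> R) psi g X x0 rho (mu : nat -> R) (m : R)
    (x y : nat -> 'cV[R]_n) :
  0 < rho -> mu @ F --> m -> jet2 psi g X x0 ->
  y @ F --> x0 ->
  (\forall N \near F, forall z, l1norm (z - x0) <= rho ->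
      u N (x N) - psi (x N) - t N ^+ 4 <= u N z - psi z) ->
  (\forall N \near F, psi (x N) <= psi (y N) + l1norm (x N - y N)) ->
  (\forall N \near F, logavg s (b N) (t N) (u N) (y N) + l1norm (x N - y N) <=
     u N (x N) + t N ^+ 2 * mu N) ->
  Qop s b0 X (g x0) x0 <= m.
Proof.
move=> rho0 mum psiJ yy hx hpsi hsup.
have hc := consistency (s:=s) J0 psiJ t0 tp bb yy.
have tmu : (fun N => t N * (t N * (mu N + t N * t N))) @ F --> 0.
  rewrite -[X in _ --> X](mul0r (0 * (m + 0 * 0))).
  by do 2!apply: cvgM => //; apply: cvgD => //; exact: cvgM.
(* This is [(a + 2 * a ^+ 2) / t ^+ 2] for [a = t ^+ 2 * mu + t ^+ 4], the bound that [expR_le_quad]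
   gives for the average at the end. *)
have ec : (fun N => (mu N + t N * t N) + 2 * (t N * (t N * (mu N + t N * t N))) *
     (mu N + t N * t N)) @ F --> m.
  rewrite -[X in _ --> X]addr0 -(mul0r m).
  have h : (fun N => mu N + t N * t N) @ F --> m.
    by rewrite -[m]addr0 -(mul0r 0); apply: cvgD => //; exact: cvgM.
  apply: cvgD => //; apply: cvgM => //; rewrite -(mulr0 2).
  by apply: cvgM; [exact: cvg_cst|].
apply: (cvg_le_lim (hc _) ec); near=> N.
have hx' : forall z, l1norm (z - x0) <= rho ->
      u N (x N) - psi (x N) - t N ^+ 4 <= u N z - psi z by near: N.
have hb : forall j, l1norm (y N + t N *: b N j - x0) <= rho /\
     l1norm (y N - t N *: b N j - x0) <= rho by near: N; exact: stay_near.
have hs : logavg s (b N) (t N) (u N) (y N) + l1norm (x N - y N) <=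
     u N (x N) + t N ^+ 2 * mu N by near: N.
have hp : psi (x N) <= psi (y N) + l1norm (x N - y N) by near: N.
have th : t N * (t N * (mu N + t N * t N)) <= 2^-1.
  by apply: le_trans (ler_norm _) _; near: N; apply: (cvgr0_norm_le _ tmu).
pose k := u N (x N) - psi (x N) - t N ^+ 4.
have : avge s (b N) (t N) (fun z => psi z + k) (y N) <= avge s (b N) (t N) (u N) (y N).
  by apply: avge_mono => // j; have [h1 h2] := hb j; split;
    [have := hx' _ h1|have := hx' _ h2]; rewrite /k; lra.
rewrite avge_addc => h.
have h2 : avge s (b N) (t N) psi (y N) * expR k <=
    expR (u N (x N) + t N ^+ 2 * mu N - l1norm (x N - y N)).
  by apply: (le_trans h); rewrite -expR_logavg // ler_expR; lra.
rewrite ler_pdivrMr ?exprn_gt0 //.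
set a := t N * (t N * (mu N + t N * t N)) in th *.
have h3 : avge s (b N) (t N) psi (y N) * expR (- psi (y N)) <= expR a.
  rewrite -(ler_pM2r (expR_gt0 (k + psi (y N)))) -[leLHS]mulrA -!expRD.
  have -> : - psi (y N) + (k + psi (y N)) = k by ring.
  apply: (le_trans h2); rewrite ler_expR /k /a.
  have -> : t N * (t N * (mu N + t N * t N)) = t N ^+ 2 * mu N + t N ^+ 4 by ring.
  lra.
have := expR_le_quad th.
have -> : (mu N + t N * t N + 2 * a * (mu N + t N * t N)) * t N ^+ 2 = a + 2 * a ^+ 2.
  by rewrite {2}/a /a; ring.
lra.
Unshelve. all: by end_near. Qed.

End Stability.

(** * Convex functions with bounded second differences *)

Section SecondDifferences.
Context {R : realType} {n : nat}.
Implicit Types (f u : 'cV[R]_n -> R) (x y z v w : 'cV[R]_n).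

Local Notation ee i := (delta_mx i 0 : 'cV[R]_n).

Lemma cvx_avg u (y : nat -> 'cV[R]_n) k : cvx u ->
  u (k.+1%:R^-1 *: \sum_(i < k.+1) y i) <= k.+1%:R^-1 * \sum_(i < k.+1) u (y i).
Proof.
move=> uC; elim: k => [|k IH].
  by rewrite !big_ord1 invr1 scale1r mul1r.
rewrite big_ord_recr [in leRHS]big_ord_recr /=.
set S := \sum_(i < k.+1) y i in IH *; set T := \sum_(i < k.+1) u (y i) in IH *.
have kE : k.+2%:R = k.+1%:R + 1 :> R by rewrite -natr1.
have a0 : 0 < k.+1%:R :> R by rewrite ltr0n.
rewrite kE; clear kE; move: (k.+1%:R : R) a0 IH => a a0 IH.
have a1 : 0 < a + 1 by rewrite addr_gt0.
have [az a1z] : a != 0 /\ a + 1 != 0 by rewrite !gt_eqF.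
pose p : R := a / (a + 1).
have p01 : 0 <= p <= 1.
  by rewrite divr_ge0 ?(ltW a0) ?(ltW a1) //= ler_pdivrMr // mul1r lerDl.
have -> : (a + 1)^-1 *: (S + y k.+1) = p *: (a^-1 *: S) + (1 - p) *: y k.+1.
  by apply/matrixP => i j; rewrite !mxE /p; field; rewrite ?az ?a1z.
apply: (le_trans (uC _ _ _ p01)).
have := ler_wpM2l (proj1 (andP p01)) IH.
have -> : p * (a^-1 * T) = (a + 1)^-1 * T by rewrite /p; field; rewrite ?az ?a1z.
have -> : (a + 1)^-1 * (T + u (y k.+1)) = (a + 1)^-1 * T + (1 - p) * u (y k.+1).
  by rewrite /p; field; rewrite ?a1z.
lra.
Qed.

(** Semiconcavity along the line of v. With the constant quantified inside, the admissible v form a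
    linear subspace when u is convex, so a spanning family of directions suffices. *)
Definition semic u v := exists2 A, 0 <= A & forall x (r : R),
  u (x + r *: v) + u (x - r *: v) - 2 * u x <= A * r ^+ 2.

Lemma semic0 u : semic u 0.
Proof.
by exists 0 => // x r; rewrite scaler0 addr0 subr0 mul0r; lra.
Qed.

Lemma semicZ u c v : semic u v -> semic u (c *: v).
Proof.
move=> [A A0 hA]; exists (A * c ^+ 2); first by rewrite mulr_ge0 // sqr_ge0.
move=> x r; have := hA x (r * c); rewrite scalerA exprMn.
by rewrite -mulrA [c ^+ 2 * _]mulrC.
Qed.

Lemma semicD u v w : cvx u -> semic u v -> semic u w -> semic u (v + w).
Proof.
move=> uC [A A0 hA] [B B0 hB]; exists (2 * (A + B)); first by rewrite mulr_ge0 ?addr_ge0.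
move=> x r; have := hA x (2 * r); have := hB x (2 * r).
have p01 : 0 <= (2^-1 : R) <= 1 by apply/andP; split; lra.
have := uC 2^-1 (x + (2 * r) *: v) (x + (2 * r) *: w) p01.
have := uC 2^-1 (x - (2 * r) *: v) (x - (2 * r) *: w) p01.
have -> : 2^-1 *: (x - (2 * r) *: v) + (1 - 2^-1) *: (x - (2 * r) *: w) =
    x - r *: (v + w) by apply/matrixP => i j; rewrite !mxE; field.
have -> : 2^-1 *: (x + (2 * r) *: v) + (1 - 2^-1) *: (x + (2 * r) *: w) =
    x + r *: (v + w) by apply/matrixP => i j; rewrite !mxE; field.
lra.
Qed.

Lemma semic_sum u (I : Type) (r : seq I) (c : I -> R) (v : I -> 'cV[R]_n) : cvx u ->
  (forall i, semic u (v i)) -> semic u (\sum_(i <- r) c i *: v i).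
Proof.
move=> uC uv; elim: r => [|i r IH]; first by rewrite big_nil; exact: semic0.
by rewrite big_cons; apply: semicD => //; exact: semicZ.
Qed.

(* Slopes of a convex function on a line squeezed by the second difference. *)
Lemma semic_derive u v x A : cvx u -> 0 <= A ->
  (forall r : R, u (x + r *: v) + u (x - r *: v) - 2 * u x <= A * r ^+ 2) ->
  exists p, forall h : R, 0 <= u (x + h *: v) - u x - h * p <= A * h ^+ 2.
Proof.
move=> uC A0 uA.
pose sl h := (u (x + h *: v) - u x) / h.
pose slm h := (u x - u (x - h *: v)) / h.
have mono h k : 0 < h -> 0 < k -> slm h <= sl k.
  move=> h0 k0; pose p := h / (h + k).
  have hk : 0 < h + k by rewrite addr_gt0.
  have p01 : 0 <= p <= 1.
    by rewrite divr_ge0 ?(ltW h0) ?(ltW hk) //= ler_pdivrMr // mul1r lerDl ltW.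
  have := uC p (x + k *: v) (x - h *: v) p01.
  have -> : p *: (x + k *: v) + (1 - p) *: (x - h *: v) = x.
    by apply/matrixP => i j; rewrite !mxE /p; field; rewrite gt_eqF.
  move=> h1; rewrite /slm /sl ler_pdivrMr // mulrAC ler_pdivlMr //; move: h1.
  set a := u (x + _); set c := u (x - _); set d := u x => h1.
  have : (h + k) * d <= (h + k) * (p * a + (1 - p) * c) by rewrite ler_wpM2l // ltW.
  have -> : (h + k) * (p * a + (1 - p) * c) = h * a + k * c.
    by rewrite /p; field; rewrite gt_eqF.
  lra.
pose P := [set sl h | h in [set h | 0 < h]].
have infP : has_inf P.
  split; first by exists (sl 1); exists 1 => //=.
  by exists (slm 1) => _ [h /= h0 <-]; exact: mono.
have p_le h : 0 < h -> inf P <= sl h.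
  by move=> h0; apply: ge_inf; [case: infP|exists h].
have p_ge h : 0 < h -> slm h <= inf P.
  by move=> h0; apply: lb_le_inf; [case: infP|move=> _ [k /= k0 <-]; exact: mono].
exists (inf P); set p := inf P in p_le p_ge *.
have pos h : 0 < h -> (0 <= u (x + h *: v) - u x - h * p <= A * h ^+ 2) &&
    (0 <= u (x - h *: v) - u x + h * p <= A * h ^+ 2).
  move=> h0; have := p_le _ h0; have := p_ge _ h0.
  rewrite /sl /slm ler_pdivrMr // ler_pdivlMr // => h1 h2; have := uA h => h3.
  by apply/andP; split; apply/andP; split; lra.
move=> h; have [h0|h0|<-] := ltgtP 0 h.
- by case/andP: (pos _ h0).
- have nh : 0 < - h by rewrite oppr_gt0.
  by have /andP[_] := pos _ nh; rewrite scaleNr opprK sqrrN mulNr.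
- by rewrite scale0r addr0 subrr mul0r subr0 expr0n mulr0 lexx.
Qed.

Section GradientLipschitz.
Variables (u : 'cV[R]_n -> R) (A : R).
Hypothesis uC : cvx u.
Hypothesis A0 : 0 <= A.
Hypothesis uA : forall i x r,
  u (x + r *: ee i) + u (x - r *: ee i) - 2 * u x <= A * r ^+ 2.

Lemma semic_partial i x (h : R) :
  0 <= u (x + h *: ee i) - u x - h * partial i u x <= A * h ^+ 2.
Proof.
have [p hp] := semic_derive uC A0 (uA i x).
have d : is_derive x (ee i) u p.
  apply/is_derive_epsP => e e0; exists (e / (A + 1)).
    by rewrite divr_gt0 // ltr_wpDl.
  move=> k; rewrite ler_pdivlMr ?ltr_wpDl // => ke.
  have /andP[h1 h2] := hp k; rewrite ger0_norm //; apply: (le_trans h2).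
  by rewrite -real_normK ?num_real //; have := normr_ge0 k; nra.
have -> : partial i u x = p by case: d.
exact: hp.
Qed.

Lemma semic_derivable i x : derivable u x (ee i).
Proof.
have [p hp] := semic_derive uC A0 (uA i x).
have [] // : is_derive x (ee i) u p.
apply/is_derive_epsP => e e0; exists (e / (A + 1)).
  by rewrite divr_gt0 // ltr_wpDl.
move=> k; rewrite ler_pdivlMr ?ltr_wpDl // => ke.
have /andP[h1 h2] := hp k; rewrite ger0_norm //; apply: (le_trans h2).
by rewrite -real_normK ?num_real //; have := normr_ge0 k; nra.
Qed.

Lemma cV_sum_delta w : w = \sum_i w i 0 *: ee i.
Proof.
apply/matrixP => i j; rewrite summxE (bigD1 i) //= !mxE (ord1 j) !eqxx mulr1.
by rewrite big1 ?addr0 // => k ki; rewrite !mxE eq_sym (negbTE ki) mulr0.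
Qed.

(** x + w is the mean of the n points [x + n w_i e_i], so Jensen reduces the bound to the coordinate
    directions. The factor n of each step, squared and then averaged, leaves one n. *)
Lemma semic_upper x w :
  u (x + w) - u x - dot (grad u x) w <= A * n%:R * l1norm w ^+ 2.
Proof.
have [n0|n0] := posnP n.
  have -> : w = 0.
    by apply/matrixP => -[i ilt]; exfalso; have := ilt; rewrite n0.
  by rewrite addr0 dot0r subrr subr0 mulr_ge0 ?sqr_ge0 // mulr_ge0.
have np : (0 : R) < n%:R by rewrite ltr0n.
have nz : (n%:R : R) != 0 by rewrite gt_eqF.
pose o (i : nat) : 'I_n := insubd (Ordinal n0) i.
have oK (i : 'I_n) : o i = i by rewrite /o valKd.
pose y (i : nat) := x + (n%:R * w (o i) 0) *: ee (o i).
have := cvx_avg y n.-1 uC.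
have sE (T : nmodType) (G : nat -> T) : \sum_(i < n.-1.+1) G i = \sum_(i < n) G i.
  by rewrite prednK.
rewrite (sE _ y) (sE _ (fun i => u (y i))) prednK // => h.
have yE : n%:R^-1 *: (\sum_(i < n) y i) = x + w.
  rewrite /y; under eq_bigr do rewrite oK.
  rewrite big_split /= sumr_const card_ord scalerDr -[x *+ n]scaler_nat scalerA mulVf //.
  rewrite scale1r scaler_sumr; congr (_ + _); rewrite [RHS]cV_sum_delta.
  by apply: eq_bigr => i _; rewrite scalerA mulrA mulVf // mul1r.
rewrite yE in h.
have h2 : \sum_(i < n) u (y i) <=
    \sum_(i < n) (u x + n%:R * (grad u x i 0 * w i 0) + A * n%:R ^+ 2 * (w i 0) ^+ 2).
  apply: ler_sum => i _; rewrite /y oK mxE.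
  by have /andP[_] := semic_partial i x (n%:R * w i 0); rewrite exprMn; lra.
have h3 : n%:R^-1 * \sum_(i < n) u (y i) <=
    u x + dot (grad u x) w + A * n%:R * dot w w.
  apply: (le_trans (ler_wpM2l _ h2)); first by rewrite invr_ge0 ltW.
  rewrite 2!big_split /= sumr_const card_ord -mulr_natr -!mulr_sumr -/(dot _ w).
  have -> : \sum_i w i 0 ^+ 2 = dot w w by apply: eq_bigr => i _; rewrite expr2.
  by rewrite le_eqVlt; apply/orP; left; apply/eqP; field.
have h4 : dot w w <= l1norm w ^+ 2 by rewrite expr2; exact: le_trans (ler_norm _) (dot_bound _ _).
have An : 0 <= A * n%:R by rewrite mulr_ge0.
have := ler_wpM2l An h4; lra.
Qed.

(** The deviation g from the tangent plane is convex, vanishes at 0 and is at most [r ^+ 2 * K] at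
    [- r w]. Midpoint convexity at 0 gives [g (r w) >= - r ^+ 2 * K], and [g (r w) <= r * g w], so
    [g w >= - r * K] for every small r. *)
Lemma semic_lower x w : 0 <= u (x + w) - u x - dot (grad u x) w.
Proof.
pose g v := u (x + v) - u x - dot (grad u x) v.
have gC : cvx g.
  move=> p v v' p01; have := uC (x + v) (x + v') p01.
  have -> : p *: (x + v) + (1 - p) *: (x + v') = x + (p *: v + (1 - p) *: v').
    by apply/matrixP => i j; rewrite !mxE; ring.
  by rewrite /g !dotE; lra.
have g0 : g 0 = 0 by rewrite /g addr0 dot0r; lra.
pose K := A * n%:R * l1norm w ^+ 2.
have K0 : 0 <= K by rewrite mulr_ge0 ?sqr_ge0 // mulr_ge0.
have step (r : R) : 0 < r <= 1 -> - (r * K) <= g w.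
  move=> /andP[r0 r1].
  have h1 : g (r *: w) <= r * g w.
    have := gC r w 0; rewrite scaler0 addr0 g0 mulr0 addr0; apply.
    by rewrite (ltW r0).
  have h2 := cvx_mid 0 (r *: w) gC; rewrite g0 add0r sub0r in h2.
  have h3 := semic_upper x (- (r *: w)); rewrite -/(g _) l1normN l1normZ exprMn in h3.
  rewrite real_normK ?num_real // in h3.
  have h4 : - (r ^+ 2 * K) <= r * g w by rewrite /K; lra.
  by rewrite -(ler_pM2l r0); lra.
rewrite leNgt; apply/negP => gw; rewrite -/(g w) in gw.
have q0 : 0 < K - g w by rewrite subr_gt0 (lt_le_trans gw).
pose r := - g w / (K - g w) / 2.
have gwn : 0 < - g w by rewrite oppr_gt0.
have r0 : 0 < r by rewrite !divr_gt0.
have hr : r * (K - g w) = - g w / 2 by rewrite /r; field; rewrite gt_eqF.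
have r1 : r <= 1.
  by rewrite -(ler_pM2r q0) hr mul1r; lra.
have := step r; rewrite r0 r1 => /(_ isT).
by nra.
Qed.

(** At the point [y + d e_i], with d the distance from x to y, the tangent plane at x lies below the
    parabola at y. The two quadratic errors are of order d^2, and dividing by d bounds the
    difference of slopes. *)
Lemma semic_grad_lip i x y :
  `|partial i u x - partial i u y| <= 2 * A * n%:R * l1norm (x - y).
Proof.
wlog suff H : x y / partial i u x - partial i u y <= 2 * A * n%:R * l1norm (x - y).
  by rewrite ler_norml H andbT; have := H y x; rewrite l1normB; lra.
have [d0|dn] := eqVneq (l1norm (x - y)) 0.
  have -> : x = y.
    apply/eqP; rewrite -subr_eq0; apply/eqP/matrixP => k j; rewrite (ord1 j) [RHS]mxE.
    by apply/eqP; rewrite -normr_le0 -d0 l1norm_coord.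
  by rewrite !subrr l1norm0 mulr0.
have d0 : 0 < l1norm (x - y) by rewrite lt_neqAle eq_sym dn l1norm_ge0.
set d := l1norm _ in d0 *.
pose w := d *: ee i.
have h1 := semic_upper y w; have h2 := semic_upper x (y - x).
have h3 := semic_lower x (y + w - x).
rewrite !(addrC x) !subrK in h2 h3.
have wn : l1norm w = d by rewrite l1normZ l1norm_delta mulr1 gtr0_norm.
rewrite wn in h1; rewrite l1normB -/d in h2.
have e1 v : dot v w = d * v i 0.
  rewrite dotZr /dot (bigD1 i) //= mxE !eqxx mulr1 big1 ?addr0 // => k ki.
  by rewrite mxE (negbTE ki) mulr0.
rewrite [y + w - x]addrAC dotDr !e1 in h3; rewrite e1 in h1.
have : d * (grad u x i 0 - grad u y i 0) <= d * (2 * A * n%:R * d) by lra.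
by rewrite ler_pM2l // !mxE.
Qed.

Lemma semic_C1 : C1 u.
Proof.
move=> i; split=> [x|]; first exact: semic_derivable.
exact: lipschitz_l1_continuous (semic_grad_lip i).
Qed.

End GradientLipschitz.

(** For distances above 1 the gradient bound gives 2; below 1 a distance is at most its power alpha.
    The constant is therefore the same for all compact sets. *)
Lemma lip_C1alpha u K (alpha : R) : C1 u -> lip1 u -> 0 <= K ->
  (forall i x y, `|partial i u x - partial i u y| <= K * l1norm (x - y)) ->
  (forall i x, `|partial i u x| <= 1) ->
  0 < alpha < 1 -> C1alpha_loc alpha u.
Proof.
move=> uC1 uL K0 uK u1 /andP[a0 a1]; split=> // B _; exists (2 + K * n%:R) => i x y _ _.
have n0 : 0 <= n%:R :> R by [].
have en0 : 0 <= enorm (x - y) by rewrite sqrtr_ge0.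
have [e1|e1] := leP (enorm (x - y)) 1; last first.
  have : `|partial i u x - partial i u y| <= 2.
    by apply: (le_trans (ler_normB _ _)); have := u1 i x; have := u1 i y; lra.
  move=> h; apply: (le_trans h).
  have : 1 <= enorm (x - y) `^ alpha by rewrite -[leLHS](powRr0 (enorm (x - y))) ler_powR // ltW.
  have := mulr_ge0 K0 n0; nra.
apply: (le_trans (uK i x y)).
have h1 := l1norm_le_enorm (x - y).
have h2 : enorm (x - y) <= enorm (x - y) `^ alpha.
  have [->|ez] := eqVneq (enorm (x - y)) 0; first by rewrite powR0 // gt_eqF.
  by rewrite ger1_powR ?(ltW a1) // e1 lt_neqAle eq_sym ez en0.
have h3 := ler_wpM2l K0 h1; have h4 := ler_wpM2l (mulr_ge0 K0 n0) h2.
have h5 := powR_ge0 (enorm (x - y)) alpha; lra.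
Qed.

End SecondDifferences.

(** * Limits of discrete eigenpairs *)

Section Tools.
Context {R : realType} {n : nat}.
Implicit Types (f u : 'cV[R]_n -> R) (x y z v w : 'cV[R]_n).

(** Two consecutive increments of [D] differ by the second differences at [x +- (k+1) w], so the
    k-th increment is at most [(2k+1) c], and odd numbers sum to squares. This carries a bound at
    step t to all multiples of t. *)
Lemma second_diff_scale u w c (k : nat) x :
  (forall x, u (x + w) + u (x - w) - 2 * u x <= c) ->
  u (x + k%:R *: w) + u (x - k%:R *: w) - 2 * u x <= k%:R ^+ 2 * c.
Proof.
move=> uc; pose D (l : nat) := u (x + l%:R *: w) + u (x - l%:R *: w) - 2 * u x.
suff : D k <= k%:R ^+ 2 * c /\ D k.+1 - D k <= (2 * k%:R + 1) * c by case.
elim: k => [|k [IH1 IH2]].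
  have D0 : D 0%N = 0 by rewrite /D scale0r addr0 subr0; lra.
  rewrite D0; split; first by rewrite expr0n /= mul0r.
  by have := uc x; rewrite /D !scale1r; lra.
have kE : k.+1%:R = k%:R + 1 :> R by rewrite -natr1.
have kE2 : k.+2%:R = k%:R + 2 :> R by rewrite -natr1 kE; ring.
split; first by rewrite kE; lra.
have h1 := uc (x + k.+1%:R *: w); have h2 := uc (x - k.+1%:R *: w).
have e1 : x + k.+1%:R *: w + w = x + k.+2%:R *: w.
  by apply/matrixP => i j; rewrite !mxE kE kE2; ring.
have e2 : x + k.+1%:R *: w - w = x + k%:R *: w.
  by apply/matrixP => i j; rewrite !mxE kE; ring.
have e3 : x - k.+1%:R *: w + w = x - k%:R *: w.
  by apply/matrixP => i j; rewrite !mxE kE; ring.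
have e4 : x - k.+1%:R *: w - w = x - k.+2%:R *: w.
  by apply/matrixP => i j; rewrite !mxE kE kE2; ring.
rewrite e1 e2 in h1; rewrite e3 e4 in h2.
by move: IH2; rewrite /D kE; rewrite kE in h1 h2; lra.
Qed.

Lemma dot_le_slope (g w : 'cV[R]_n) q : (forall i, `|g i 0| <= q) ->
  dot g w <= q * l1norm w.
Proof.
move=> gq; apply: (le_trans (ler_norm _)); apply: (le_trans (ler_norm_sum _ _ _)).
rewrite mulr_sumr; apply: ler_sum => i _; rewrite normrM ler_wpM2r //.
Qed.

(** The strict inequalities persist near y0 by continuity, and th is half the gap. [MVT_line] only
    gives [|c| <= 1], so the intermediate point may lie behind z, whence the radius [r / 3]. *)
Lemma C1_slope psi y0 : C1 psi -> (forall i, `|partial i psi y0| < 1) ->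
  exists2 th, 0 < th & exists2 rho, 0 < rho & forall x z,
    l1norm (x - y0) <= rho -> l1norm (z - y0) <= rho ->
    psi x - psi z <= (1 - th) * l1norm (x - z).
Proof.
move=> psi1 psi_lt; pose q := \big[Num.max/0]_i `|partial i psi y0|.
have q1 : q < 1 by apply/bigmax_ltP; split.
pose th := (1 - q) / 2; have th0 : 0 < th by rewrite /th; lra.
exists th => //.
have [r r0 hr] := continuous_l1_fin (fun i => (psi1 i).2 y0) th0.
exists (r / 3); first by rewrite divr_gt0.
move=> x z xr zr.
have fl (s : R) : is_derive s 1 (fun r => psi (z + r *: (x - z)))
    (dot (grad psi (z + s *: (x - z))) (x - z)).
  by apply: is_derive_line; exact: C1_dir.
have [c c1] := MVT_line 1 fl.
have e : z + (x - z) = x by rewrite addrC subrK.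
rewrite scale1r scale0r addr0 e mulr1 => ->.
apply: dot_le_slope => i; rewrite mxE.
have h : l1norm (z + c *: (x - z) - y0) <= r.
  have -> : z + c *: (x - z) - y0 = (z - y0) + c *: ((x - y0) - (z - y0)).
    by apply/matrixP => k l; rewrite !mxE; ring.
  apply: (le_trans (l1norm_triangle _ _)); rewrite l1normZ.
  have ha := l1norm_triangle (x - y0) (- (z - y0)); rewrite l1normN in ha.
  have a0 := l1norm_ge0 (x - y0 - (z - y0)); rewrite normr1 in c1.
  have := ler_wpM2r a0 c1; set a := l1norm (x - y0 - (z - y0)) in ha *.
  lra.
have h2 := hr i _ h.
have h3 : `|partial i psi y0| <= q by exact: (le_bigmax _ (fun i => `|partial i psi y0|)).
have := ler_normD (partial i psi (z + c *: (x - z)) - partial i psi y0) (partial i psi y0).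
by rewrite subrK /th; rewrite /th in h2; lra.
Qed.

(** One ultrafilter makes all bounded sequences converge simultaneously, so limits at uncountably
    many points x exist without extraction of subsequences. *)
Lemma ultra_lim (F : set_system nat) (a : nat -> R) (M : R) : UltraFilter F ->
  (forall N, `|a N| <= M) -> exists l : R, a @ F --> l.
Proof.
move=> FU aM.
have FP : ProperFilter (a @ F) by exact: fmap_proper_filter.
have FA : (a @ F) `[- M, M]%classic.
  have h : F (a @^-1` `[- M, M]%classic).
    by apply: filterS filterT => N _ /=; rewrite in_itv /= -ler_norml.
  exact: h.
have [l [_ lc]] := segment_compact FP FA.
exists l => P Pl; have [//|h] := in_ultra_setVsetC (a @^-1` P) FU.
by have [y [/= h1 h2]] := lc (~` P) P h Pl; case: h1.
Qed.

End Tools.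

Section Limit.
Context {R : realType} {n : nat} {J : finType}.
Context {F : set_system nat} {FF : ProperFilter F}.
Implicit Types (f : 'cV[R]_n -> R) (x y z v w : 'cV[R]_n).

Lemma pointwise_unif (u_ : nat -> 'cV[R]_n -> R) u x0 M :
  (forall N, lip1 (u_ N)) -> lip1 u -> (forall x, (fun N => u_ N x) @ F --> u x) ->
  @unif_on _ _ F [set x | l1norm (x - x0) <= M] u_ u.
Proof.
move=> uL Lu uu e e0; pose K := [set x | l1norm x <= M + l1norm x0] : set 'cV[R]_n.
have cK : near_covering K by apply/compact_near_coveringP; exact: l1ball_compact.
have h : \forall N \near F, K `<=` [set x | `|u_ N x - u x| <= e].
  apply: (cK _ F (fun N x => `|u_ N x - u x| <= e)) => x _.
  have e3 : 0 < e / 3 by rewrite divr_gt0.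
  exists ([set y | l1norm (y - x) <= e / 3], [set N | `|u_ N x - u x| <= e / 3]).
    split => /=; first by apply/nbhs_l1P; exists (e / 3).
    by have /cvgrPdist_le := uu x; move=> /(_ _ e3); apply: filterS => N; rewrite distrC.
  move=> [y N] /= [h1 h2].
  have := lip1_norm y x (uL N); have := lip1_norm y x Lu.
  have -> : u_ N y - u y = (u_ N y - u_ N x) + (u_ N x - u x) - (u y - u x) by ring.
  move=> h3 h4; apply: (le_trans (ler_normB _ _)).
  have := ler_normD (u_ N y - u_ N x) (u_ N x - u x); lra.
apply: filterS h => N h x /= hx; apply: h; rewrite /K /=.
by have := l1norm_triangle (x - x0) x0; rewrite subrK; lra.
Qed.

Variables (s : J -> 'cV[R]_n) (t : nat -> R) (b : nat -> J -> 'cV[R]_n).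
Variables (b0 : J -> 'cV[R]_n) (C : R) (u_ : nat -> 'cV[R]_n -> R) (k_ : nat -> R).
Variables (u : 'cV[R]_n -> R) (k : R).
Hypothesis J0 : (0 < #|J|)%N.
Hypothesis C0 : 0 < C.
Hypothesis t0 : t @ F --> 0.
Hypothesis tp : forall N, 0 < t N.
Hypothesis t1 : forall N, t N <= 1.
Hypothesis bb : forall j, (fun N => b N j) @ F --> b0 j.
Hypothesis dp : forall N, dpair s C (t N) (b N) (u_ N) (k_ N).
Hypothesis uu : forall x, (fun N => u_ N x) @ F --> u x.
Hypothesis kk : k_ @ F --> k.

Lemma lim_cvx : cvx u.
Proof.
move=> p x y p01.
apply: (@cvg_le_lim _ F _ _ (fun N => p * u_ N x + (1 - p) * u_ N y)); first exact: uu.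
  by apply: cvgD; apply: cvgM => //; exact: cvg_cst.
by near=> N; have := dp_cvx (dp N); apply.
Unshelve. all: by end_near. Qed.

Lemma lim_lip : lip1 u.
Proof.
move=> x y; apply: (@cvg_le_lim _ F _ _ (fun N => u_ N y + l1norm (x - y))); first exact: uu.
  by apply: cvgD => //; exact: cvg_cst.
by near=> N; exact: dp_lip (dp N) x y.
Unshelve. all: by end_near. Qed.

Lemma lim_0 : u 0 = 0.
Proof.
have h : (fun N => u_ N 0) @ F --> u 0 by exact: uu.
have e : (fun N => u_ N 0) = (fun=> 0) by apply/funext => N; exact: dp_0 (dp N).
rewrite e in h; apply/eqP; rewrite eq_le; apply/andP; split.
  by apply: (cvg_le_lim h (cvg_cst 0)); near=> N.
by apply: (cvg_le_lim (cvg_cst 0) h); near=> N.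
Unshelve. all: by end_near. Qed.

Lemma lim_growth x : l1norm x - C <= u x.
Proof.
apply: (cvg_le_lim (cvg_cst (l1norm x - C)) (uu (x:=x))).
by near=> N; exact: dp_growth (dp N) x.
Unshelve. all: by end_near. Qed.

Lemma lim_unif x0 M : @unif_on _ _ F [set x | l1norm (x - x0) <= M] u_ u.
Proof. by apply: pointwise_unif => // [N|]; [exact: dp_lip (dp N)|exact: lim_lip]. Qed.

(** The direction v is constant along the sequence. The bound holds at multiples of the step; r is
    within [t N] of the multiple [l N * t N], and the Lipschitz bound moves the points. *)
Lemma lim_semic v : (exists j, forall N, b N j = v) -> forall x (r : R),
  u (x + r *: v) + u (x - r *: v) - 2 * u x <= C * r ^+ 2.
Proof.
move=> [j bv] x r.
wlog r0 : r / 0 <= r => [hw|].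
  have [/hw //|/ltW r0] := leP 0 r.
  have := hw (- r); rewrite oppr_ge0 scaleNr opprK sqrrN => /(_ r0); lra.
pose l N := Num.trunc (r / t N).
have lt N : `|(l N)%:R * t N - r| <= t N.
  have /truncn_itv/andP[h1 h2] : 0 <= r / t N by rewrite divr_ge0 // ltW.
  move: h1 h2; rewrite -/(l N) ler_pdivlMr // ltr_pdivrMr // -natr1 => h1 h2.
  by rewrite ler_norml; apply/andP; split; lra.
have lc : (fun N => (l N)%:R * t N - r) @ F --> 0.
  by apply: (cvg_0_le t0); near=> N; exact: lt.
have lr : (fun N => (l N)%:R * t N) @ F --> r.
  have -> : (fun N => (l N)%:R * t N) = (fun N => ((l N)%:R * t N - r) + r).
    by apply/funext => N; rewrite subrK.
  by rewrite -[X in _ --> X]add0r; apply: cvgD => //; exact: cvg_cst.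
have shift (c : R) : (fun N => u_ N (x + (c * ((l N)%:R * t N)) *: v)) @ F --> u (x + (c * r) *: v).
  have -> : (fun N => u_ N (x + (c * ((l N)%:R * t N)) *: v)) =
      (fun N => (u_ N (x + (c * ((l N)%:R * t N)) *: v) - u_ N (x + (c * r) *: v)) +
         u_ N (x + (c * r) *: v)) by apply/funext => N; rewrite subrK.
  rewrite -[X in _ --> X]add0r; apply: cvgD => //.
  apply: (@cvg_0_le _ _ _ _ (fun N => `|c| * l1norm v * t N)).
    rewrite -(mulr0 (`|c| * l1norm v)); apply: cvgM => //; exact: cvg_cst.
  near=> N; apply: (le_trans (lip1_norm _ _ (dp_lip (dp N)))).
  rewrite opprD addrACA subrr add0r -scalerBl l1normZ -mulrBr normrM.
  by rewrite mulrAC ler_wpM2l ?mulr_ge0 ?l1norm_ge0 //; exact: lt.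
apply: (@cvg_le_lim _ F _ (fun N => u_ N (x + (1 * ((l N)%:R * t N)) *: v) +
   u_ N (x + (- 1 * ((l N)%:R * t N)) *: v) - 2 * u_ N x)
   (fun N => C * ((l N)%:R * t N * ((l N)%:R * t N)))).
- apply: cvgB; last by apply: cvgM => //; exact: cvg_cst.
  have h1 := shift 1; have h2 := shift (-1); rewrite mul1r in h1.
  by rewrite mulN1r scaleNr in h2; apply: cvgD.
- by rewrite expr2; apply: cvgM; [exact: cvg_cst|exact: cvgM].
near=> N.
have hs y : u_ N (y + t N *: v) + u_ N (y - t N *: v) - 2 * u_ N y <= C * t N ^+ 2.
  by have := dp_sc (dp N) y j; rewrite bv.
have := second_diff_scale (l N) x hs; rewrite !scalerA mul1r mulN1r scaleNr.
by move=> h; apply: (le_trans h); rewrite le_eqVlt; apply/orP; left; apply/eqP; ring.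
Unshelve. all: by end_near. Qed.

Lemma lim_viscosity_sub x0 phi : C2 phi -> local_max_at (fun x => u x - phi x) x0 ->
  k <= Qop s b0 (hess phi x0) (grad phi x0) x0.
Proof.
move=> phi2 /nbhs_l1P[rho rho0 umax].
apply: (@stability_sub _ _ _ _ _ s t b b0 J0 t0 tp bb u_ u phi (grad phi) _ _ rho
  (fun N => k_ N - C * (t N * t N)) k rho0 _ (C2_jet2 x0 phi2) (lim_unif x0 rho) umax).
  rewrite -[X in _ --> X]subr0 -(mulr0 C) -[X in C * X](mul0r 0); apply: cvgB => //.
  by apply: cvgM; [exact: cvg_cst|exact: cvgM].
near=> N => x _; have h := dp_sub (dp N) x.
have -> : t N ^+ 2 * (k_ N - C * (t N * t N)) = t N ^+ 2 * k_ N - C * t N ^+ 4 by ring.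
lra.
Unshelve. all: by end_near. Qed.

(** The scheme inequality is available only at a near-minimiser [y N] of the inf-convolution at
    [x N]. The strict gradient bound forces [y N] towards [x N], after which [stability_sup_core]
    applies. *)
Lemma lim_viscosity_sup x0 psi : C2 psi -> (forall i, `|partial i psi x0| < 1) ->
  local_min_at (fun x => u x - psi x) x0 ->
  Qop s b0 (hess psi x0) (grad psi x0) x0 <= k.
Proof.
move=> psi2 psi_lt /nbhs_l1P[rho1 rho10 umin].
apply: (@le_of_all_eps _ _ _ (#|J|%:R^-1 * \sum_j dot (b0 j) (b0 j))) => e e0.
rewrite -lerBlDr -mulNr -Qop_perturb //.
have [th th0 [rho2 rho20 slope]] := C1_slope psi2.1 psi_lt.
(* With [rho * (4 * e) <= th] the paraboloid changes slopes by at most [th / 2], half of the slack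
   of psi. *)
pose rho := Num.min rho1 (Num.min rho2 (th / (4 * e))).
have rho0 : 0 < rho by rewrite !lt_min rho10 rho20 divr_gt0 // mulr_gt0.
have rho_1 : rho <= rho1 by rewrite ge_min lexx.
have rho_2 : rho <= rho2 by rewrite !ge_min lexx orbT.
have rho_3 : rho * (4 * e) <= th.
  by rewrite -ler_pdivlMr ?mulr_gt0 // !ge_min lexx !orbT.
have umin' x : l1norm (x - x0) <= rho -> u x0 - psi x0 <= u x - psi x.
  by move=> h; apply: umin; exact: le_trans rho_1.
have [x [xx hx]] := near_min_seq rho0 e0 t0 tp (lim_unif x0 rho) umin'.
pose psi' x := psi x + (- e) * dot (x - x0) (x - x0).
have slope' y z : l1norm (y - x0) <= rho -> l1norm (z - x0) <= rho ->
    psi' y - psi' z <= (1 - th / 2) * l1norm (y - z).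
  move=> hy hz; have := slope y z (le_trans hy rho_2) (le_trans hz rho_2).
  have : dot (z - x0) (z - x0) - dot (y - x0) (y - x0) <= 2 * rho * l1norm (y - z).
    have -> : dot (z - x0) (z - x0) - dot (y - x0) (y - x0) =
        dot (z - y) ((z - x0) + (y - x0)).
      by rewrite !dotE (dotC z x0) (dotC y x0) (dotC z y); ring.
    apply: (le_trans (ler_norm _)); apply: (le_trans (dot_bound _ _)).
    rewrite l1normB mulrC ler_wpM2r ?l1norm_ge0 //.
    by apply: (le_trans (l1norm_triangle _ _)); lra.
  move=> h1 h2; have := ler_wpM2l (ltW e0) h1; have := l1norm_ge0 (y - z).
  have := rho_3; rewrite /psi'; set a := l1norm (y - z) in h1 h2 * => h3 h4 h5.
  have : rho * (4 * e) * a <= th * a by rewrite ler_wpM2r.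
  lra.
have /choice[y hy] : forall N, exists y, logavg s (b N) (t N) (u_ N) y + l1norm (x N - y) <=
    u_ N (x N) + t N ^+ 2 * k_ N + C * t N ^+ 4.
  by move=> N; exact: dp_sup (dp N) (x N).
have near_y N : u_ N (y N) + l1norm (x N - y N) <= u_ N (x N) + 3 * C * t N ^+ 2.
  have := hy N; have := dp_lower (dp N) (y N).
  have := le_trans (ler_norm _) (dp_k (dp N)) => h1 h2 h3.
  have t20 : 0 <= t N ^+ 2 by rewrite sqr_ge0.
  have := ler_wpM2l t20 h1.
  have t4 : t N ^+ 4 <= t N ^+ 2 by rewrite ler_wiXn2l // ltW.
  have := ler_wpM2l (ltW C0) t4; lra.
have tC : (fun N => (3 * C + 1) * (t N * t N)) @ F --> 0.
  rewrite (_ : 0 = (3 * C + 1) * (0 * 0)); last by rewrite !mulr0.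
  by apply: cvgM; [exact: cvg_cst|exact: cvgM].
have yx r : 0 < r -> \forall N \near F, l1norm (x N - y N) <= r.
  move=> r0; pose d := Num.min r (rho / 2).
  have d0 : 0 < d by rewrite lt_min r0 divr_gt0.
  have dr : d <= r by rewrite ge_min lexx.
  have drho : d <= rho / 2 by rewrite ge_min lexx orbT.
  have rho2' : 0 < rho / 2 by rewrite divr_gt0.
  have thd : 0 < th / 4 * d by rewrite mulr_gt0 // divr_gt0.
  near=> N; apply: le_trans dr; rewrite leNgt; apply/negP => hl.
  have hx' : forall z, l1norm (z - x0) <= rho ->
      u_ N (x N) - psi' (x N) - t N ^+ 4 <= u_ N z - psi' z by near: N.
  have hxr : l1norm (x N - x0) <= rho / 2.
    by near: N; move: (rho / 2) rho2'; exact/cvg_l1P.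
  have ht : `|(3 * C + 1) * (t N * t N)| <= th / 4 * d.
    by near: N; exact: (cvgr0_norm_le _ tC).
  have {}ht := le_trans (ler_norm _) ht.
  set l := l1norm (x N - y N) in hl; have l0 : 0 < l by exact: lt_trans hl.
  (* If [y N] stayed away, convexity would give almost the full slope 1 already at the point z at
     distance d from [x N], where the test function has slope at most [1 - th / 2]. *)
  pose p := d / l; pose z := p *: y N + (1 - p) *: x N.
  have p01 : 0 <= p <= 1 by rewrite divr_ge0 ?(ltW d0) ?(ltW l0) //= ler_pdivrMr // mul1r ltW.
  have uz := dp_cvx (dp N) (y N) (x N) p01; rewrite -/z in uz.
  have xz : l1norm (x N - z) = d.
    have -> : x N - z = p *: (x N - y N).
      by apply/matrixP => i j; rewrite /z !mxE; ring.
    have /andP[p0 _] := p01.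
    by rewrite l1normZ (ger0_norm p0) -/l /p divfK // gt_eqF.
  have zr : l1norm (z - x0) <= rho.
    have := l1norm_triangle (z - x N) (x N - x0); rewrite addrA subrK [l1norm (z - x N)]l1normB xz.
    lra.
  have hxr' : l1norm (x N - x0) <= rho by apply: (le_trans hxr); lra.
  have h1 := hx' _ zr; have h2 := slope' _ _ hxr' zr; rewrite xz in h2.
  have ny := near_y N; rewrite -/l in ny.
  have /andP[p0 p1] := p01.
  have h3 : p * u_ N (y N) - p * u_ N (x N) <= p * (3 * C * t N ^+ 2 - l).
    by rewrite -mulrBr ler_wpM2l //; lra.
  have pl : p * l = d by rewrite /p divfK // gt_eqF.
  have h4 : p * (3 * C * t N ^+ 2) <= 3 * C * t N ^+ 2.
    by rewrite ler_piMl // mulr_ge0 ?sqr_ge0 // mulr_ge0 // ltW.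
  have t4 : t N ^+ 4 <= t N ^+ 2 by rewrite ler_wiXn2l // ltW.
  have : th / 2 * d <= 3 * C * t N ^+ 2 + t N ^+ 2.
    have e1 : p * (3 * C * t N ^+ 2 - l) = p * (3 * C * t N ^+ 2) - d by rewrite mulrBr pl.
    by rewrite e1 in h3; lra.
  have -> : 3 * C * t N ^+ 2 + t N ^+ 2 = (3 * C + 1) * (t N * t N) by ring.
  lra.
have yy : y @ F --> x0.
  apply/cvg_l1P => r r0; have r2 : 0 < r / 2 by rewrite divr_gt0.
  near=> N.
  have h1 : l1norm (x N - y N) <= r / 2 by near: N; exact: yx.
  have h2 : l1norm (x N - x0) <= r / 2.
    by near: N; move: (r / 2) r2; exact/cvg_l1P.
  have := l1norm_triangle (y N - x N) (x N - x0); rewrite addrA subrK [l1norm (y N - x N)]l1normB.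
  lra.
have := @stability_sup_core _ _ _ _ _ s t b b0 J0 t0 tp bb u_ psi' _ _ x0 rho
  (fun N => k_ N + C * (t N * t N)) k x y rho0 _ (jet2_perturb (- e) (C2_jet2 x0 psi2)) yy hx.
rewrite jet2_grad_perturb mulrN; apply.
- rewrite -[X in _ --> X]addr0 -(mulr0 C) -[X in C * X](mul0r 0); apply: cvgD => //.
  by apply: cvgM; [exact: cvg_cst|exact: cvgM].
- near=> N; have h1 : l1norm (x N - x0) <= rho.
    by near: N; move: rho rho0 {rho_1 rho_2 rho_3 umin' hx slope' yx}; exact/cvg_l1P.
  have h2 : l1norm (y N - x0) <= rho.
    by near: N; move: rho rho0 {rho_1 rho_2 rho_3 umin' hx slope' yx}; exact/cvg_l1P.
  have := slope' _ _ h1 h2; have := l1norm_ge0 (x N - y N).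
  set a := l1norm _; have := mulr_ge0 (ltW th0) (l1norm_ge0 (x N - y N)); rewrite -/a; lra.
- near=> N; have h := hy N.
  have -> : t N ^+ 2 * (k_ N + C * (t N * t N)) = t N ^+ 2 * k_ N + C * t N ^+ 4 by ring.
  lra.
Unshelve. all: by end_near. Qed.

End Limit.

(** * Smoothing of exp u *)

Section LineAverage.
Context {R : realType}.
Implicit Types (g : R -> R).

(** The integral starts at -1 so that the fundamental theorem of calculus covers 0 and a
    neighbourhood of it, as small shifts of the window [0, r] require. *)
Definition primitive g (y : R) : R :=
  (\int[lebesgue_measure]_(s in [set` `[-1, y]]) g s)%R.

Lemma primitive_derive g : continuous g -> forall y : R, -1 < y ->
  is_derive y 1 (primitive g) (g y).
Proof.
move=> gc y y1.
have gi : lebesgue_measure.-integrable `[-1, y + 1] (EFin \o g).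
  apply: continuous_compact_integrable; first exact: segment_compact.
  exact: continuous_subspaceT.
have yy : y < y + 1 by rewrite ltrDl.
have [d e] := continuous_FTC1_closed yy gi y1 (gc y).
split; first exact: d.
by rewrite -derive1E; exact: e.
Qed.

Definition avg r g : R := (primitive g r - primitive g 0) / r.

Section Fixed.
Variable r : R.
Hypothesis r0 : 0 < r.

Let is_prim (G g : R -> R) := forall y : R, 0 <= y <= r -> is_derive y 1 G (g y).


Lemma prim_MVT G g : is_prim G g -> exists2 c, 0 <= c <= r & G r - G 0 = g c * r.
Proof.
move=> Gg.
have Gg' (y : R) : y \in `]0, r[ -> is_derive y 1 G (g y).
  by rewrite in_itv /= => /andP[y0 yr]; apply: Gg; rewrite !ltW.
have Gc : {within `[0, r], continuous G}.
  apply: derivable_within_continuous => y; rewrite in_itv /= => yr.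
  by have [] := Gg y yr.
have [c cr h] := MVT_segment (ltW r0) Gg' Gc.
by exists c; [move: cr; rewrite in_itv|rewrite h subr0].
Qed.

Lemma avg_primitive g : continuous g -> is_prim (primitive g) g.
Proof.
by move=> gc y /andP[y0 _]; apply: primitive_derive => //; lra.
Qed.

(** Two primitives differ by a function with zero derivative. The integral thus serves only to
    provide a primitive; the properties of [avg] follow from the mean value theorem and rules of
    differentiation. *)
Lemma avg_unique g G : continuous g -> is_prim G g -> avg r g = (G r - G 0) / r.
Proof.
move=> gc Gg; have h : is_prim (fun y => primitive g y - G y) (fun y => g y - g y).
  by move=> y yr; apply: is_derive_subf; [exact: avg_primitive|exact: Gg].
have [c _] := prim_MVT h; rewrite subrr mul0r => e.
by rewrite /avg; congr (_ / _); lra.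
Qed.

Lemma avg_ge0 g : continuous g -> (forall y, 0 <= y <= r -> 0 <= g y) -> 0 <= avg r g.
Proof.
move=> gc g0; have [c cr] := prim_MVT (avg_primitive gc); rewrite /avg => ->.
by rewrite mulfK ?gt_eqF // g0.
Qed.

Lemma avg_lin g1 g2 (a c : R) : continuous g1 -> continuous g2 ->
  avg r (fun y => a * g1 y + c * g2 y) = a * avg r g1 + c * avg r g2.
Proof.
move=> c1 c2.
have cc : continuous (fun y => a * g1 y + c * g2 y).
  move=> y; apply: (@continuousD _ _ _ (fun y => a * g1 y) (fun y => c * g2 y)).
    apply: (@continuousM _ _ (fun=> a) g1); [exact: cst_continuous|exact: c1].
  apply: (@continuousM _ _ (fun=> c) g2); [exact: cst_continuous|exact: c2].
rewrite (@avg_unique _ (fun y => a * primitive g1 y + c * primitive g2 y)) //.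
  by rewrite /avg; field; rewrite gt_eqF.
move=> y yr; have d1 := avg_primitive c1 yr; have d2 := avg_primitive c2 yr.
exact: (is_deriveD (is_deriveZ a d1) (is_deriveZ c d2)).
Qed.

Lemma avg_cst c : avg r (fun=> c) = c.
Proof.
rewrite (@avg_unique _ (fun y => 0 + y * c + y ^+ 2 * 0)).
- by field; rewrite gt_eqF.
- exact: cst_continuous.
move=> y _; have := is_derive_quad 0 c 0 y.
by rewrite mulr0 addr0.
Qed.

Lemma avg_le g1 g2 : continuous g1 -> continuous g2 ->
  (forall y, 0 <= y <= r -> g1 y <= g2 y) -> avg r g1 <= avg r g2.
Proof.
move=> c1 c2 g12.
have := @avg_ge0 (fun y => 1 * g2 y + (-1) * g1 y) _ _; rewrite avg_lin //.
have h : 0 <= 1 * avg r g2 + -1 * avg r g1 -> avg r g1 <= avg r g2 by lra.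
move=> H; apply/h/H => [y|y yr]; last by have := g12 y yr; lra.
apply: (@continuousD _ _ _ (fun y => 1 * g2 y) (fun y => -1 * g1 y)).
  apply: (@continuousM _ _ (fun=> 1) g2); [exact: cst_continuous|exact: c2].
apply: (@continuousM _ _ (fun=> -1) g1); [exact: cst_continuous|exact: c1].
Qed.

Lemma avg_dist g1 g2 c : continuous g1 -> continuous g2 ->
  (forall y, 0 <= y <= r -> `|g1 y - g2 y| <= c) -> `|avg r g1 - avg r g2| <= c.
Proof.
move=> c1 c2 g12.
have cc (a : R) g : continuous g -> continuous (fun y => 1 * g y + a * 1).
  move=> gc y; apply: (@continuousD _ _ _ (fun y => 1 * g y) (fun=> a * 1)).
    apply: (@continuousM _ _ (fun=> 1) g); [exact: cst_continuous|exact: gc].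
  exact: cst_continuous.
have cE (a : R) g : continuous g -> avg r (fun y => 1 * g y + a * 1) = avg r g + a.
  move=> gc; rewrite (@avg_lin g (fun=> 1)) ?avg_cst ?mul1r ?mulr1 //.
  exact: cst_continuous.
have h1 := @avg_le g1 (fun y => 1 * g2 y + c * 1) c1 (cc _ _ c2) _.
have h2 := @avg_le g2 (fun y => 1 * g1 y + c * 1) c2 (cc _ _ c1) _.
rewrite !cE // in h1 h2.
rewrite ler_norml; apply/andP; split.
  have : avg r g2 <= avg r g1 + c; last by lra.
  by apply: h2 => y /g12; rewrite ler_norml => /andP[]; lra.
have : avg r g1 <= avg r g2 + c; last by lra.
by apply: h1 => y /g12; rewrite ler_norml => /andP[]; lra.
Qed.

(** Shifting the window only moves its endpoints, so the derivative is a difference quotient of g: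
    each averaging gains one derivative. *)
Lemma avg_shift_derive g : continuous g ->
  is_derive (0 : R) 1 (fun h => avg r (fun y => g (h + y))) ((g r - g 0) / r).
Proof.
move=> gc.
have P0 : is_derive (0 : R) 1 (primitive g) (g 0).
  by apply: avg_primitive => //; rewrite lexx ltW.
have Pr : is_derive r 1 (primitive g) (g r).
  by apply: avg_primitive => //; rewrite lexx andbT ltW.
apply/is_derive_epsP => e e0.
have er : 0 < e * r / 2 by rewrite divr_gt0 // mulr_gt0.
have /is_derive_epsP/(_ _ er)[d1 d10 h1] := P0.
have /is_derive_epsP/(_ _ er)[d2 d20 h2] := Pr.
pose d := Num.min (2^-1 : R) (Num.min d1 d2).
have dd : 0 < d by rewrite !lt_min d10 d20 invr_gt0 ltr0n.
have [hd1 hd2 hd3] : [/\ d <= 2^-1, d <= d1 & d <= d2].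
  by rewrite !ge_min !lexx ?orbT.
have eq_h h : `|h| <= 2^-1 ->
    avg r (fun y => g (h + y)) = (primitive g (r + h) - primitive g (0 + h)) / r.
  rewrite ler_norml => /andP[hh _].
  apply: (@avg_unique (fun y => g (h + y)) (fun y => primitive g (y + h))).
    move=> y; apply: (@continuous_comp _ _ _ (fun y => h + y) g); last exact: gc.
    apply: (@continuousD _ _ _ (fun=> h) id); [exact: cst_continuous|exact: id].
  move=> y /andP[y0 yr]; have y1 : -1 < y + h by lra.
  have /is_derive_epsP dP := primitive_derive gc y1.
  apply/is_derive_epsP => e' e'0; have [q q0 hq] := dP _ e'0; exists q => // k kq.
  have -> : y + k *: 1 + h = y + h + k *: 1 by rewrite addrAC.
  by rewrite [h + y]addrC; exact: hq.
exists d => // h hh.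
have hh1 : `|h| <= 2^-1 by exact: le_trans hd1.
have := h1 h (le_trans hh hd2); have := h2 h (le_trans hh hd3).
rewrite /GRing.scale /= !mulr1 !add0r (eq_h h hh1) (eq_h 0) ?normr0 ?invr_ge0 //.
rewrite !addr0 add0r => a1 a2.
have -> : (primitive g (r + h) - primitive g h) / r - (primitive g r - primitive g 0) / r -
   h * ((g r - g 0) / r) = ((primitive g (r + h) - primitive g r - h * g r) -
     (primitive g h - primitive g 0 - h * g 0)) / r by field; rewrite gt_eqF.
rewrite normrM normfV (gtr0_norm r0) ler_pdivrMr //.
apply: (le_trans (ler_normB _ _)); lra.
Qed.

End Fixed.
End LineAverage.

(** * Locally Lipschitz functions and iterated coordinate averages *)

Section Mollifier.
Context {R : realType} {n : nat}.
Implicit Types (f g u : 'cV[R]_n -> R) (x y z v w : 'cV[R]_n).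
Local Notation ee i := (delta_mx i 0 : 'cV[R]_n).

(** The class in which exp u lies when u is Lipschitz. It is stable under sums, shifts and averages,
    and it gives both the continuity needed by [avg] and differentiation under the average. *)
Definition loclip f := forall M, exists2 L, 0 <= L & forall x y,
  l1norm x <= M -> l1norm y <= M -> `|f x - f y| <= L * l1norm (x - y).

Lemma loclip_continuous f : loclip f -> continuous f.
Proof.
move=> fL x; apply/(@cvgrPdist_le _ _ _ (nbhs x)) => e e0.
have [L L0 h] := fL (l1norm x + 1).
have L1 : 0 < L + 1 by rewrite ltr_wpDl.
apply/nbhs_l1P; exists (Num.min 1 (e / (L + 1))).
  by rewrite lt_min ltr01 divr_gt0.
move=> y; rewrite le_min ler_pdivlMr // => /andP[y1 y2].
have ly : l1norm y <= l1norm x + 1.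
  by have := l1norm_triangle (y - x) x; rewrite subrK; lra.
apply: (le_trans (h x y _ ly)); first by rewrite lerDl.
by rewrite l1normB; have := l1norm_ge0 (y - x); nra.
Qed.

Lemma loclip_line f i x : loclip f -> continuous (fun y : R => f (x + y *: ee i)).
Proof.
move=> fL; have fc := loclip_continuous fL.
move=> y; apply: (@continuous_comp _ _ _ (fun y : R => x + y *: ee i) f); last exact: fc.
move=> P /nbhs_l1P[e e0 eP]; apply/nbhs_ballP; exists e => //= z.
rewrite -ball_normE /= => zy; apply: eP; rewrite opprD addrACA subrr add0r -scalerBl.
by rewrite l1normZ l1norm_delta mulr1 distrC ltW.
Qed.

Lemma loclipD f g : loclip f -> loclip g -> loclip (fun x => f x + g x).
Proof.
move=> fL gL M; have [L L0 h] := fL M; have [K K0 k] := gL M.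
exists (L + K) => [|x y xM yM]; first by rewrite addr_ge0.
rewrite opprD addrACA mulrDl; apply: (le_trans (ler_normD _ _)).
by rewrite lerD // ?h ?k.
Qed.

Lemma loclipZ f c : loclip f -> loclip (fun x => c * f x).
Proof.
move=> fL M; have [L L0 h] := fL M; exists (`|c| * L) => [|x y xM yM].
  by rewrite mulr_ge0.
by rewrite -mulrBr normrM -mulrA ler_wpM2l // h.
Qed.

Lemma loclip_shift f d : loclip f -> loclip (fun x => f (x + d)).
Proof.
move=> fL M; have [L L0 h] := fL (M + l1norm d); exists L => // x y xM yM.
have -> : x - y = x + d - (y + d) by rewrite opprD addrACA subrr addr0.
apply: h; apply: (le_trans (l1norm_triangle _ _)); exact: lerD.
Qed.

Variable r : R.
Hypothesis r0 : 0 < r.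

Definition smooth1 (i : 'I_n) f x : R := avg r (fun s => f (x + s *: ee i)).

Lemma smooth1_dist i f x y c : loclip f ->
  (forall s, 0 <= s <= r -> `|f (x + s *: ee i) - f (y + s *: ee i)| <= c) ->
  `|smooth1 i f x - smooth1 i f y| <= c.
Proof. by move=> fL h; apply: avg_dist => //; exact: loclip_line. Qed.

Lemma smooth1_loclip i f : loclip f -> loclip (smooth1 i f).
Proof.
move=> fL M; have [L L0 h] := fL (M + r); exists L => // x y xM yM.
apply: smooth1_dist => // s /andP[s0 sr].
have -> : x - y = (x + s *: ee i) - (y + s *: ee i).
  by rewrite opprD addrACA subrr addr0.
apply: h; apply: (le_trans (l1norm_triangle _ _));
  by rewrite l1normZ l1norm_delta mulr1 ger0_norm // lerD.
Qed.

Lemma smooth1_le i f g x : loclip f -> loclip g ->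
  (forall s, 0 <= s <= r -> f (x + s *: ee i) <= g (x + s *: ee i)) ->
  smooth1 i f x <= smooth1 i g x.
Proof. by move=> fL gL h; apply: avg_le => //; exact: loclip_line. Qed.

Lemma smooth1_lin i f g (a c : R) x : loclip f -> loclip g ->
  smooth1 i (fun x => a * f x + c * g x) x = a * smooth1 i f x + c * smooth1 i g x.
Proof. by move=> fL gL; apply: avg_lin => //; exact: loclip_line. Qed.

Lemma smooth1_shift i f d x : smooth1 i (fun x => f (x + d)) x = smooth1 i f (x + d).
Proof. by congr (avg r _); apply/funext => s; rewrite addrAC. Qed.

Lemma smooth1_derive i f x : loclip f ->
  is_derive x (ee i) (smooth1 i f) ((f (x + r *: ee i) - f x) / r).
Proof.
move=> fL; have := avg_shift_derive r0 (loclip_line (i:=i) (x:=x) fL).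
rewrite scale0r addr0 => /is_derive_epsP h.
apply/is_derive_epsP => e /h[d d0 hd]; exists d => // k kd.
have := hd k kd; rewrite [k *: 1](mulr1 k) add0r.
have -> : smooth1 i f (x + k *: ee i) = avg r (fun y : R => f (x + (k + y) *: ee i)).
  by congr (avg r _); apply/funext => s; rewrite scalerDl addrA.
by have -> : smooth1 i f x = avg r (fun y : R => f (x + (0 + y) *: ee i));
  [congr (avg r _); apply/funext => s; rewrite add0r|].
Qed.

Lemma smooth1_derive_under i j f g x : loclip f -> loclip g ->
  (forall y, is_derive y (ee j) f (g y)) ->
  is_derive x (ee j) (smooth1 i f) (smooth1 i g x).
Proof.
move=> fL gL fg; apply/is_derive_epsP => e e0.
have [L L0 hL] := gL (l1norm x + r + 1).
have L1 : 0 < L + 1 by rewrite ltr_wpDl.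
exists (Num.min 1 (e / (L + 1))); first by rewrite lt_min ltr01 divr_gt0.
move=> h; rewrite le_min ler_pdivlMr // => /andP[h1 h2].
have sE : smooth1 i (fun y => 1 * f y + h * g y) x = smooth1 i f x + h * smooth1 i g x.
  by rewrite smooth1_lin // mul1r.
rewrite -addrA -opprD -sE -smooth1_shift.
apply: avg_dist => //.
- exact: (loclip_line (i:=i) (x:=x) (loclip_shift (h *: ee j) fL)).
- exact: (loclip_line (i:=i) (x:=x) (loclipD (loclipZ 1 fL) (loclipZ h gL))).
move=> s /andP[s0 sr]; set z := x + s *: ee i.
have fl (q : R) : is_derive q 1 (fun q => f (z + q *: ee j)) (g (z + q *: ee j)).
  by apply: is_derive_line.
have [th ht] := MVT_line h fl; rewrite scale0r addr0 mul1r => eq.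
have -> : f (z + h *: ee j) - (f z + h * g z) = (g (z + th *: ee j) - g z) * h by lra.
rewrite normrM ler_wpM2r //.
have zM : l1norm z <= l1norm x + r.
  apply: (le_trans (l1norm_triangle _ _)).
  by rewrite l1normZ l1norm_delta mulr1 ger0_norm // lerD2l.
have h3 : l1norm (z + th *: ee j) <= l1norm x + r + 1.
  apply: (le_trans (l1norm_triangle _ _)).
  by rewrite l1normZ l1norm_delta mulr1 lerD // (le_trans ht).
apply: (le_trans (hL _ _ h3 _)); first by lra.
have -> : z + th *: ee j - z = th *: ee j by rewrite addrAC subrr add0r.
rewrite l1normZ l1norm_delta mulr1; have := normr_ge0 h; nra.
Qed.

Definition mollify (l : seq 'I_n) f : 'cV[R]_n -> R := foldr smooth1 f l.

Lemma mollify_loclip l f : loclip f -> loclip (mollify l f).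
Proof. by move=> fL; elim: l => //= i l IH; exact: smooth1_loclip. Qed.

Lemma mollify_shift l f d x : mollify l (fun x => f (x + d)) x = mollify l f (x + d).
Proof.
elim: l x => //= i l IH x; rewrite -smooth1_shift; congr (smooth1 i _ x).
by apply/funext => y; exact: IH.
Qed.

Lemma mollify_lin l f g (a c : R) x : loclip f -> loclip g ->
  mollify l (fun x => a * f x + c * g x) x = a * mollify l f x + c * mollify l g x.
Proof.
move=> fL gL; elim: l x => //= i l IH x.
rewrite -smooth1_lin; try exact: mollify_loclip.
congr (smooth1 i _ x).
by apply/funext => y; exact: IH.
Qed.

Lemma mollify_cst l c x : mollify l (fun=> c) x = c.
Proof.
elim: l x => //= i l IH x; rewrite -[RHS](avg_cst r0 c); congr (avg r _).
by apply/funext => s; exact: IH.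
Qed.

Lemma mollify_le l f g x : loclip f -> loclip g ->
  (forall y, l1norm (y - x) <= (size l)%:R * r -> f y <= g y) ->
  mollify l f x <= mollify l g x.
Proof.
move=> fL gL; elim: l x => [|i l IH] x h /=.
  by apply: h; rewrite subrr l1norm0 mul0r.
apply: smooth1_le; try exact: mollify_loclip.
move=> s /andP[s0 sr]; apply: IH => y hy; apply: h.
have -> : y - x = (y - (x + s *: ee i)) + s *: ee i.
  by apply/matrixP => k j; rewrite !mxE; ring.
apply: (le_trans (l1norm_triangle _ _)); rewrite l1normZ l1norm_delta mulr1.
by rewrite ger0_norm // /= -natr1 mulrDl mul1r lerD.
Qed.

(** A derivative in direction i uses up one average in that direction and leaves a difference
    quotient; averages in other directions that stand before it are crossed by
    [smooth1_derive_under]. *)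
Lemma mollify_derive l f i x : loclip f -> i \in l ->
  is_derive x (ee i) (mollify l f)
    ((mollify (rem i l) f (x + r *: ee i) - mollify (rem i l) f x) / r).
Proof.
move=> fL; elim: l x => //= j l IH x.
have [->|ji] := eqVneq j i.
  by move=> _; apply: smooth1_derive; exact: mollify_loclip.
rewrite inE eq_sym (negbTE ji) /= => il.
pose G := mollify (rem i l) f; have GL : loclip G by exact: mollify_loclip.
pose g y := r^-1 * G (y + r *: ee i) + (- r^-1) * G y.
have gL : loclip g by apply: loclipD; apply: loclipZ => //; exact: loclip_shift.
have -> : (smooth1 j (mollify (rem i l) f) (x + r *: ee i) -
    smooth1 j (mollify (rem i l) f) x) / r = smooth1 j g x.
  rewrite /g smooth1_lin //; last exact: loclip_shift.
  by rewrite smooth1_shift -/G; ring.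
apply: smooth1_derive_under => //; first exact: mollify_loclip.
by move=> y; have := IH y il; rewrite /g -/G; congr is_derive; ring.
Qed.

(** Each direction occurs twice, so every direction is still present after one average has been used
    up by a derivative; this is what gives C^2. *)
Definition mollifier f := mollify (enum 'I_n ++ enum 'I_n) f.

Lemma mollify_C1 l f : loclip f -> (forall i, i \in l) -> C1 (mollify l f).
Proof.
move=> fL hl i; split=> [x|]; first by have [] := mollify_derive x fL (hl i).
pose G := mollify (rem i l) f; have GL : loclip G by exact: mollify_loclip.
have -> : partial i (mollify l f) = fun x => r^-1 * G (x + r *: ee i) + (- r^-1) * G x.
  apply/funext => x; have [_ h] := mollify_derive x fL (hl i).
  rewrite /partial h.
  by rewrite -/G; ring.
by apply/loclip_continuous/loclipD; apply: loclipZ => //; exact: loclip_shift.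
Qed.

Lemma C1_lin (a c : R) f g : C1 f -> C1 g -> C1 (fun x => a * f x + c * g x).
Proof.
move=> fC gC i.
have d x : is_derive x (ee i) (fun x => a * f x + c * g x) (a * partial i f x + c * partial i g x).
  exact: (is_deriveD (is_deriveZ a (C1_partial i x fC)) (is_deriveZ c (C1_partial i x gC))).
split=> [x|]; first by case: (d x).
have -> : partial i (fun x => a * f x + c * g x) = fun x => a * partial i f x + c * partial i g x.
  by apply/funext => x; case: (d x).
move=> x; apply: (@continuousD _ _ _ (fun x => a * partial i f x) (fun x => c * partial i g x)).
  by apply: (@continuousM _ _ (fun=> a)); [exact: cst_continuous|case: (fC i) => _; exact].
by apply: (@continuousM _ _ (fun=> c)); [exact: cst_continuous|case: (gC i) => _; exact].
Qed.

Lemma C1_shift f d : C1 f -> C1 (fun x => f (x + d)).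
Proof.
move=> fC i.
have dd x : is_derive x (ee i) (fun x => f (x + d)) (partial i f (x + d)).
  apply/is_derive_epsP => e e0.
  have /is_derive_epsP/(_ _ e0)[q q0 h] := C1_partial i (x + d) fC.
  by exists q => // k /h; rewrite [x + d + _]addrAC.
split=> [x|]; first by case: (dd x).
have -> : partial i (fun x => f (x + d)) = fun x => partial i f (x + d).
  by apply/funext => x; have [_ h] := dd x; exact: h.
move=> x; apply: (@continuous_comp _ _ _ (fun x => x + d) (partial i f)); last first.
  exact: (fC i).2.
apply: (@continuousD _ _ _ id (fun=> d)); [exact: cvg_id|exact: cst_continuous].
Qed.

Lemma mollifier_C2 f : loclip f -> C2 (mollifier f).
Proof.
move=> fL; have hl i : i \in enum 'I_n ++ enum 'I_n by rewrite mem_cat mem_enum.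
split; first exact: mollify_C1.
move=> i; pose l := rem i (enum 'I_n ++ enum 'I_n); pose G := mollify l f.
have hl' j : j \in l.
  by rewrite -has_pred1 has_count count_rem hl /= count_cat
     !count_uniq_mem ?enum_uniq // !mem_enum eq_sym; case: eqP.
have -> : partial i (mollifier f) = fun x => r^-1 * G (x + r *: ee i) + (- r^-1) * G x.
  apply/funext => x; have [_ h] := mollify_derive x fL (hl i).
  rewrite /partial h.
  by rewrite -/G; ring.
have GC : C1 G by exact: mollify_C1.
by apply: C1_lin => //; exact: C1_shift.
Qed.

End Mollifier.

Section C2Closure.
Context {R : realType} {n : nat}.
Implicit Types (f g u : 'cV[R]_n -> R) (x y z v w : 'cV[R]_n).
Local Notation ee i := (delta_mx i 0 : 'cV[R]_n).

Lemma is_derive_comp1 (phi : R -> R) f x v (d d' : R) :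
  is_derive (f x) 1 phi d' -> is_derive x v f d ->
  is_derive x v (fun y => phi (f y)) (d' * d).
Proof.
move=> hphi hf.
have h0 : is_derive (0 : R) 1 (fun h : R => f (x + h *: v)) d.
  by apply: is_derive_line; rewrite scale0r addr0.
have h1 : is_derive (f (x + (0 : R) *: v)) 1 phi d' by rewrite scale0r addr0.
have h2 := @is_derive1_comp _ phi (fun h : R => f (x + h *: v)) 0 d' d h1 h0.
apply/is_derive_epsP => e e0.
have /is_derive_epsP/(_ _ e0)[q q0 h] := h2; exists q => // k kq.
by have := h k kq; rewrite /= [k *: 1](mulr1 k) add0r scale0r addr0.
Qed.

Lemma C1_continuous f : C1 f -> continuous f.
Proof.
move=> fC x; apply/(@cvgrPdist_le _ _ _ (nbhs x)) => e e0.
have [q q0 h] := C1_expand x fC ltr01.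
pose L := 1 + l1norm (grad f x).
have L0 : 0 < L by rewrite ltr_pwDl // l1norm_ge0.
apply/nbhs_l1P; exists (Num.min q (e / L)); first by rewrite lt_min q0 divr_gt0.
move=> y; rewrite le_min ler_pdivlMr // => /andP[y1 y2].
have exy : x + (y - x) = y by rewrite addrC subrK.
have := h (y - x) y1; rewrite exy => h1.
have h2 := dot_bound (grad f x) (y - x).
rewrite distrC; have -> : f y - f x = (f y - f x - dot (grad f x) (y - x)) +
  dot (grad f x) (y - x) by rewrite subrK.
by apply: (le_trans (ler_normD _ _)); rewrite /L in y2; lra.
Qed.

Lemma C1_of_partials f (g : 'I_n -> 'cV[R]_n -> R) :
  (forall i x, is_derive x (ee i) f (g i x)) -> (forall i, continuous (g i)) -> C1 f.
Proof.
move=> fg gc i; split=> [x|]; first by have [] := fg i x.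
have -> // : partial i f = g i by apply/funext => x; have [_ h] := fg i x; exact: h.
Qed.

Lemma partial_of_derive f i x d : is_derive x (ee i) f d -> partial i f x = d.
Proof. by move=> [_ h]; exact: h. Qed.

Lemma C1M f g : C1 f -> C1 g -> C1 (fun x => f x * g x).
Proof.
move=> fC gC; apply: (@C1_of_partials _ (fun i x => f x * partial i g x + g x * partial i f x)).
  by move=> i x; exact: (is_deriveM (C1_partial i x fC) (C1_partial i x gC)).
move=> i x; apply: (@continuousD _ _ _ (fun x => f x * partial i g x) (fun x => g x * partial i f x)).
  by apply: (@continuousM _ _ f); [exact: C1_continuous|exact: (gC i).2].
by apply: (@continuousM _ _ g); [exact: C1_continuous|exact: (fC i).2].
Qed.

Lemma C1Z c f : C1 f -> C1 (fun x => c * f x).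
Proof.
move=> fC; apply: (@C1_of_partials _ (fun i x => c * partial i f x)).
  by move=> i x; exact: (is_deriveZ c (C1_partial i x fC)).
by move=> i x; apply: (@continuousM _ _ (fun=> c)); [exact: cst_continuous|exact: (fC i).2].
Qed.

Lemma C1_expR f : C1 f -> C1 (fun x => expR (f x)).
Proof.
move=> fC; apply: (@C1_of_partials _ (fun i x => expR (f x) * partial i f x)).
  by move=> i x; exact: (is_derive_comp1 (is_derive_expR (f x)) (C1_partial i x fC)).
move=> i x; apply: (@continuousM _ _ (fun x => expR (f x))); last exact: (fC i).2.
apply: (@continuous_comp _ _ _ f expR); first exact: C1_continuous.
exact: continuous_expR.
Qed.

Lemma partialZ c f i : C1 f -> partial i (fun x => c * f x) = fun x => c * partial i f x.
Proof.
move=> fC; apply/funext => x; apply: partial_of_derive.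
exact: (is_deriveZ c (C1_partial i x fC)).
Qed.

Lemma C2Z c f : C2 f -> C2 (fun x => c * f x).
Proof.
by move=> [fC fC2]; split=> [|i]; [exact: C1Z|rewrite (partialZ c i fC); exact: C1Z].
Qed.

Lemma gradZ c f x : C1 f -> grad (fun x => c * f x) x = c *: grad f x.
Proof. by move=> fC; apply/matrixP => i j; rewrite !mxE partialZ. Qed.

Lemma hessZ c f x : C2 f -> hess (fun x => c * f x) x = c *: hess f x.
Proof. by move=> [fC fC2]; apply/matrixP => i j; rewrite !mxE partialZ // partialZ. Qed.

(** The factor 1/f of the derivative is written as the exponential of minus [ln f], so that its
    regularity follows from the C^1 property of [ln f] just obtained. *)
Lemma C2_ln f : (forall x, 0 < f x) -> C2 f -> C2 (fun x => ln (f x)).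
Proof.
move=> f0 [fC fC2].
have d i x : is_derive x (ee i) (fun x => ln (f x)) (expR (- ln (f x)) * partial i f x).
  rewrite expRN lnK ?posrE //.
  exact: (is_derive_comp1 (is_derive1_ln (f0 x)) (C1_partial i x fC)).
have C1l : C1 (fun x => ln (f x)).
  apply: (C1_of_partials d) => i x.
  apply: (@continuousM _ _ (fun x => expR (- ln (f x)))); last exact: (fC i).2.
  have -> : (fun x => expR (- ln (f x))) = fun x => (f x)^-1.
    by apply/funext => z; rewrite expRN lnK ?posrE.
  by apply: continuousV; [rewrite gt_eqF|exact: C1_continuous].
split; first exact: C1l.
move=> i; have -> : partial i (fun x => ln (f x)) = fun x => expR ((-1) * ln (f x)) * partial i f x.
  by apply/funext => x; rewrite mulN1r; exact: partial_of_derive.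
by apply: C1M; [exact/C1_expR/C1Z|exact: fC2].
Qed.

End C2Closure.

Section TiltBound.
Context {R : realType}.

Lemma expR_le2 (a : R) : `|a| <= 2^-1 -> expR a <= 2.
Proof.
rewrite ler_norml => /andP[h1 h2]; apply: (le_trans (expR_le_quad h2)); nra.
Qed.

Lemma expR_sub1 (a : R) : `|a| <= 2^-1 -> `|expR a - 1| <= 2 * `|a|.
Proof.
move=> h; have := h; rewrite ler_norml => /andP[h1 h2].
have h3 := expR_le_quad h2; have h4 := expR_ge1Dx a.
have := ler_norm a; have := ler_norm (- a); rewrite normrN.
have : a ^+ 2 <= `|a| / 2.
  by rewrite -real_normK ?num_real //; have := normr_ge0 a; nra.
by rewrite ler_norml => ? ? ?; apply/andP; split; lra.
Qed.

(* First-order cancellation between the two tilted neighbours. *)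
Lemma tilt_pair (a1 a2 th t A : R) : 0 <= t -> 0 <= A -> `|a1| <= t * A -> `|a2| <= t * A ->
  t * A <= 2^-1 -> `|t * th| <= 2^-1 ->
  `|expR a1 * (expR (t * th) - 1) + expR a2 * (expR (- (t * th)) - 1)| <=
    t ^+ 2 * (4 * A * `|th| + 8 * th ^+ 2).
Proof.
move=> t0 A0 h1 h2 tA tth.
have h1' := le_trans h1 tA; have h2' := le_trans h2 tA.
have b1 := expR_le2 h1'; have b2 := expR_le2 h2'.
have p1 := expR_gt0 a1; have p2 := expR_gt0 a2.
have d1 := expR_sub1 h1'; have d2 := expR_sub1 h2'.
have /andP[q1 q2] : - 2^-1 <= t * th <= 2^-1 by rewrite -ler_norml.
have q1' : - (t * th) <= 2^-1 by lra.
have r1 := expR_le_quad q2; have r2 := expR_le_quad q1'.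
have l1 := expR_ge1Dx (t * th); have l2 := expR_ge1Dx (- (t * th)).
pose R1 := expR (t * th) - 1 - t * th; pose R2 := expR (- (t * th)) - 1 + t * th.
have -> : expR a1 * (expR (t * th) - 1) + expR a2 * (expR (- (t * th)) - 1) =
    t * th * (expR a1 - expR a2) + (expR a1 * R1 + expR a2 * R2) by rewrite /R1 /R2; ring.
have R1b : 0 <= R1 <= 2 * (t * th) ^+ 2 by apply/andP; split; rewrite /R1; lra.
have R2b : 0 <= R2 <= 2 * (t * th) ^+ 2.
  by apply/andP; split; rewrite /R2; rewrite ?sqrrN in r2; lra.
have dd : `|expR a1 - expR a2| <= 4 * (t * A).
  have -> : expR a1 - expR a2 = (expR a1 - 1) - (expR a2 - 1) by ring.
  by apply: (le_trans (ler_normB _ _)); lra.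
have e1 : `|t * th * (expR a1 - expR a2)| <= t * `|th| * (4 * (t * A)).
  by rewrite !normrM (ger0_norm t0) ler_wpM2l // mulr_ge0.
have e2 : `|expR a1 * R1 + expR a2 * R2| <= 8 * (t * th) ^+ 2.
  have /andP[u1 u2] := R1b; have /andP[u3 u4] := R2b.
  rewrite ger0_norm; first by have := sqr_ge0 (t * th); nra.
  by rewrite addr_ge0 // mulr_ge0 // ltW.
apply: (le_trans (ler_normD _ _)).
by rewrite exprMn in e2; lra.
Qed.

End TiltBound.

(** * Mollified exponentials and their commutation with the scheme *)

Section SmoothLog.
Context {R : realType} {n : nat} {J : finType}.
Implicit Types (f g u v : 'cV[R]_n -> R) (x y z w : 'cV[R]_n).

Lemma lip1_upper u x : lip1 u -> u x <= u 0 + l1norm x.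
Proof. by move=> uL; have := uL x 0; rewrite subr0. Qed.

Lemma loclip_expR u : lip1 u -> loclip (fun x => expR (u x)).
Proof.
move=> uL M; exists (expR (u 0 + M)) => [|x y]; first exact: expR_ge0.
wlog xy : x y / u y <= u x => [hw xM yM|xM yM].
  have [/hw|/ltW/hw] := leP (u y) (u x); first exact.
  by move=> /(_ yM xM); rewrite distrC l1normB.
rewrite ger0_norm ?subr_ge0 ?ler_expR //.
have h := expR_ge1Dx (u y - u x).
have -> : expR (u y) = expR (u x) * expR (u y - u x) by rewrite -expRD; congr expR; ring.
have ux : expR (u x) <= expR (u 0 + M) by rewrite ler_expR; have := lip1_upper x uL; lra.
have h2 := uL x y; have p := expR_gt0 (u x); have q := l1norm_ge0 (x - y).
have h3 : 1 - expR (u y - u x) <= l1norm (x - y) by lra.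
rewrite -[X in X - _]mulr1 -mulrBr.
apply: (le_trans (ler_wpM2l (ltW p) h3)); exact: ler_wpM2r.
Qed.

Lemma loclip_cst (c : R) : loclip (fun _ : 'cV[R]_n => c).
Proof. by move=> M; exists 0 => // x y _ _; rewrite subrr normr0 mul0r. Qed.

Lemma loclip_sum (I : Type) (r : seq I) (f : I -> 'cV[R]_n -> R) :
  (forall i, loclip (f i)) -> loclip (fun x => \sum_(i <- r) f i x).
Proof.
move=> fL; elim: r => [|i r IH].
  have -> : (fun x => \sum_(i <- [::]) f i x) = fun=> 0.
    by apply/funext => x; rewrite big_nil.
  exact: loclip_cst.
have -> : (fun x => \sum_(j <- i :: r) f j x) = fun x => f i x + \sum_(j <- r) f j x.
  by apply/funext => x; rewrite big_cons.
exact: loclipD.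
Qed.

Variable r : R.
Hypothesis r0 : 0 < r.

(** The l1 reach of the mollifier: 2n successive averages over length r. *)
Let rho := (2 * n)%:R * r.

Lemma mollifier_le f g x : loclip f -> loclip g ->
  (forall y, l1norm (y - x) <= rho -> f y <= g y) -> mollifier r f x <= mollifier r g x.
Proof.
move=> fL gL h; apply: mollify_le => // y; rewrite size_cat size_enum_ord addnn -mul2n.
exact: h.
Qed.

Lemma mollifier_scale f c x : loclip f -> mollifier r (fun x => c * f x) x = c * mollifier r f x.
Proof.
move=> fL; rewrite /mollifier; have -> : (fun x => c * f x) = fun x => c * f x + 0 * f x.
  by apply/funext => y; rewrite mul0r addr0.
by rewrite mollify_lin // mul0r addr0.
Qed.

Lemma mollifier_sum (I : Type) (q : seq I) (f : I -> 'cV[R]_n -> R) x :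
  (forall i, loclip (f i)) ->
  mollifier r (fun x => \sum_(i <- q) f i x) x = \sum_(i <- q) mollifier r (f i) x.
Proof.
move=> fL; elim: q => [|i q IH].
  have -> : (fun x => \sum_(i <- [::]) f i x) = fun=> 0.
    by apply/funext => y; rewrite big_nil.
  by rewrite big_nil /mollifier mollify_cst.
have -> : (fun x => \sum_(j <- i :: q) f j x) =
    fun x => 1 * f i x + 1 * \sum_(j <- q) f j x.
  by apply/funext => y; rewrite big_cons !mul1r.
rewrite big_cons -IH /mollifier mollify_lin ?mul1r //; exact: loclip_sum.
Qed.

Lemma mollifierD f g x : loclip f -> loclip g ->
  mollifier r (fun x => f x + g x) x = mollifier r f x + mollifier r g x.
Proof.
move=> fL gL; rewrite /mollifier -[mollify r _ f x]mul1r -[mollify r _ g x]mul1r.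
by rewrite -mollify_lin //; congr mollify; apply/funext => y; rewrite !mul1r.
Qed.

Lemma mollifier_shift f d x : mollifier r (fun x => f (x + d)) x = mollifier r f (x + d).
Proof. exact: mollify_shift. Qed.

Definition expmol u x := mollifier r (fun x => expR (u x)) x.
Definition smoothlog u x := ln (expmol u x).

Lemma expmol_mono u v x c : lip1 u -> lip1 v ->
  (forall y, l1norm (y - x) <= rho -> u y <= v y + c) -> expmol u x <= expR c * expmol v x.
Proof.
move=> uL vL h; rewrite /expmol -mollifier_scale; last exact: loclip_expR.
apply: mollifier_le; [exact: loclip_expR|by apply: loclipZ; exact: loclip_expR|].
by move=> y /h; rewrite -expRD ler_expR [c + _]addrC.
Qed.

Lemma expmol_bounds u x : lip1 u -> expR (u x - rho) <= expmol u x <= expR (u x + rho).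
Proof.
move=> uL; have cE c : mollifier r (fun=> c) x = c by rewrite /mollifier mollify_cst.
apply/andP; split; [rewrite -[leLHS]cE|rewrite -[leRHS]cE]; apply: mollifier_le;
  try exact: loclip_cst; try exact: loclip_expR; move=> y hy; rewrite ler_expR.
  by have := uL x y; rewrite l1normB; lra.
by have := uL y x; lra.
Qed.

Lemma expmol_gt0 u x : lip1 u -> 0 < expmol u x.
Proof.
by move=> uL; have /andP[h _] := expmol_bounds x uL; apply: lt_le_trans h; exact: expR_gt0.
Qed.

Lemma expR_smoothlog u x : lip1 u -> expR (smoothlog u x) = expmol u x.
Proof. by move=> uL; rewrite lnK // posrE expmol_gt0. Qed.

Lemma smoothlog_C2 u : lip1 u -> C2 (smoothlog u).
Proof.
move=> uL; apply: C2_ln => [x|]; first exact: expmol_gt0.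
exact/mollifier_C2/loclip_expR.
Qed.

Lemma smoothlog_dist u x : lip1 u -> `|smoothlog u x - u x| <= rho.
Proof.
move=> uL; have /andP[h1 h2] := expmol_bounds x uL.
rewrite -expR_smoothlog // !ler_expR in h1 h2.
by rewrite ler_norml; apply/andP; split; lra.
Qed.

Lemma smoothlog_mono u v x c : lip1 u -> lip1 v ->
  (forall y, l1norm (y - x) <= rho -> u y <= v y + c) -> smoothlog u x <= smoothlog v x + c.
Proof.
move=> uL vL h; rewrite -ler_expR expRD !expR_smoothlog // mulrC.
exact: expmol_mono.
Qed.

Lemma lip1_shift u d : lip1 u -> lip1 (fun x => u (x + d)).
Proof.
move=> uL x y; have := uL (x + d) (y + d).
by rewrite opprD addrACA subrr addr0.
Qed.

Lemma smoothlog_shift u d x : smoothlog (fun x => u (x + d)) x = smoothlog u (x + d).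
Proof. by congr ln; exact: (mollifier_shift (fun x => expR (u x))). Qed.

Lemma smoothlog_lip u : lip1 u -> lip1 (smoothlog u).
Proof.
move=> uL x y; have -> : smoothlog u x = smoothlog (fun z => u (z + (x - y))) y.
  by rewrite smoothlog_shift addrC subrK.
apply: smoothlog_mono => //; first exact: lip1_shift.
by move=> z _; have := uL (z + (x - y)) z; rewrite addrAC subrr add0r.
Qed.

Variables (s b : J -> 'cV[R]_n) (S B t : R).
Hypothesis J0 : (0 < #|J|)%N.
Hypothesis sS : forall j, l1norm (s j) <= S.
Hypothesis bB : forall j, l1norm (b j) <= B.
Hypothesis S0 : 0 <= S.
Hypothesis B0 : 0 <= B.
Hypothesis t0 : 0 < t.
Hypothesis rho1 : rho <= 1.
Variable M : R.
Hypothesis M0 : 0 <= M.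

Let A := B + S * M.
(** The constant of [tilt_pair] for a tilt of size at most [S * rho], one factor rho being taken out
    thanks to [rho <= 1]. Here [B + S * M] bounds the other exponent per unit of t. *)
Definition tilt_const := 4 * (B + S * M) * S + 8 * S ^+ 2.
Let K := tilt_const.

Hypothesis tA : t * A <= 2^-1.
Hypothesis tS : t * S <= 2^-1.
Hypothesis tSB : t ^+ 2 * (S * B) <= 2^-1.

Let rho0 : 0 <= rho. Proof. by rewrite mulr_ge0 // ltW. Qed.
Let A0 : 0 <= A. Proof. by rewrite addr_ge0 // mulr_ge0. Qed.
Let K0 : 0 <= K. Proof. by rewrite addr_ge0 // !mulr_ge0 // ?addr_ge0 // ?mulr_ge0 // sqr_ge0. Qed.
Let m0 : (0 : R) < #|J|%:R. Proof. by rewrite ltr0n. Qed.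

(* The tilts of the neighbours are frozen at x: the resulting average has
   constant coefficients, hence commutes with the mollifier. *)
Let W x j (q : R) := expR (q * dot (s j) x + q ^+ 2 / 2 * dot (s j) (b j)).
Let frozen u x y :=
  (\sum_j (W x j t * expR (u (y + t *: b j)) + W x j (- t) * expR (u (y + (- t) *: b j)))) /
  (2 * #|J|%:R).

(** Taking the tilts at x instead of y changes each term by a relative amount of order [t * rho],
    too much for division by t^2. The steps t and -t cancel it to first order and leave
    [t ^+ 2 * rho]. *)
Lemma frozen_dist u x y : lip1 u -> l1norm x <= M -> l1norm (y - x) <= rho ->
  `|avge s b t u y - frozen u x y| <= K * t ^+ 2 * rho * expR (u y).
Proof.
move=> uL xM yx; rewrite /avge /frozen -mulrBl -sumrB normrM normfV.
rewrite [`|2 * _|]gtr0_norm ?mulr_gt0 // ler_pdivrMr ?mulr_gt0 //.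
apply: (le_trans (ler_norm_sum _ _ _)).
have -> : K * t ^+ 2 * rho * expR (u y) * (2 * #|J|%:R) =
    \sum_(j : J) expR (u y) * 2 * (K * t ^+ 2 * rho).
  by rewrite sumr_const -[RHS]mulr_natr; ring.
apply: ler_sum => j _.
pose c := t ^+ 2 / 2 * dot (s j) (b j); pose th := dot (s j) (y - x).
pose a (q : R) := u (y + q *: b j) - u y + q * dot (s j) x.
have sE q : q ^+ 2 = t ^+ 2 -> stepe s b q u y j =
    expR (u y) * expR c * (expR (a q) * expR (q * th)).
  move=> q2; rewrite -!expRD; congr expR; rewrite q2 /a /th /c dotBr; ring.
have WE q : q ^+ 2 = t ^+ 2 -> W x j q * expR (u (y + q *: b j)) =
    expR (u y) * expR c * expR (a q).
  move=> q2; rewrite -!expRD; congr expR; rewrite q2 /a /c; ring.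
rewrite (sE t erefl) (sE (- t) (sqrrN t)) (WE t erefl) (WE (- t) (sqrrN t)).
have -> : expR (u y) * expR c * (expR (a t) * expR (t * th)) +
    expR (u y) * expR c * (expR (a (- t)) * expR (- t * th)) -
    (expR (u y) * expR c * expR (a t) + expR (u y) * expR c * expR (a (- t))) =
    expR (u y) * expR c * (expR (a t) * (expR (t * th) - 1) +
      expR (a (- t)) * (expR (- (t * th)) - 1)) by rewrite mulNr; ring.
have thS : `|th| <= S * rho.
  apply: (le_trans (dot_bound _ _)); rewrite ler_pM ?l1norm_ge0 //.
have aA q : `|q| = t -> `|a q| <= t * A.
  move=> qt; apply: (le_trans (ler_normD _ _)); rewrite normrM qt /A mulrDr.
  apply: lerD.
    have := lip1_norm (y + q *: b j) y uL; rewrite addrAC subrr add0r l1normZ qt => h.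
    by apply: (le_trans h); rewrite ler_wpM2l // ltW.
  rewrite ler_wpM2l ?(ltW t0) //; apply: (le_trans (dot_bound _ _)).
  by rewrite ler_pM ?l1norm_ge0.
have tth : `|t * th| <= 2^-1.
  rewrite normrM (gtr0_norm t0); apply: le_trans tS; rewrite ler_wpM2l ?(ltW t0) //.
  by apply: (le_trans thS); rewrite ler_piMr.
have hp := tilt_pair (ltW t0) A0 (aA t (gtr0_norm t0)) (aA (- t) _) tA tth.
have {}hp := hp (etrans (normrN _) (gtr0_norm t0)).
have c2 : expR c <= 2.
  apply: expR_le2; rewrite normrM ger0_norm ?divr_ge0 ?sqr_ge0 //.
  have := dot_bound (s j) (b j).
  have : l1norm (s j) * l1norm (b j) <= S * B by rewrite ler_pM ?l1norm_ge0.
  have t20 : 0 <= t ^+ 2 / 2 by rewrite divr_ge0 ?sqr_ge0.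
  move=> h1 h2; have := ler_wpM2l t20 (le_trans h2 h1).
  have : 0 <= t ^+ 2 * (S * B) by rewrite mulr_ge0 ?sqr_ge0 // mulr_ge0.
  have := tSB; lra.
rewrite normrM ger0_norm ?mulr_ge0 ?expR_ge0 //.
have thK : 4 * A * `|th| + 8 * th ^+ 2 <= K * rho.
  have : th ^+ 2 <= S ^+ 2 * rho.
    rewrite -real_normK ?num_real // (@le_trans _ _ ((S * rho) ^+ 2)) //.
      by rewrite lerXn2r ?nnegrE // mulr_ge0.
    by rewrite exprMn ler_wpM2l ?sqr_ge0 // expr2 ler_piMr.
  have A4 : 0 <= 4 * A by rewrite mulr_ge0.
  have := ler_wpM2l A4 thS; rewrite /K /tilt_const -/A; lra.
have t20 : 0 <= t ^+ 2 by rewrite sqr_ge0.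
have h1 := le_trans hp (ler_wpM2l t20 thK).
rewrite -!mulrA ler_wpM2l ?expR_ge0 //.
apply: ler_pM; rewrite ?expR_ge0 //.
by apply: (le_trans h1); rewrite le_eqVlt; apply/orP; left; apply/eqP; ring.
Qed.

Lemma frozen_loclip u x : lip1 u -> loclip (frozen u x).
Proof.
move=> uL; have -> : frozen u x = fun y => (2 * #|J|%:R)^-1 *
    \sum_j (W x j t * expR (u (y + t *: b j)) + W x j (- t) * expR (u (y + (- t) *: b j))).
  by apply/funext => y; rewrite /frozen mulrC.
apply: loclipZ; apply: loclip_sum => j.
by apply: loclipD; apply: loclipZ; exact: (loclip_shift _ (loclip_expR uL)).
Qed.

Lemma mollifier_frozen u x : lip1 u ->
  mollifier r (frozen u x) x = avge s b t (smoothlog u) x.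
Proof.
move=> uL; have eL := loclip_expR uL.
have -> : frozen u x = fun y => (2 * #|J|%:R)^-1 *
    \sum_j (W x j t * expR (u (y + t *: b j)) + W x j (- t) * expR (u (y + (- t) *: b j))).
  by apply/funext => y; rewrite /frozen mulrC.
have sh d : loclip (fun y => expR (u (y + d))) by exact: (loclip_shift d eL).
rewrite mollifier_scale; last first.
  by apply: loclip_sum => j; apply: loclipD; apply: loclipZ.
rewrite mollifier_sum; last by move=> j; apply: loclipD; apply: loclipZ.
rewrite /avge mulrC; congr (_ / _); apply: eq_bigr => j _.
have hW q : W x j q * mollifier r (fun y => expR (u (y + q *: b j))) x =
    stepe s b q (smoothlog u) x j.
  rewrite (mollifier_shift (fun x => expR (u x))) -/(expmol u _) -expR_smoothlog //.
  by rewrite -expRD; congr expR; ring.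
rewrite mollifierD ?mollifier_scale ?hW //; exact: loclipZ.
Qed.

Lemma smoothlog_sub u x mu : lip1 u -> l1norm x <= M ->
  `|t ^+ 2 * mu| <= 2^-1 -> 2 * K * t ^+ 2 * rho <= 8^-1 ->
  (forall y, l1norm (y - x) <= rho -> u y + t ^+ 2 * mu <= logavg s b t u y) ->
  smoothlog u x + t ^+ 2 * (mu - 4 * K * rho) <= logavg s b t (smoothlog u) x.
Proof.
move=> uL xM tmu tK h; have eL := loclip_expR uL.
have Kt0 : 0 <= K * t ^+ 2 * rho by rewrite mulr_ge0 // mulr_ge0 // sqr_ge0.
set E := expR (t ^+ 2 * mu).
have h1 : mollifier r (fun y => (E - K * t ^+ 2 * rho) * expR (u y)) x <=
    mollifier r (frozen u x) x.
  apply: mollifier_le; [exact: loclipZ|exact: frozen_loclip|].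
  move=> y yx; have := frozen_dist uL xM yx; rewrite ler_norml => /andP[_ h2].
  have := h y yx; rewrite ge_logavg // expRD -/E; lra.
rewrite mollifier_scale // mollifier_frozen // -/(expmol u x) in h1.
rewrite ge_logavg //; apply: le_trans h1.
rewrite expRD expR_smoothlog // mulrC ler_wpM2r ?(ltW (expmol_gt0 _ _)) //.
set z := K * t ^+ 2 * rho in Kt0 *.
have -> : t ^+ 2 * (mu - 4 * K * rho) = t ^+ 2 * mu - 4 * z by rewrite /z; ring.
have z8 : 2 * z <= 8^-1 by move: tK; rewrite /z; lra.
have q : - (4 * z) <= 2^-1 by lra.
rewrite expRD -/E; have := expR_le_quad q; set e4 := expR (- (4 * z)) => he.
have E2 : 1 <= 2 * E.
  have := @expR_le2 _ (- (t ^+ 2 * mu)); rewrite normrN => /(_ tmu).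
  rewrite expRN -/E => hE; have Ep : 0 < E by exact: expR_gt0.
  have := ler_wpM2l (ltW Ep) hE; rewrite mulfV ?gt_eqF //; lra.
have Ep : 0 < E by exact: expR_gt0.
have : e4 <= 1 - 2 * z by nra.
move=> h5; have := ler_wpM2l (ltW Ep) h5; nra.
Qed.

Lemma smoothlog_sup u x mu : lip1 u -> l1norm x <= M ->
  `|t ^+ 2 * mu| <= 2^-1 ->
  (forall y, l1norm (y - x) <= rho -> logavg s b t u y <= u y + t ^+ 2 * mu) ->
  logavg s b t (smoothlog u) x <= smoothlog u x + t ^+ 2 * (mu + 4 * K * rho).
Proof.
move=> uL xM tmu h; have eL := loclip_expR uL.
have Kt0 : 0 <= K * t ^+ 2 * rho by rewrite mulr_ge0 // mulr_ge0 // sqr_ge0.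
set E := expR (t ^+ 2 * mu).
have h1 : mollifier r (frozen u x) x <=
    mollifier r (fun y => (E + K * t ^+ 2 * rho) * expR (u y)) x.
  apply: mollifier_le; [exact: frozen_loclip|exact: loclipZ|].
  move=> y yx; have := frozen_dist uL xM yx; rewrite ler_norml => /andP[h2 _].
  have := h y yx; rewrite le_logavg // expRD -/E; lra.
rewrite mollifier_scale // mollifier_frozen // -/(expmol u x) in h1.
rewrite le_logavg //; apply: (le_trans h1).
rewrite [leRHS]expRD expR_smoothlog // [leRHS]mulrC ler_wpM2r ?(ltW (expmol_gt0 _ _)) //.
set z := K * t ^+ 2 * rho in Kt0 *.
have -> : t ^+ 2 * (mu + 4 * K * rho) = t ^+ 2 * mu + 4 * z by rewrite /z; ring.
rewrite expRD -/E; have := expR_ge1Dx (4 * z); set e4 := expR (4 * z) => he.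
have Ep : 0 < E by exact: expR_gt0.
have E2 : 1 <= 2 * E.
  have := @expR_le2 _ (- (t ^+ 2 * mu)); rewrite normrN => /(_ tmu).
  rewrite expRN -/E => hE.
  have := ler_wpM2l (ltW Ep) hE; rewrite mulfV ?gt_eqF //; lra.
have := ler_wpM2l (ltW Ep) he; nra.
Qed.

End SmoothLog.

(** * Smooth approximate solutions *)

Section StabilitySup.
Context {R : realType} {n : nat} {J : finType}.
Context {F : set_system nat} {FF : ProperFilter F}.
Implicit Types (f : 'cV[R]_n -> R) (x y z w : 'cV[R]_n) (X : 'M[R]_n).
Variables (s : J -> 'cV[R]_n) (t : nat -> R) (b : nat -> J -> 'cV[R]_n).
Variable b0 : J -> 'cV[R]_n.
Hypothesis J0 : (0 < #|J|)%N.
Hypothesis t0 : t @ F --> 0.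
Hypothesis tp : forall N, 0 < t N.
Hypothesis bb : forall j, (fun N => b N j) @ F --> b0 j.

Lemma stability_sup (u : nat -> 'cV[R]_n -> R) f phi g X x0 rho (mu : nat -> R) (m : R) :
  0 < rho -> mu @ F --> m -> jet2 phi g X x0 ->
  unif_on (F:=F) [set x | l1norm (x - x0) <= rho] u f ->
  (forall x, l1norm (x - x0) <= rho -> f x0 - phi x0 <= f x - phi x) ->
  (\forall N \near F, forall x, l1norm (x - x0) <= rho ->
     logavg s (b N) (t N) (u N) x <= u N x + t N ^+ 2 * mu N) ->
  Qop s b0 X (g x0) x0 <= m.
Proof.
move=> rho0 mum phiJ uf fmin usup.
apply: (@le_of_all_eps _ _ _ (#|J|%:R^-1 * \sum_j dot (b0 j) (b0 j))) => e e0.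
rewrite -lerBlDr -mulNr -Qop_perturb //.
have [x [xx hx]] := near_min_seq rho0 e0 t0 tp uf fmin.
have := @stability_sup_core _ _ _ _ _ s t b b0 J0 t0 tp bb u _ _ _ x0 rho
  mu m x x rho0 mum (jet2_perturb (- e) phiJ) xx hx.
rewrite jet2_grad_perturb mulrN; apply.
  by near=> N; rewrite subrr l1norm0 addr0.
near=> N; rewrite subrr l1norm0 addr0.
have hall : forall x, l1norm (x - x0) <= rho ->
     logavg s (b N) (t N) (u N) x <= u N x + t N ^+ 2 * mu N by near: N.
by apply: hall; near: N; move: rho rho0 {uf fmin usup hx}; exact/cvg_l1P.
Unshelve. all: by end_near. Qed.

End StabilitySup.

Section SmoothTests.
Context {R : realType} {n : nat} {J : finType}.
Context {F : set_system nat} {FF : ProperFilter F}.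
Implicit Types (f : 'cV[R]_n -> R) (x y z w : 'cV[R]_n).
Local Notation ee i := (delta_mx i 0 : 'cV[R]_n).

Variables (s : J -> 'cV[R]_n) (t : nat -> R) (b : nat -> J -> 'cV[R]_n).
Variables (b0 : J -> 'cV[R]_n) (C : R) (u_ : nat -> 'cV[R]_n -> R) (k_ : nat -> R).
Variables (u : 'cV[R]_n -> R) (k : R) (B : R).
Hypothesis J0 : (0 < #|J|)%N.
Hypothesis C0 : 0 < C.
Hypothesis B0 : 0 <= B.
Hypothesis t0 : t @ F --> 0.
Hypothesis tp : forall N, 0 < t N.
Hypothesis t1 : forall N, t N <= 1.
Hypothesis bB : forall N j, l1norm (b N j) <= B.
Hypothesis dp : forall N, dpair s C (t N) (b N) (u_ N) (k_ N).
Hypothesis uu : forall x, (fun N => u_ N x) @ F --> u x.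
Hypothesis kk : k_ @ F --> k.

Let S := \sum_j l1norm (s j).
Let sS j : l1norm (s j) <= S.
Proof. by rewrite /S (bigD1 j) //= lerDl sumr_ge0 // => i _; exact: l1norm_ge0. Qed.
Let S0 : 0 <= S. Proof. by apply: sumr_ge0 => i _; exact: l1norm_ge0. Qed.

Let uL : lip1 u. Proof. exact: lim_lip dp uu. Qed.
Let uC : cvx u. Proof. exact: lim_cvx dp uu. Qed.

Let small (a e : R) : 0 < e -> \forall N \near F, t N * a <= e.
Proof.
move=> e0; have ta : (fun N => t N * a) @ F --> 0.
  by rewrite -(mul0r a); apply: cvgM => //; exact: cvg_cst.
near=> N; apply: le_trans (ler_norm _) _; near: N; exact: (cvgr0_norm_le _ ta).
Unshelve. all: by end_near. Qed.

Let small2 (a e : R) : 0 < e -> 0 <= a -> \forall N \near F, t N ^+ 2 * a <= e.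
Proof.
move=> e0 a0; near=> N.
apply: (@le_trans _ _ (t N * a)); last by near: N; exact: small.
by rewrite ler_wpM2r // expr2 ler_piMr // ltW.
Unshelve. all: by end_near. Qed.

Section FixedRadius.
Variables (r M : R).
Hypothesis r0 : 0 < r.
Hypothesis M0 : 0 <= M.
Let rho := (2 * n)%:R * r.
Hypothesis rho1 : rho <= 1.

Let rho0 : 0 <= rho. Proof. by rewrite mulr_ge0 // ltW. Qed.

Lemma smoothlog_unif x0 q :
  unif_on (F:=F) [set x | l1norm (x - x0) <= q] (fun N => smoothlog r (u_ N)) (smoothlog r u).
Proof.
move=> e e0; have hu := lim_unif dp uu x0 (q + rho) e0.
apply: filterS (hu _) => N h x /= xq.
have near_h y : l1norm (y - x) <= rho -> `|u_ N y - u y| <= e.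
  move=> yx; apply: h => /=.
  by have := l1norm_triangle (y - x) (x - x0); rewrite addrA subrK; lra.
have NL := dp_lip (dp N).
have h1 := @smoothlog_mono _ _ r r0 (u_ N) u x e NL uL.
have h2 := @smoothlog_mono _ _ r r0 u (u_ N) x e uL NL.
have {}h1 : smoothlog r (u_ N) x <= smoothlog r u x + e.
  by apply: h1 => y /near_h; rewrite ler_norml => /andP[_]; rewrite lerBlDl.
have {}h2 : smoothlog r u x <= smoothlog r (u_ N) x + e.
  by apply: h2 => y /near_h; rewrite distrC ler_norml => /andP[_]; rewrite lerBlDl.
by rewrite ler_norml; apply/andP; split; lra.
Qed.

Let K := tilt_const S B M.
Let K0 : 0 <= K.
Proof. by rewrite addr_ge0 // !mulr_ge0 // ?addr_ge0 // ?mulr_ge0 // sqr_ge0. Qed.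

Let side : \forall N \near F, [/\ t N * (B + S * M) <= 2^-1, t N * S <= 2^-1,
  t N ^+ 2 * (S * B) <= 2^-1 & 2 * K * t N ^+ 2 * rho <= 8^-1].
Proof.
have h2 : (0 : R) < 2^-1 by rewrite invr_gt0.
have h8 : (0 : R) < 8^-1 by rewrite invr_gt0.
near=> N; split.
- by near: N; exact: small.
- by near: N; exact: small.
- by near: N; apply: small2 => //; exact: mulr_ge0.
have -> : 2 * K * t N ^+ 2 * rho = t N ^+ 2 * (2 * K * rho) by ring.
near: N; apply: small2 => //; rewrite mulr_ge0 // mulr_ge0 //.
Unshelve. all: by end_near. Qed.

Let mu_small (c : R) : \forall N \near F, `|t N ^+ 2 * (k_ N + c * (t N * t N))| <= 2^-1.
Proof.
have h2 : (0 : R) < 2^-1 by rewrite invr_gt0.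
near=> N.
have h : t N ^+ 2 * (C + `|c|) <= 2^-1.
  by near: N; apply: small2 => //; rewrite addr_ge0 // ltW.
apply: le_trans h; rewrite normrM ger0_norm ?sqr_ge0 // ler_wpM2l ?sqr_ge0 //.
apply: (le_trans (ler_normD _ _)); apply: lerD; first exact: dp_k (dp N).
rewrite normrM ler_piMr // normrM (gtr0_norm (tp N)).
by rewrite mulr_ile1 // ltW.
Unshelve. all: by end_near. Qed.

Let mu_cvg (c d : R) : (fun N => k_ N + c * (t N * t N) + d) @ F --> k + d.
Proof.
have h : (fun N => k_ N + c * (t N * t N)) @ F --> k.
  rewrite -[X in _ --> X]addr0; apply: cvgD => //.
  rewrite (_ : 0 = c * (0 * 0)); last by rewrite !mulr0.
  by apply: cvgM; [exact: cvg_cst|exact: cvgM].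
by apply: cvgD => //; exact: cvg_cst.
Qed.

Lemma lim_smooth_sub x0 : (forall j, (fun N => b N j) @ F --> b0 j) ->
  l1norm x0 + 1 <= M ->
  k - 4 * K * rho <= Qop s b0 (hess (smoothlog r u) x0) (grad (smoothlog r u) x0) x0.
Proof.
move=> bb x0M; have W2 := smoothlog_C2 r0 uL.
(* The smoothed limit tests itself: the difference is identically 0, every point is an extremum, and
   stability yields a classical inequality. *)
apply: (stability_sub J0 t0 tp bb ltr01 (@mu_cvg (- C) (- (4 * K * rho)))
  (C2_jet2 x0 W2) (@smoothlog_unif x0 1)); first by move=> x _; rewrite !subrr.
near=> N => x xx0.
have [h1 h2 h3 h4] : [/\ t N * (B + S * M) <= 2^-1, t N * S <= 2^-1,
  t N ^+ 2 * (S * B) <= 2^-1 & 2 * K * t N ^+ 2 * rho <= 8^-1] by near: N; exact: side.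
have hm : `|t N ^+ 2 * (k_ N + (- C) * (t N * t N))| <= 2^-1 by near: N; exact: mu_small.
have xM : l1norm x <= M by have := l1norm_triangle (x - x0) x0; rewrite subrK; lra.
apply: (@smoothlog_sub _ _ _ r r0 s (b N) S B (t N) J0 sS (bB N) S0 B0 (tp N) rho1 M M0
  h1 h2 h3 (u_ N) x _ (dp_lip (dp N)) xM hm h4) => y _.
have h := dp_sub (dp N) y.
have -> : t N ^+ 2 * (k_ N + - C * (t N * t N)) = t N ^+ 2 * k_ N - C * t N ^+ 4 by ring.
lra.
Unshelve. all: by end_near. Qed.

(** The increment w is arbitrary because the minimiser of the inf-convolution is not localised here.
    By convexity the descent from a to [a + w] is no steeper than that from a point at distance
    [eta / 4] behind a, where [u_ N] is uniformly close to u. With [e = th * eta / 16], half of th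
    survives. *)
Lemma lim_local_slope x0 q th eta : 0 < th -> 0 < eta ->
  (forall y z, l1norm (y - x0) <= q + eta -> l1norm (z - x0) <= q + eta ->
     u y - u z <= (1 - th) * l1norm (y - z)) ->
  \forall N \near F, forall a w, l1norm (a - x0) <= q + eta / 2 ->
     u_ N a - u_ N (a + w) <= (1 - th / 2) * l1norm w.
Proof.
move=> th0 eta0 slope; pose e := th * eta / 16.
have e0 : 0 < e by rewrite divr_gt0 // mulr_gt0.
have eta4 : 0 < eta / 4 by rewrite divr_gt0.
have hu := lim_unif dp uu x0 (q + eta) e0.
apply: filterS (hu _) => N h a w ha.
have [w0|wn] := eqVneq (l1norm w) 0.
  have -> : w = 0.
    apply/matrixP => i j; rewrite (ord1 j) [RHS]mxE; apply/eqP.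
    by rewrite -normr_le0 -w0 l1norm_coord.
  by rewrite addr0 subrr l1norm0 mulr0.
have wp : 0 < l1norm w by rewrite lt_neqAle eq_sym wn l1norm_ge0.
pose lam := eta / 4 / l1norm w; have lam0 : 0 < lam by rewrite divr_gt0.
have lamw : lam * l1norm w = eta / 4 by rewrite /lam divfK.
pose p := lam / (1 + lam).
have l1p : 0 < 1 + lam by rewrite addr_gt0.
have p01 : 0 <= p <= 1.
  by rewrite divr_ge0 ?(ltW lam0) ?(ltW l1p) //= ler_pdivrMr // mul1r lerDr.
have hc := dp_cvx (dp N) (a + w) (a - lam *: w) p01.
have ea : p *: (a + w) + (1 - p) *: (a - lam *: w) = a.
  by apply/matrixP => i j; rewrite !mxE /p; field; rewrite gt_eqF.
rewrite ea in hc.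
have hc2 : lam * (u_ N a - u_ N (a + w)) <= u_ N (a - lam *: w) - u_ N a.
  have := ler_wpM2l (ltW l1p) hc.
  have -> : (1 + lam) * (p * u_ N (a + w) + (1 - p) * u_ N (a - lam *: w)) =
    lam * u_ N (a + w) + u_ N (a - lam *: w) by rewrite /p; field; rewrite gt_eqF.
  lra.
have ha' : l1norm (a - x0) <= q + eta by lra.
have hz : l1norm (a - lam *: w - x0) <= q + eta.
  have -> : a - lam *: w - x0 = (a - x0) - lam *: w by rewrite addrAC.
  apply: (le_trans (l1norm_triangle _ _)).
  by rewrite l1normN l1normZ gtr0_norm // lamw; lra.
have s1 := slope _ _ hz ha'.
have e1 : l1norm (a - lam *: w - a) = eta / 4.
  by rewrite addrAC subrr add0r l1normN l1normZ gtr0_norm.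
rewrite e1 in s1.
have := h a ha'; have := h _ hz; rewrite !ler_norml => /andP[i1 i2] /andP[i3 i4].
have : lam * (u_ N a - u_ N (a + w)) <= lam * ((1 - th / 2) * l1norm w).
  rewrite [leRHS]mulrCA lamw; apply: (le_trans hc2); rewrite /e in i1 i2 i3 i4; lra.
by rewrite ler_pM2l.
Qed.

Variables (b' : nat -> J -> 'cV[R]_n) (b0' : J -> 'cV[R]_n).
Hypothesis b'B : forall N j, l1norm (b' N j) <= B.
Hypothesis bb' : forall j, (fun N => b' N j) @ F --> b0' j.
Hypothesis b'_le : forall N f x, cvx f ->
  avge s (b' N) (t N) f x <= avge s (b N) (t N) f x.

(** Where u has slope below 1 the inf-convolution is inactive: moving the average from the minimiser
    z to y raises each exponent by at most [l1norm (y - z)], of which the share [1 - th / 2] pays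
    for [u_ N] and [th / 2] for the tilt. The inequality then holds at y itself, and passing from b
    to b' only lowers the average. *)
Lemma lim_smooth_sup x0 th eta : 0 < th -> 0 < eta ->
  l1norm x0 + 1 <= M ->
  (forall y z, l1norm (y - x0) <= rho + eta -> l1norm (z - x0) <= rho + eta ->
     u y - u z <= (1 - th) * l1norm (y - z)) ->
  Qop s b0' (hess (smoothlog r u) x0) (grad (smoothlog r u) x0) x0 <= k + 4 * K * rho.
Proof.
move=> th0 eta0 x0M slope; have W2 := smoothlog_C2 r0 uL.
pose q := Num.min 1 (eta / 4).
have eta4 : 0 < eta / 4 by rewrite divr_gt0.
have q0 : 0 < q by rewrite lt_min ltr01.
have q1 : q <= 1 by rewrite ge_min lexx.
have q2 : q <= eta / 4 by rewrite ge_min lexx orbT.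
apply: (stability_sup J0 t0 tp bb' q0 (@mu_cvg C (4 * K * rho))
  (C2_jet2 x0 W2) (@smoothlog_unif x0 q)); first by move=> x _; rewrite !subrr.
near=> N => x xx0.
have [h1 h2 h3 h4] : [/\ t N * (B + S * M) <= 2^-1, t N * S <= 2^-1,
  t N ^+ 2 * (S * B) <= 2^-1 & 2 * K * t N ^+ 2 * rho <= 8^-1] by near: N; exact: side.
have hm : `|t N ^+ 2 * (k_ N + C * (t N * t N))| <= 2^-1 by near: N; exact: mu_small.
have hs : forall a w, l1norm (a - x0) <= rho + eta / 2 ->
     u_ N a - u_ N (a + w) <= (1 - th / 2) * l1norm w.
  by near: N; exact: lim_local_slope.
have hB : t N * B <= eta / 4 by near: N; exact: small.
have hS : t N * S <= th / 2 by near: N; apply: small; rewrite divr_gt0.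
have xM : l1norm x <= M by have := l1norm_triangle (x - x0) x0; rewrite subrK; lra.
apply: (@smoothlog_sup _ _ _ r r0 s (b' N) S B (t N) J0 sS (b'B N) S0 B0 (tp N) rho1 M M0
  h1 h2 h3 (u_ N) x _ (dp_lip (dp N)) xM hm) => y yx.
apply: (@le_trans _ _ (logavg s (b N) (t N) (u_ N) y)).
  by rewrite ler_ln ?posrE ?avge_gt0 // b'_le //; exact: dp_cvx (dp N).
have [z hz] := dp_sup (dp N) y.
have -> : t N ^+ 2 * (k_ N + C * (t N * t N)) = t N ^+ 2 * k_ N + C * t N ^+ 4 by ring.
rewrite addrA; apply: le_trans hz.
have yx0 : l1norm (y - x0) <= rho + eta / 4.
  have := l1norm_triangle (y - x) (x - x0); rewrite addrA subrK; rewrite -/rho in yx; lra.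
have tb (c : R) j : `|c| = t N -> l1norm (y + c *: b N j - x0) <= rho + eta / 2.
  move=> ct; rewrite addrAC; apply: (le_trans (l1norm_triangle _ _)).
  rewrite l1normZ ct; have := ler_wpM2l (ltW (tp N)) (bB N j); lra.
have sw w j : t N * `|dot (s j) w| <= th / 2 * l1norm w.
  apply: (@le_trans _ _ (t N * (S * l1norm w))).
    rewrite ler_wpM2l ?(ltW (tp N)) //; apply: (le_trans (dot_bound _ _)).
    by rewrite ler_wpM2r ?l1norm_ge0.
  by rewrite mulrA ler_wpM2r ?l1norm_ge0.
have step (c : R) j : `|c| = t N ->
    stepe s (b N) c (u_ N) y j <= stepe s (b N) c (u_ N) z j * expR (l1norm (y - z)).
  move=> ct; rewrite -expRD ler_expR.
  have a1 := hs _ (z - y) (tb c j ct).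
  have e1 : y + c *: b N j + (z - y) = z + c *: b N j.
    by apply/matrixP => i l; rewrite !mxE; ring.
  rewrite e1 l1normB in a1.
  have a2 : c * dot (s j) (y - z) <= th / 2 * l1norm (y - z).
    apply: le_trans (sw (y - z) j); apply: (le_trans (ler_norm _)).
    by rewrite normrM ct.
  rewrite dotBr in a2; lra.
rewrite le_logavg // expRD expR_logavg // /avge mulrAC ler_wpM2r ?invr_ge0 ?mulr_ge0 //.
rewrite mulr_suml; apply: ler_sum => j _; rewrite mulrDl.
by apply: lerD; apply: step; rewrite ?normrN gtr0_norm.
Unshelve. all: by end_near. Qed.

End FixedRadius.

(** A gradient bound for the smoothed function at one point becomes a slope bound for u on the
    averaging ball, where the gradient of u varies little. The budget [4 * th]: one th from the
    smoothed function to u at x0, two over the ball of radius [rho + eta], one left as slack. *)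
Lemma smoothlog_slope A r x0 tau th : 0 <= A ->
  (forall i x (h : R), u (x + h *: ee i) + u (x - h *: ee i) - 2 * u x <= A * h ^+ 2) ->
  0 < r -> 0 < th -> tau + 4 * th <= 1 ->
  let L := 2 * A * n%:R in
  L * ((2 * n)%:R * r) <= th ->
  (forall i, `|partial i (smoothlog r u) x0| <= tau) ->
  exists2 eta, 0 < eta & forall y z,
    l1norm (y - x0) <= (2 * n)%:R * r + eta -> l1norm (z - x0) <= (2 * n)%:R * r + eta ->
    u y - u z <= (1 - th) * l1norm (y - z).
Proof.
move=> A0 uA r0 th0 tau1 L Lr Wtau; set rho := _ * r in Lr *.
have L0 : 0 <= L by rewrite !mulr_ge0.
have glip i x y : `|partial i u x - partial i u y| <= L * l1norm (x - y).
  exact: semic_grad_lip.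
have rho0 : 0 <= rho by rewrite mulr_ge0 // ltW.
have W2 := smoothlog_C2 r0 uL.
have key i : `|partial i u x0| <= tau + th.
  have hW := C1_partial i x0 W2.1.
  have low (h : R) y : l1norm (y - x0) <= rho ->
      u y <= u (y + h *: ee i) - h * partial i u x0 + `|h| * th.
    move=> yx; have /andP[g1 _] := semic_partial uC A0 uA i y h.
    have g2 := glip i y x0.
    have g3 : `|h * (partial i u x0 - partial i u y)| <= `|h| * th.
      rewrite normrM ler_wpM2l // distrC; apply: (le_trans g2); apply: le_trans Lr.
      exact: ler_wpM2l.
    have := ler_norm (h * (partial i u x0 - partial i u y)); lra.
  have Wlow (h : R) : smoothlog r u x0 <= smoothlog r u (x0 + h *: ee i) +
      (- h * partial i u x0 + `|h| * th).
    rewrite -(smoothlog_shift r u); apply: smoothlog_mono => //; first exact: lip1_shift.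
    by move=> y /low h1; have := h1 h; lra.
  have bound e : 0 < e -> `|partial i u x0| <= `|partial i (smoothlog r u) x0| + th + e.
    move=> e0; have /is_derive_epsP/(_ _ e0)[d d0 hd] := hW.
    have dd : `|d| <= d by rewrite gtr0_norm.
    have dd' : `|- d| <= d by rewrite normrN.
    have := hd d dd; have := hd (- d) dd'; rewrite normrN (gtr0_norm d0).
    rewrite !ler_norml => /andP[a1 a2] /andP[a3 a4].
    have := Wlow d; have := Wlow (- d); rewrite normrN (gtr0_norm d0) => b1 b2.
    set D := partial i (smoothlog r u) x0 in a1 a2 a3 a4 *.
    set P := partial i u x0 in b1 b2 *.
    have c1 : d * P <= d * (D + th + e) by lra.
    have c2 : d * (- P) <= d * (- D + th + e) by lra.
    rewrite !ler_pM2l // in c1 c2.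
    have := ler_norm D; have := ler_norm (- D); rewrite normrN => f1 f2.
    by apply/andP; split; lra.
  apply/ler_addgt0Pr => e e0; apply: (le_trans (bound e e0)).
  by have := Wtau i; lra.
have L1 : 0 < L + 1 by rewrite ltr_wpDl.
exists (th / (L + 1)); first by rewrite divr_gt0.
set eta := th / (L + 1); have Leta : L * eta <= th.
  rewrite /eta mulrA ler_pdivrMr //; nra.
move=> y z hy hz.
have := semic_lower uC A0 uA y (z - y).
have eyz : y + (z - y) = z by rewrite addrC subrK.
rewrite eyz => g1.
have g2 : dot (grad u y) (y - z) <= (1 - th) * l1norm (y - z).
  apply: dot_le_slope => i; rewrite mxE.
  have := glip i y x0; have := key i.
  have := ler_wpM2l L0 hy.
  have := ler_normD (partial i u y - partial i u x0) (partial i u x0); rewrite subrK.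
  lra.
have : dot (grad u y) (z - y) = - dot (grad u y) (y - z) by rewrite -dotNr opprB.
lra.
Qed.

End SmoothTests.

(** * Comparison with arbitrary viscosity solutions *)

Section ComparisonTools.
Context {R : realType} {n : nat}.
Implicit Types (f u : 'cV[R]_n -> R) (x y z w p : 'cV[R]_n).
Local Notation ee i := (delta_mx i 0 : 'cV[R]_n).

Lemma lip1_touch u phi x0 i : lip1 u -> C1 phi ->
  local_max_at (fun x => u x - phi x) x0 -> `|partial i phi x0| <= 1.
Proof.
move=> uL phi1 /nbhs_l1P[rho rho0 umax].
apply/ler_addgt0Pr => e e0.
have /is_derive_epsP/(_ _ e0)[d1 d10 hd] := C1_partial i x0 phi1.
pose d := Num.min d1 rho; have d0 : 0 < d by rewrite lt_min d10.
have dd1 : d <= d1 by rewrite ge_min lexx.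
have drho : d <= rho by rewrite ge_min lexx orbT.
have step (h : R) : `|h| = d -> h * partial i phi x0 >= - (1 + e) * d.
  move=> hh; have h1 : `|h| <= d1 by rewrite hh.
  have := hd h h1; rewrite hh ler_norml => /andP[_ a2].
  have hx : l1norm (h *: ee i) = d by rewrite l1normZ l1norm_delta mulr1.
  have hx' : l1norm (x0 + h *: ee i - x0) = d by rewrite addrAC subrr add0r.
  have := umax (x0 + h *: ee i); rewrite hx' => /(_ drho) a3.
  have := uL x0 (x0 + h *: ee i); rewrite l1normB hx' => a4.
  lra.
have s1 := step d (gtr0_norm d0).
have s2 := step (- d); rewrite normrN (gtr0_norm d0) in s2.
have {}s2 := s2 erefl.
rewrite ler_norml; apply/andP; split; rewrite -(ler_pM2l d0); lra.
Qed.

Lemma coercive_max f D e : continuous f -> 0 < e -> (forall x, f x <= D - e * l1norm x) ->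
  exists2 x0, e * l1norm x0 <= D - f 0 & forall x, f x <= f x0.
Proof.
move=> fC e0 fD.
have [c cM] : exists2 c, c \in [set x | l1norm x <= (D - f 0) / e] &
    forall x, x \in [set x | l1norm x <= (D - f 0) / e] -> f x <= f c.
  apply: compact_EVT_max; last exact: continuous_subspaceT.
    exists 0; rewrite /= l1norm0 divr_ge0 ?(ltW e0) //.
    by have := fD 0; rewrite l1norm0; lra.
  exact: l1ball_compact.
move=> hc; have f0 : f 0 <= f c.
  apply: hc; rewrite inE /= l1norm0 divr_ge0 ?(ltW e0) //.
  by have := fD 0; rewrite l1norm0; lra.
exists c; first by have := fD c; lra.
move=> x; have [xM|xM] := leP (l1norm x) ((D - f 0) / e); first by apply: hc; rewrite inE.
rewrite ltr_pdivrMr // in xM; apply: le_trans f0; have := fD x; lra.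
Qed.

Lemma unit_growth_bounds v e : continuous v -> unit_growth v -> 0 < e ->
  exists c, forall x, `|v x - l1norm x| <= e * l1norm x + c.
Proof.
move=> vC vg e0.
have /cvgrPdist_le/(_ _ e0)[M _ hM] := vg.
pose r := n%:R * Num.max M 0.
have r0 : 0 <= r by rewrite mulr_ge0 // le_max lexx orbT.
have vl : continuous (v \- l1norm).
  by move=> x; apply: continuousB; [exact: vC|exact: l1norm_continuous].
have fC : continuous (fun x => `|v x - l1norm x|) by move=> x; exact: (cvg_norm (vl x)).
have [c _ hc] : exists2 c, c \in [set x | l1norm x <= r] &
    forall x, x \in [set x | l1norm x <= r] -> `|v x - l1norm x| <= `|v c - l1norm c|.
  apply: compact_EVT_max; last exact: continuous_subspaceT.
    by exists 0; rewrite /= l1norm0.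
  exact: l1ball_compact.
exists `|v c - l1norm c| => x; have [xr|xr] := leP (l1norm x) r.
  have := hc x; rewrite inE => /(_ xr) h.
  by apply: (le_trans h); rewrite lerDr mulr_ge0 ?l1norm_ge0 // ltW.
have x0 : 0 < l1norm x by exact: le_lt_trans xr.
have xM : M < enorm x.
  rewrite ltNge; apply/negP => h; move: xr; apply/negP; rewrite -leNgt.
  apply: (le_trans (l1norm_le_enorm x)); rewrite ler_wpM2l //.
  by apply: (le_trans h); rewrite le_max lexx.
have := hM x xM; rewrite /= -/(l1norm x) => h.
have -> : v x - l1norm x = - ((1 - v x / l1norm x) * l1norm x) by field; rewrite gt_eqF.
rewrite normrN normrM (gtr0_norm x0).
by apply: (le_trans (ler_wpM2r (ltW x0) h)); rewrite lerDl.
Qed.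

Lemma le_of_scaling (a c q : R) :
  (forall tau, 0 < tau < 1 -> tau * a <= c + (1 - tau) * q) -> a <= c.
Proof.
move=> h; rewrite leNgt; apply/negP => ac.
pose d := a - c; have d0 : 0 < d by rewrite subr_gt0.
have A0 : 0 < 2 * (`|a + q| + d) by rewrite mulr_gt0 // ltr_wpDl.
pose e := d / (2 * (`|a + q| + d)); have e0 : 0 < e by rewrite divr_gt0.
have e2 : e * (`|a + q| + d) = d / 2 by rewrite /e; field; rewrite gt_eqF // ltr_wpDl.
have e1 : e <= 2^-1.
  rewrite /e ler_pdivrMr //; have := normr_ge0 (a + q); lra.
have hq : e * (a + q) <= e * `|a + q| by rewrite ler_wpM2l ?ler_norm // ltW.
have := h (1 - e); have -> : 0 < 1 - e < 1 by apply/andP; split; lra.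
have ed : 0 <= e * d by rewrite mulr_ge0 // ltW.
move=> /(_ isT); rewrite /d in e2 d0 ed *; lra.
Qed.

Section Scaling.
Variables (J : finType) (s b : J -> 'cV[R]_n).

Definition scale_const : R :=
  (2 * #|J|%:R)^-1 * \sum_j (`|dot (s j) (b j)| + l1norm (b j) ^+ 2).

(** With a the drift [dot (s j) x] and be the slope [dot p (b j)], [(a + tau * be) ^+ 2 - tau * (a +
    be) ^+ 2] equals [(1 - tau) * a ^+ 2 - tau * (1 - tau) * be ^+ 2]. The term in a, unbounded in
    x, has the good sign, and be is bounded by the gradient constraint. *)
Lemma Qop_scale X p x tau : 0 <= tau <= 1 -> (forall i, `|p i 0| <= 1) ->
  tau * Qop s b X p x - (1 - tau) * scale_const <= Qop s b (tau *: X) (tau *: p) x.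
Proof.
move=> /andP[tau0 tau1] p1; rewrite /Qop /scale_const.
rewrite (mulrCA tau) (mulrCA (1 - tau)) -mulrBr ler_wpM2l ?invr_ge0 ?mulr_ge0 //.
rewrite !mulr_sumr -sumrB; apply: ler_sum => j _.
have -> : qform (tau *: X) (b j) = tau * qform X (b j).
  by rewrite /qform -scalemxAl dotZr.
rewrite dotZl; set c := dot (s j) (b j); set a := dot (s j) x.
have b2 : dot p (b j) ^+ 2 <= l1norm (b j) ^+ 2.
  rewrite -[leLHS]real_normK ?num_real // ler_pXn2r ?nnegrE ?l1norm_ge0 //.
  rewrite ler_norml; apply/andP; split; last by have := dot_le_slope (b j) p1; rewrite mul1r.
  rewrite lerNl -dotNr; have := dot_le_slope (- b j) p1; rewrite mul1r l1normN; exact.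
set be := dot p (b j) in b2 *; set L := l1norm (b j) ^+ 2 in b2 *.
have t1 : 0 <= 1 - tau by rewrite subr_ge0.
have := ler_norm (- c); rewrite normrN => c1.
have h1 := ler_wpM2l t1 c1; have h2 := ler_wpM2l t1 b2.
have h3 : 0 <= (1 - tau) * a ^+ 2 by rewrite mulr_ge0 ?sqr_ge0.
have h4 : (1 - tau) * (tau * be ^+ 2) <= (1 - tau) * be ^+ 2.
  by rewrite ler_wpM2l // ler_piMl ?sqr_ge0.
have -> : tau * (c + qform X (b j) + (a + be) ^+ 2) - (1 - tau) * (`|c| + L) =
  c + tau * qform X (b j) + (a + tau * be) ^+ 2
   - ((1 - tau) * a ^+ 2 - (1 - tau) * (tau * be ^+ 2) + (1 - tau) * c
      + (1 - tau) * (`|c| + L)) by ring.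
rewrite gerBl; lra.
Qed.

End Scaling.

End ComparisonTools.

Section Comparison.
Context {R : realType} {n : nat} {J : finType}.
Context {F : set_system nat} {FF : ProperFilter F}.
Implicit Types (f : 'cV[R]_n -> R) (x y z w : 'cV[R]_n).
Local Notation ee i := (delta_mx i 0 : 'cV[R]_n).

Variables (s : J -> 'cV[R]_n) (t : nat -> R) (b : nat -> J -> 'cV[R]_n).
Variables (C : R) (u_ : nat -> 'cV[R]_n -> R) (k_ : nat -> R).
Variables (u : 'cV[R]_n -> R) (k : R) (B : R).
Hypothesis J0 : (0 < #|J|)%N.
Hypothesis C0 : 0 < C.
Hypothesis B0 : 0 <= B.
Hypothesis t0 : t @ F --> 0.
Hypothesis tp : forall N, 0 < t N.
Hypothesis t1 : forall N, t N <= 1.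
Hypothesis bB : forall N j, l1norm (b N j) <= B.
Hypothesis dp : forall N, dpair s C (t N) (b N) (u_ N) (k_ N).
Hypothesis uu : forall x, (fun N => u_ N x) @ F --> u x.
Hypothesis kk : k_ @ F --> k.

Variables (v : 'cV[R]_n -> R) (l : R).
Hypothesis vC : continuous v.
Hypothesis vG : unit_growth v.

Let S := \sum_j l1norm (s j).
Let S0 : 0 <= S. Proof. by apply: sumr_ge0 => i _; exact: l1norm_ge0. Qed.
Let uL : lip1 u. Proof. exact: lim_lip dp uu. Qed.
Let u0 : u 0 = 0. Proof. exact: lim_0 dp uu. Qed.

Let K_ge0 M : 0 <= M -> 0 <= tilt_const S B M.
Proof. by move=> M0; rewrite addr_ge0 // !mulr_ge0 // ?addr_ge0 // ?mulr_ge0 // sqr_ge0. Qed.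

Let radius (L K th d : R) : 0 <= L -> 0 <= K -> 0 < th -> 0 < d ->
  exists2 r : R, 0 < r & [/\ (2 * n)%:R * r <= 1, L * ((2 * n)%:R * r) <= th
    & 4 * K * ((2 * n)%:R * r) <= d].
Proof.
move=> L0 K0 th0 d0.
have n1 : 0 < (2 * n)%:R + 1 :> R by rewrite ltr_wpDl.
have L1 : 0 < L + 1 by rewrite ltr_wpDl.
have K1 : 0 < 4 * K + 1 by rewrite ltr_wpDl // mulr_ge0.
pose e := Num.min 1 (Num.min (th / (L + 1)) (d / (4 * K + 1))).
have e0 : 0 < e by rewrite !lt_min ltr01 !divr_gt0.
have e1 : e <= 1 by rewrite ge_min lexx.
have e2 : e * (L + 1) <= th by rewrite -ler_pdivlMr // !ge_min lexx orbT.
have e3 : e * (4 * K + 1) <= d by rewrite -ler_pdivlMr // !ge_min lexx !orbT.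
exists (e / ((2 * n)%:R + 1)); first by rewrite divr_gt0.
have re : (2 * n)%:R * (e / ((2 * n)%:R + 1)) <= e.
  by rewrite mulrA ler_pdivrMr // mulrDr mulr1 mulrC lerDl ltW.
have h1 := ler_wpM2l L0 re; have h2 := ler_wpM2l K0 re.
by split; lra.
Qed.

Let W_bounds (r : R) x : 0 < r -> (2 * n)%:R * r <= 1 ->
  l1norm x - C - 1 <= smoothlog r u x <= l1norm x + 1.
Proof.
move=> r0 r1; have := smoothlog_dist r0 x uL.
have := lim_growth (FF:=FF) dp uu x; have := lip1_upper x uL.
by rewrite u0 add0r ler_norml => a1 a2 /andP[a3 a4]; apply/andP; split; lra.
Qed.

Let W_cont (r : R) : 0 < r -> continuous (smoothlog r u).
Proof. by move=> r0; apply: C1_continuous; exact: (smoothlog_C2 r0 uL).1. Qed.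

Let contB (a c : R) r : 0 < r -> continuous (fun x => a * v x + c * smoothlog r u x).
Proof.
move=> r0 x.
apply: (@continuousD _ _ _ (fun x => a * v x) (fun x => c * smoothlog r u x)).
  apply: (@continuousM _ _ (fun=> a) v); [exact: cst_continuous|exact: vC].
apply: (@continuousM _ _ (fun=> c) (smoothlog r u)); first exact: cst_continuous.
exact: W_cont.
Qed.

Section Sub.
Variables (b' : nat -> J -> 'cV[R]_n) (b0' : J -> 'cV[R]_n).
Hypothesis b'B : forall N j, l1norm (b' N j) <= B.
Hypothesis bb' : forall j, (fun N => b' N j) @ F --> b0' j.
Hypothesis b'_le : forall N f x, cvx f ->
  avge s (b' N) (t N) f x <= avge s (b N) (t N) f x.
Variable A : R.
Hypothesis A0 : 0 <= A.
Hypothesis uA : forall i x (h : R),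
  u (x + h *: ee i) + u (x - h *: ee i) - 2 * u x <= A * h ^+ 2.
Hypothesis vsub : forall x0 phi, C2 phi -> local_max_at (fun x => v x - phi x) x0 ->
  (forall i, `|partial i phi x0| <= 1) /\ l <= Qop s b0' (hess phi x0) (grad phi x0) x0.

(** At a maximum of v - W / tau the subsolution property bounds the gradient of W by tau < 1, which
    is just what the approximate supersolution inequality for W asks for. *)
Lemma comparison_sub : l <= k.
Proof.
apply: (@le_of_scaling _ _ _ (scale_const s b0')) => tau /andP[tau0 tau1].
have ti : 1 < tau^-1 by rewrite invf_gt1.
(* Half of the gap between the growth rates of W / tau and v is spent on the growth error of v; the
   other half gives coercivity. *)
pose e := (tau^-1 - 1) / 2; have e0 : 0 < e by rewrite /e; lra.
have [c vc] := unit_growth_bounds vC vG e0.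
pose D := c + tau^-1 * (C + 1).
(* M bounds the maximum point independently of r, so r can be chosen afterwards, in terms of
   [tilt_const], which depends on M. *)
pose M := Num.max ((D - v 0 + tau^-1) / e + 1) 0.
have M0 : 0 <= M by rewrite le_max lexx orbT.
have M1 : (D - v 0 + tau^-1) / e + 1 <= M by rewrite le_max lexx.
pose th := (1 - tau) / 4; have th0 : 0 < th by rewrite /th; lra.
have tth : tau + 4 * th <= 1 by rewrite /th; lra.
apply/ler_addgt0Pr => d d0.
have L0 : 0 <= 2 * A * n%:R by rewrite !mulr_ge0.
have [r r0 [r1 rL rK]] := radius L0 (K_ge0 M0) th0 d0.
pose W := smoothlog r u; have W2 : C2 W := smoothlog_C2 r0 uL.
pose f x := 1 * v x + (- tau^-1) * W x.
have fD x : f x <= D - e * l1norm x.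
  have /andP[W1 _] := W_bounds x r0 r1; have := vc x; rewrite ler_norml => /andP[_ v1].
  have := ler_wpM2l (ltW (lt_trans ltr01 ti)) W1.
  rewrite /f /D /e in v1 *; rewrite -/W => w1; lra.
have [x0 x0M fmax] := coercive_max (@contB 1 (- tau^-1) _ r0) e0 fD.
have {}x0M : l1norm x0 + 1 <= M.
  apply: le_trans M1; rewrite lerD2r ler_pdivlMr // mulrC; apply: (le_trans x0M).
  have /andP[_ W1] := W_bounds 0 r0 r1; rewrite l1norm0 add0r in W1.
  have := ler_wpM2l (ltW (lt_trans ltr01 ti)) W1; rewrite /f -/W; lra.
have lm : local_max_at (fun x => v x - tau^-1 * W x) x0.
  by apply/nbhs_l1P; exists 1 => // y _ /=; have := fmax y; rewrite /f -/W; lra.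
have [p1 lQ] := vsub (C2Z tau^-1 W2) lm.
have hW : forall i, `|partial i W x0| <= tau.
  move=> i; have := p1 i; rewrite partialZ; last exact: W2.1.
  by rewrite normrM gtr0_norm ?invr_gt0 // mulrC ler_pdivrMr // mul1r.
have [eta eta0 slope] := smoothlog_slope (FF:=FF) dp uu A0 uA r0 th0 tth rL hW.
have hk := lim_smooth_sup (FF:=FF) J0 C0 B0 t0 tp t1 bB dp uu kk r0 M0 r1 b'B bb' b'_le th0 eta0 x0M slope.
have sc := @Qop_scale _ _ _ s b0' (hess (fun x => tau^-1 * W x) x0)
  (grad (fun x => tau^-1 * W x) x0) x0 tau.
have t01 : 0 <= tau <= 1 by rewrite !ltW.
have q1 i : `|grad (fun x => tau^-1 * W x) x0 i 0| <= 1 by rewrite mxE.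
have {sc} := sc t01 q1; rewrite hessZ // gradZ; last exact: W2.1.
rewrite !scalerA divff ?gt_eqF // !scale1r.
rewrite -(hessZ tau^-1 x0 W2) -(gradZ tau^-1 x0 W2.1) -/W in hk *.
have := ler_wpM2l (ltW tau0) lQ; rewrite /W; lra.
Qed.

End Sub.

Variable b0 : J -> 'cV[R]_n.
Hypothesis bb : forall j, (fun N => b N j) @ F --> b0 j.
Hypothesis vsup : forall x0 psi, C2 psi -> local_min_at (fun x => v x - psi x) x0 ->
  (forall i, `|partial i psi x0| < 1) -> Qop s b0 (hess psi x0) (grad psi x0) x0 <= l.

(** W is 1-Lipschitz, so the gradient of tau W is at most tau < 1, and the supersolution property at
    a minimum of v - tau W reduces to the operator part. *)
Lemma comparison_sup : k <= l.
Proof.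
apply: (@le_of_scaling _ _ _ (scale_const s b0)) => tau /andP[tau0 tau1].
pose e := (1 - tau) / 2; have e0 : 0 < e by rewrite /e; lra.
have [c vc] := unit_growth_bounds vC vG e0.
pose D := c + tau.
pose M := Num.max ((D + v 0 + tau * (C + 1)) / e + 1) 0.
have M0 : 0 <= M by rewrite le_max lexx orbT.
have M1 : (D + v 0 + tau * (C + 1)) / e + 1 <= M by rewrite le_max lexx.
apply/ler_addgt0Pr => d d0.
have [r r0 [r1 _ rK]] := radius (lexx 0) (K_ge0 M0) ltr01 d0.
pose W := smoothlog r u; have W2 : C2 W := smoothlog_C2 r0 uL.
pose f x := -1 * v x + tau * W x.
have fD x : f x <= D - e * l1norm x.
  have /andP[_ W1] := W_bounds x r0 r1; have := vc x; rewrite ler_norml => /andP[v1 _].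
  have := ler_wpM2l (ltW tau0) W1.
  rewrite /f /D /e in v1 *; rewrite -/W => w1; lra.
have [x0 x0M fmax] := coercive_max (@contB (-1) tau _ r0) e0 fD.
have {}x0M : l1norm x0 + 1 <= M.
  apply: le_trans M1; rewrite lerD2r ler_pdivlMr // mulrC; apply: (le_trans x0M).
  have /andP[W1 _] := W_bounds 0 r0 r1; rewrite l1norm0 add0r in W1.
  have := ler_wpM2l (ltW tau0) W1; rewrite /f -/W; lra.
have W1 i : `|partial i W x0| <= 1.
  apply: (lip1_touch (u := W)) W2.1 _; first exact: smoothlog_lip.
  by apply/nbhs_l1P; exists 1 => // y _ /=; rewrite !subrr.
have lm : local_min_at (fun x => v x - tau * W x) x0.
  by apply/nbhs_l1P; exists 1 => // y _ /=; have := fmax y; rewrite /f -/W; lra.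
have hl : Qop s b0 (tau *: hess W x0) (tau *: grad W x0) x0 <= l.
  rewrite -(hessZ tau x0 W2) -(gradZ tau x0 W2.1); apply: (vsup (C2Z tau W2) lm) => i.
  rewrite partialZ; last exact: W2.1.
  rewrite normrM gtr0_norm //; apply: le_lt_trans tau1.
  by rewrite ler_piMr // ltW.
have hk := lim_smooth_sub (FF:=FF) J0 C0 B0 t0 tp t1 bB dp uu kk r0 M0 r1 bb x0M.
have t01 : 0 <= tau <= 1 by rewrite !ltW.
have q1 i : `|grad W x0 i 0| <= 1 by rewrite mxE.
have := @Qop_scale _ _ _ s b0 (hess W x0) (grad W x0) x0 tau t01 q1.
have K4 : 0 <= 4 * tilt_const S B M * ((2 * n)%:R * r).
  by rewrite mulr_ge0 ?mulr_ge0 ?K_ge0 // ltW.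
have K5 : tau * (4 * tilt_const S B M * ((2 * n)%:R * r)) <=
    4 * tilt_const S B M * ((2 * n)%:R * r) by rewrite ler_piMl // ltW.
have := ler_wpM2l (ltW tau0) hk; rewrite -/S -/W; lra.
Qed.

End Comparison.

(** * The matrix equation *)

Section FinalTools.
Context {R : realType} {n : nat}.
Implicit Types (f u : 'cV[R]_n -> R) (x y z w p : 'cV[R]_n) (X Y : 'M[R]_n).

Lemma lip1_continuous u : lip1 u -> continuous u.
Proof.
move=> uL; apply: (@lipschitz_l1_continuous _ _ 1) => x y.
by rewrite mul1r; exact: lip1_norm.
Qed.

Lemma lip1_lsc u : lip1 u -> lsc u.
Proof.
move=> uL x a; rewrite lte_fin => ax.
exists [set y | l1norm (y - x) <= (u x - a) / 2].
  by apply/nbhs_l1P; exists ((u x - a) / 2) => //; lra.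
move=> y /=; rewrite lte_fin l1normB => yx; have := uL x y; lra.
Qed.

Lemma lip1_usc u : lip1 u -> usc u.
Proof.
move=> uL x a; rewrite lte_fin => ax.
exists [set y | l1norm (y - x) <= (- u x - a) / 2].
  by apply/nbhs_l1P; exists ((- u x - a) / 2) => //; lra.
move=> y /=; rewrite lte_fin => yx; have := uL y x; lra.
Qed.

Lemma unit_growth_of_bounds u C : (forall x, l1norm x - C <= u x <= l1norm x) -> unit_growth u.
Proof.
move=> uB; apply/cvgrPdist_le => e e0; exists (`|C| / e) => // x /= xM.
have x0 : 0 < l1norm x.
  apply: lt_le_trans (enorm_le_l1norm x); apply: le_lt_trans xM.
  by rewrite divr_ge0 // ltW.
rewrite -/(l1norm x); have /andP[u1 u2] := uB x.
have -> : 1 - u x / l1norm x = (l1norm x - u x) / l1norm x by field; rewrite gt_eqF.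
rewrite normrM normfV (gtr0_norm x0) ler_pdivrMr // ger0_norm ?subr_ge0 //.
apply: (@le_trans _ _ `|C|); first by have := ler_norm C; lra.
rewrite mulrC -ler_pdivrMr //; apply: (le_trans (ltW xM)); exact: enorm_le_l1norm.
Qed.

Lemma cvx_convex_function u : cvx u -> convex_function [set: convex_lmodType 'cV[R]_n] u.
Proof.
move=> uC t x y _ _; apply: uC.
by apply/andP; split; [exact: ge0|exact: le1].
Qed.

End FinalTools.

Section Operator.
Context {R : realType} {n : nat}.
Variables (sigma A : 'M[R]_n).
Hypothesis n_gt0 : (0 < n)%N.
Hypothesis sigma_unit : sigma \in unitmx.
Hypothesis A_sym : A^T = A.
Implicit Types (f u : 'cV[R]_n -> R) (x y z w p : 'cV[R]_n) (X Y : 'M[R]_n).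
Local Notation ee i := (delta_mx i 0 : 'cV[R]_n).
Local Notation J := ('I_n + 'I_n)%type.

Definition drift_dir (j : J) : 'cV[R]_n := if j is inl i then col i sigma else 0.

(* The directions d e_i with zero drift add a Laplacian of size d^2 to the
   operator, which makes its solutions C^{1,1} whatever A is. *)
Definition step_dir (d : R) (j : J) : 'cV[R]_n :=
  match j with inl i => A *m col i sigma | inr i => d *: ee i end.

Local Notation s := drift_dir.
Local Notation b := step_dir.

Lemma dot_mulmx x Y y : dot x (Y *m y) = dot (Y^T *m x) y.
Proof.
rewrite /dot; under eq_bigr do rewrite mxE mulr_sumr.
rewrite exchange_big; apply: eq_bigr => j _; rewrite mxE mulr_suml.
by apply: eq_bigr => i _; rewrite mxE; ring.
Qed.

Lemma mxtrace_qform Y : \tr (sigma *m sigma^T *m Y) = \sum_i qform Y (col i sigma).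
Proof.
rewrite -mulmxA mxtrace_mulC -mulmxA /mxtrace.
apply: eq_bigr => i _; rewrite mxE /qform /dot.
apply: eq_bigr => k _; rewrite 3!mxE [in RHS]mxE; congr (_ * _).
by apply: eq_bigr => l _; rewrite !mxE.
Qed.

Lemma card_J : (0 < #|{: J}|)%N.
Proof. by rewrite card_sum card_ord addn_gt0 n_gt0. Qed.

(** The trace is the sum over the columns c of sigma of the quadratic form of the bracket at c. With
    [s_j = c] and [b_j = A c], its three terms give [dot (s j) (b j)], [qform X (b j)] and the
    square, as A is symmetric. The [inr] indices contribute 0 at d = 0; the factor [#|J|] undoes the
    averaging in [Qop]. *)
Lemma GE X p x : G sigma X p x A = - (#|{: J}|%:R * Qop s (b 0) X p x).
Proof.
rewrite /G /Qop mulrA; congr (- _).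
have -> : #|{: J}|%:R / (2 * #|{: J}|%:R) = 2^-1 :> R.
  by rewrite invfM mulrCA divff ?mulr1 // pnatr_eq0 -lt0n card_J.
congr (_ * _); rewrite mxtrace_qform big_sumType /=.
rewrite [X in _ = _ + X]big1 ?addr0; last first.
  by move=> i _; rewrite /qform scale0r !dot0l !dot0r addr0 expr0n /= !addr0.
apply: eq_bigr => i _; set c := col i sigma.
have e1 : qform (tensor (x + A *m p) (x + A *m p)) c = dot c (x + A *m p) ^+ 2.
  rewrite /qform expr2 {2}/dot.
  have -> : tensor (x + A *m p) (x + A *m p) *m c = dot c (x + A *m p) *: (x + A *m p).
    apply/matrixP => k l; rewrite (ord1 l) [LHS]mxE [RHS]mxE /dot mulr_suml.
    by apply: eq_bigr => j _; rewrite mxE; ring.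
  by rewrite dotZr.
have e2 : qform (A *m X *m A) c = qform X (A *m c).
  by rewrite /qform -!mulmxA dot_mulmx A_sym.
have e3 : dot c (A *m p) = dot p (A *m c) by rewrite dotC dot_mulmx A_sym dotC dotC.
rewrite /qform !mulmxDl !dotDr -![dot c (_ *m c)]/(qform _ c) e1 e2 dotDr e3.
by rewrite /qform.
Qed.

Lemma pde_le0P l X p x : pde sigma A l X p x <= 0 <->
  (forall i, `|p i 0| <= 1) /\ l <= #|{: J}|%:R * Qop s (b 0) X p x.
Proof.
rewrite /pde GE; split.
  move=> /bigmax_leP[h1 h2]; split; last by rewrite -subr_le0.
  by move=> i; rewrite -subr_le0; exact: h2.
move=> [h1 h2]; apply/bigmax_leP; split; first by rewrite subr_le0.
by move=> i _; rewrite subr_le0.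
Qed.

Lemma pde_ge0P l X p x : 0 <= pde sigma A l X p x <->
  ((forall i, `|p i 0| < 1) -> #|{: J}|%:R * Qop s (b 0) X p x <= l).
Proof.
rewrite /pde GE; split.
  move=> h p1; rewrite leNgt; apply/negP => hl; move: h; apply/negP; rewrite -ltNge.
  apply/bigmax_ltP; split; first by rewrite subr_lt0.
  by move=> i _; rewrite subr_lt0.
move=> h; have [/forallP p1|] := boolP [forall i, `|p i 0| < 1].
  apply: (@le_trans _ _ (l - #|{: J}|%:R * Qop s (b 0) X p x)).
    by rewrite subr_ge0 h.
  exact: bigmax_ge_id.
rewrite negb_forall => /existsP[i]; rewrite -leNgt => hi.
apply: (@le_trans _ _ (`|p i 0| - 1)); first by rewrite subr_ge0.
exact: (le_bigmax _ (fun i => `|p i 0| - 1) i).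
Qed.

(** The numbers [dot (s j) y] with [j = inl k] are the coordinates of [sigma^T *m y], and [sigma^T]
    is invertible. *)
Lemma coercivity : exists2 g : R, 0 <= g & forall y M,
  (forall j, `|dot (s j) y| <= M) -> l1norm y <= g * M.
Proof.
have sT : sigma^T \in unitmx by rewrite unitmx_tr.
exists (\sum_i \sum_k `|invmx sigma^T i k|).
  by apply: sumr_ge0 => i _; apply: sumr_ge0.
move=> y M hM; rewrite /l1norm mulr_suml; apply: ler_sum => i _.
rewrite -{1}(mulKmx sT y) mxE mulr_suml.
apply: (le_trans (ler_norm_sum _ _ _)); apply: ler_sum => k _.
rewrite normrM ler_wpM2l //; have := hM (inl k); rewrite /dot /= mxE.
by under eq_bigr do rewrite mxE; under [X in _ -> `|X| <= _]eq_bigr do rewrite mxE.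
Qed.

Lemma step_dir_bound : exists2 B : R, 0 <= B & forall d j, `|d| <= 1 -> l1norm (b d j) <= B.
Proof.
have S0 : 0 <= \sum_i l1norm (A *m col i sigma).
  by apply: sumr_ge0 => i _; exact: l1norm_ge0.
exists (\sum_i l1norm (A *m col i sigma) + 1); first by rewrite addr_ge0.
move=> d [i|i] d1 /=; last by rewrite l1normZ l1norm_delta mulr1; lra.
rewrite (bigD1 i) //= -addrA lerDl addr_ge0 // sumr_ge0 // => j _; exact: l1norm_ge0.
Qed.

(** An extra direction contributes a pair centred at x; for convex f its sum is smallest when the
    pair collapses to x, that is at d = 0. *)
Lemma avge_step0 t d f x : cvx f -> avge s (b 0) t f x <= avge s (b d) t f x.
Proof.
move=> fC; rewrite /avge ler_wpM2r ?invr_ge0 ?mulr_ge0 //.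
apply: ler_sum => -[i|i] _ //; rewrite /stepe /= !dot0l !mulr0 !addr0 !scale0r !scaler0 !addr0.
set y := x + _; set z := x + _; have hm := cvx_mid x (t *: (d *: ee i)) fC.
have h : f x <= (f y + f z) / 2 by move: hm; rewrite /y /z scaleNr; lra.
apply: le_trans (expR_pair_ge _ _).
have := ler_expR (f x) ((f y + f z) / 2); rewrite h => h2.
have := sqr_ge0 ((f y - f z) / 2); have := expR_ge0 ((f y + f z) / 2); nra.
Qed.

Lemma step_dir_span k : A \in unitmx -> exists c : 'I_n -> R,
  ee k = \sum_i c i *: (A *m col i sigma).
Proof.
move=> A_unit; pose c := invmx sigma *m (invmx A *m ee k); exists (fun i => c i 0).
have -> : ee k = A *m (sigma *m c) by rewrite /c mulKVmx // mulKVmx.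
have -> : sigma *m c = \sum_i c i 0 *: col i sigma.
  apply/matrixP => l j; rewrite (ord1 j) mxE summxE; apply: eq_bigr => i _.
  by rewrite !mxE mulrC.
by rewrite mulmx_sumr; apply: eq_bigr => i _; rewrite -scalemxAr.
Qed.

Section ViscosityLimit.
Context {F : set_system nat} {FF : ProperFilter F}.
Variables (t d : nat -> R) (C : R) (u_ : nat -> 'cV[R]_n -> R) (k_ : nat -> R).
Variables (u : 'cV[R]_n -> R) (k : R).
Hypothesis C0 : 0 < C.
Hypothesis t0 : t @ F --> 0.
Hypothesis tp : forall N, 0 < t N.
Hypothesis t1 : forall N, t N <= 1.
Hypothesis d1 : forall N, `|d N| <= 1.
Hypothesis dp : forall N, dpair s C (t N) (b (d N)) (u_ N) (k_ N).
Hypothesis uu : forall x, (fun N => u_ N x) @ F --> u x.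
Hypothesis kk : k_ @ F --> k.

Local Notation m := (#|{: J}|%:R : R).

Let m0 : 0 < m. Proof. by rewrite ltr0n card_J. Qed.

(** With d fixed, second differences along [d0 e_i] give the C^{1,1} constant [C / d0 ^+ 2]. It
    blows up as d0 tends to 0, but it only influences the mollification radius and does not enter
    the conclusion. *)
Lemma viscosity_eigenvalue_le d0 l v : 0 < d0 -> (forall N, d N = d0) ->
  continuous v -> unit_growth v -> viscosity_subsolution (pde sigma A l) v -> l <= m * k.
Proof.
move=> d00 dE vC vG [_ vsub]; rewrite mulrC -ler_pdivrMr //.
have [B B0 bB] := step_dir_bound.
have CA : 0 <= C / d0 ^+ 2 by rewrite divr_ge0 ?sqr_ge0 // ltW.
apply: (comparison_sub (FF := FF) card_J C0 B0 t0 tp t1 (fun N j => bB _ j (d1 N)) dp uu kk vC vG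
  (b' := fun=> b 0) (b0' := b 0) _ _ _ CA).
- by move=> N j; apply: bB; rewrite normr0.
- by move=> j; exact: cvg_cst.
- by move=> N f x; exact: avge_step0.
- move=> i x h.
  have hs := @lim_semic _ _ _ F FF _ _ _ _ _ _ _ t0 tp dp uu (d0 *: ee i).
  have /hs{hs} : exists j, forall N, b (d N) j = d0 *: ee i.
    by exists (inr i) => N; rewrite dE.
  move=> /(_ x (h / d0)); rewrite scalerA divfK ?gt_eqF //.
  have -> // : C / d0 ^+ 2 * h ^+ 2 = C * (h / d0) ^+ 2 by field; rewrite gt_eqF.
- move=> x0 phi phi2 hmax; have /pde_le0P[p1 lQ] := vsub x0 phi phi2 hmax.
  by split; [move=> i; have := p1 i; rewrite mxE|rewrite ler_pdivrMr // mulrC].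
Qed.

Hypothesis d0 : d @ F --> 0.

Let bb j : (fun N => b (d N) j) @ F --> b 0 j.
Proof.
case: j => i /=; first exact: cvg_cst.
apply/cvg_l1P => e e0; near=> N.
rewrite scale0r subr0 l1normZ l1norm_delta mulr1; near: N; exact: (cvgr0_norm_le _ d0).
Unshelve. all: by end_near. Qed.

Lemma viscosity_eigenvalue_ge l v :
  continuous v -> unit_growth v -> viscosity_supersolution (pde sigma A l) v -> m * k <= l.
Proof.
move=> vC vG [_ vsup]; rewrite mulrC -ler_pdivlMr //.
have [B B0 bB] := step_dir_bound.
apply: (comparison_sup (FF := FF) card_J C0 B0 t0 tp t1 (fun N j => bB _ j (d1 N)) dp uu kk vC vG bb).
move=> x0 psi psi2 hmin p1; have /pde_ge0P hQ := vsup x0 psi psi2 hmin.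
by rewrite ler_pdivlMr // mulrC; apply: hQ => i; rewrite mxE.
Qed.

Lemma limit_lip1 : lip1 u. Proof. exact: lim_lip dp uu. Qed.

Lemma limit_viscosity_solution : viscosity_solution (pde sigma A (m * k)) u.
Proof.
have uL := limit_lip1.
split; first exact: lip1_continuous.
  split; first exact: lip1_usc.
  move=> x0 phi phi2 hmax; apply/pde_le0P; split.
    by move=> i; rewrite mxE; apply: (lip1_touch i uL phi2.1 hmax).
  rewrite ler_pM2l //; exact: (lim_viscosity_sub card_J t0 tp bb dp uu kk phi2 hmax).
split; first exact: lip1_lsc.
move=> x0 psi psi2 hmin; apply/pde_ge0P => p1; rewrite ler_pM2l //.
apply: (lim_viscosity_sup card_J C0 t0 tp t1 bb dp uu kk psi2 _ hmin) => i.
by have := p1 i; rewrite mxE.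
Qed.

Lemma limit_unit_growth : unit_growth u.
Proof.
apply: (@unit_growth_of_bounds _ _ _ C) => x; apply/andP; split; first exact: (lim_growth dp uu).
have := lip1_upper x limit_lip1; rewrite (_ : u 0 = 0) ?add0r //; exact: lim_0 dp uu.
Qed.

Lemma limit_convex : convex_function [set: convex_lmodType 'cV[R]_n] u.
Proof. by apply: cvx_convex_function; exact: lim_cvx dp uu. Qed.

Lemma limit_C1alpha (alpha : R) : A \in unitmx -> 0 < alpha < 1 -> C1alpha_loc alpha u.
Proof.
move=> A_unit a01; have uC : cvx u by exact: lim_cvx dp uu.
have uS k0 : semic u (ee k0).
  have [c ->] := step_dir_span k0 A_unit; apply: semic_sum => // i.
  exists C; first exact: ltW.
  apply: (@lim_semic _ _ _ F FF _ _ _ _ _ _ _ t0 tp dp uu).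
  by exists (inl i).
have /choice[a ha] : forall i, exists a : R, 0 <= a /\ forall x (r : R),
    u (x + r *: ee i) + u (x - r *: ee i) - 2 * u x <= a * r ^+ 2.
  by move=> i; have [a a0 h] := uS i; exists a.
pose a0 := \sum_i a i.
have a0_ge0 : 0 <= a0 by apply: sumr_ge0 => i _; case: (ha i).
have uA i x (r : R) : u (x + r *: ee i) + u (x - r *: ee i) - 2 * u x <= a0 * r ^+ 2.
  apply: (le_trans ((ha i).2 x r)); rewrite ler_wpM2r ?sqr_ge0 //.
  by rewrite /a0 (bigD1 i) //= lerDl sumr_ge0 // => j _; case: (ha j).
have u1 : C1 u := semic_C1 uC a0_ge0 uA.
apply: (lip_C1alpha u1 limit_lip1 _ (semic_grad_lip uC a0_ge0 uA)) => //.
  by rewrite !mulr_ge0.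
move=> i x; apply: (lip1_touch i limit_lip1 u1).
by apply/nbhs_l1P; exists 1 => // y _ /=; rewrite !subrr.
Qed.

End ViscosityLimit.

End Operator.

Lemma dpair_limit (R : realType) (n : nat) (J : finType) (F : set_system nat)
    (s : J -> 'cV[R]_n) (C : R) (t : nat -> R) (b : nat -> J -> 'cV[R]_n)
    (u_ : nat -> 'cV[R]_n -> R) (k_ : nat -> R) : UltraFilter F ->
  (forall N, dpair s C (t N) (b N) (u_ N) (k_ N)) ->
  exists u : 'cV[R]_n -> R, exists k : R,
    (forall x, (fun N => u_ N x) @ F --> u x) /\ k_ @ F --> k.
Proof.
move=> FU dp.
have [k kk] : exists k : R, k_ @ F --> k.
  by apply: (@ultra_lim _ F k_ C) => N; exact: dp_k (dp N).
have /choice[u uu] : forall x, exists l : R, (fun N => u_ N x) @ F --> l.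
  move=> x; apply: (@ultra_lim _ F _ (l1norm x)) => N.
  by have := lip1_norm x 0 (dp_lip (dp N)); rewrite (dp_0 (dp N)) !subr0.
by exists u, k.
Qed.

Theorem theorem1p1 (R : realType) (n : nat) (n_gt0 : (0 < n)%N)
    (sigma : 'M[R]_n) (sigma_unit : sigma \in unitmx)
    (A : 'M[R]_n) (A_sym : A^T = A) :
  exists lambda : R,
    unique (fun l : R => exists u : 'cV[R]_n -> R,
              viscosity_solution (pde sigma A l) u /\ unit_growth u) lambda /\
    exists u : 'cV[R]_n -> R,
      [/\ viscosity_solution (pde sigma A lambda) u,
          unit_growth u,
          convex_function [set: convex_lmodType 'cV[R]_n] u
        & \det A != 0 ->
          forall alpha : R, 0 < alpha < 1 -> C1alpha_loc alpha u].
Proof.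
have J0 := card_J n_gt0.
have [g g0 coer] := coercivity sigma_unit.
have [B B0 bB] := step_dir_bound sigma A.
have [C C0 [t0 t00 pairs]] := discrete_eigenpairs J0 B0 g0 coer.
pose q := Num.min 1 t0; have q0 : 0 < q by rewrite lt_min ltr01.
have q1 : q <= 1 by rewrite ge_min lexx.
have qt : q <= t0 by rewrite ge_min lexx orbT.
pose d N : R := N.+1%:R^-1; have d0 N : 0 < d N by rewrite invr_gt0.
have d1 N : d N <= 1 by rewrite invf_le1 // ler1n.
have d1' N : `|d N| <= 1 by rewrite gtr0_norm.
pose t N := q * d N; have tp N : 0 < t N by rewrite mulr_gt0.
have tq N : t N <= q by rewrite ler_piMr // ltW.
have t1 N : t N <= 1 by exact: le_trans q1.
have td N : t N <= d N by rewrite ler_piMl // ltW.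
(* An ultrafilter finer than the eventual filter keeps ordinary limits, such as those of d and t. *)
have [U [UU oU]] := ultraFilterLemma eventually_filter.
have dU : d @ U --> (0 : R) by move=> P hP; apply: oU; exact: cvg_harmonic hP.
have tU : t @ U --> (0 : R).
  by apply: (cvg_0_le dU); near=> N; rewrite gtr0_norm.
(* The first index sets the size of the extra directions, the second the time step; C depends on
   neither. *)
have /choice[p hp] : forall MN : nat * nat, exists uk : ('cV[R]_n -> R) * R,
    dpair (drift_dir sigma) C (t MN.2) (step_dir sigma A (d MN.1)) uk.1 uk.2.
  move=> [M N] /=; have tt0 : 0 < t N <= t0 by rewrite tp (le_trans (tq N) qt).
  have [u [k h]] := pairs (t N) (step_dir sigma A (d M)) tt0 (fun j => bB _ j (d1' M)).
  by exists (u, k).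
have /choice[v hv] : forall M, exists uk : ('cV[R]_n -> R) * R,
    (forall x, (fun N => (p (M, N)).1 x) @ U --> uk.1 x) /\
    (fun N => (p (M, N)).2) @ U --> uk.2.
  move=> M; have [u [k h]] := dpair_limit UU (fun N => hp (M, N)).
  by exists (u, k).
(* Diagonal choice: the step is at most [d M], and the discrete eigenvalue is within [d M] of its
   limit for fixed M. *)
have /choice[L hL] : forall M, exists N, t N <= d M /\ `|(p (M, N)).2 - (v M).2| <= d M.
  move=> M; apply: (@filter_ex _ U); near=> N; split.
    apply: le_trans (ler_norm _) _; near: N; exact: (cvgr0_norm_le _ tU).
  rewrite distrC; near: N; have /cvgrPdist_le := (hv M).2; exact.
pose t' M := t (L M); have tp' M : 0 < t' M by exact: tp.
have tU' : t' @ U --> (0 : R).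
  by apply: (cvg_0_le dU); near=> M; rewrite gtr0_norm //; exact: (hL M).1.
have dp M : dpair (drift_dir sigma) C (t' M) (step_dir sigma A (d M))
  (p (M, L M)).1 (p (M, L M)).2 := hp (M, L M).
have [u [k [uu kk]]] := dpair_limit UU dp.
set m : R := #|{: 'I_n + 'I_n}|%:R; have m0 : 0 < m by rewrite ltr0n.
have t1' M : t' M <= 1 by exact: t1.
have sol : viscosity_solution (pde sigma A (m * k)) u.
  exact: (limit_viscosity_solution n_gt0 A_sym C0 tU' tp' t1' dp uu kk dU).
have grow : unit_growth u by exact: (limit_unit_growth dp uu).
exists (m * k); split; last first.
  exists u; split=> // [|detA alpha a01]; first exact: (limit_convex dp uu).
  apply: (limit_C1alpha sigma_unit C0 tU' tp' dp uu) => //.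
  by rewrite unitmxE unitfE.
split; first by exists u.
move=> l [w [[wC wsub wsup] wG]]; apply/eqP; rewrite eq_le; apply/andP; split.
  exact: (viscosity_eigenvalue_ge n_gt0 A_sym C0 tU' tp' t1' d1' dp uu kk dU wC wG wsup).
(* The bound is proved at each fixed M, where the limit is C^{1,1}, and then passes to the diagonal
   limit k, because [(v M).2] is within [d M] of the diagonal eigenvalues. *)
have lM M : l <= m * (v M).2.
  exact: (viscosity_eigenvalue_le n_gt0 A_sym C0 tU tp t1 (fun=> d1' M)
    (fun N => hp (M, N)) (hv M).1 (hv M).2 (d0 M) (fun=> erefl) wC wG wsub).
apply: (@cvg_le_lim _ U _ (fun=> l) (fun M => m * ((p (M, L M)).2 + d M))).
- exact: cvg_cst.
- apply: cvgM; first exact: cvg_cst.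
  by rewrite -[X in _ --> X]addr0; apply: cvgD.
near=> M; apply: (le_trans (lM M)); rewrite ler_pM2l //.
by have := (hL M).2; rewrite ler_norml => /andP[]; lra.
Unshelve. all: by end_near. Qed.
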